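(* For every real $q$ with $0<q<\infty$, as $p\to\infty$ through the primes, $$\lim_{p\to\infty}\frac{M_q(F_p)}{\sqrt p}=k_q:=\left(\int_0^1\mathbb{E}\big(|G_{\mathbb{X}}(t)|^q\big)\,dt\right)^{1/q}.$$
   Context: Write $e(t):=e^{2\pi i t}$. For an odd prime $p$, the Fekete polynomial is $F_p(z):=\sum_{n=1}^{p-1}\left(\frac{n}{p}\right)z^n$, where $\left(\frac{\cdot}{p}\right)$ is the Legendre symbol modulo $p$. For a polynomial $P$ and $q>0$, $M_q(P):=\left(\int_0^1|P(e(t))|^q\,dt\right)^{1/q}$. Let $\{\mathbb{X}(m)\}_{m\in\mathbb{Z}}$ be independent identically distributed random variables taking the values $\pm1$ with probability $1/2$ each. The random process $G_{\mathbb{X}}$ on $C[0,1]$ is $$G_{\mathbb{X}}(t):=\sum_{m\in\mathbb{Z}}\frac{e(t)-1}{2\pi i(m-t)}\,\mathbb{X}(m),\qquad t\in[0,1],$$ where the series is the (almost surely existing) limit of the sums over $|m|\le M$ as $M\to\infty$, and the coefficients at $(m,t)=(0,0)$ and $(1,1)$ are interpreted by continuity (their value is $-1$). *)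

(* Defs.v *)
From HB Require Import structures.
From mathcomp Require Import all_boot all_order all_algebra.
From mathcomp Require Import finmap complex.
From mathcomp Require Import all_classical all_reals all_analysis.

Set Implicit Arguments.
Unset Strict Implicit.
Unset Printing Implicit Defensive.

Import Order.TTheory GRing.Theory Num.Theory.
Import numFieldNormedType.Exports.

Local Open Scope classical_set_scope.
Local Open Scope complex_scope.
Local Open Scope ring_scope.

Definition legendre (n p : nat) : int :=
  if (p %| n)%N then 0
  else if [exists x : 'I_p, x ^ 2 == n %[mod p]]%N then 1 else -1.

Section Fekete.
Variable R : realType.

Definition e (t : R) : R[i] := cos (2 * pi * t) +i* sin (2 * pi * t).

Definition fekete (p : nat) : {poly R[i]} :=
  \sum_(1 <= n < p) (legendre n p)%:~R *: 'X^n.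

Definition Mq (q : R) (P : {poly R[i]}) : R :=
  (\int[lebesgue_measure]_(t in `[0, 1]) (Normc.normc P.[e t] `^ q))
    `^ q^-1.

End Fekete.

Section Process.
Context {d : measure_display} {T : measurableType d} {R : realType}
  {P : probability T R}.

Definition mutually_independent (I : choiceType) (X : I -> {RV P >-> R}) :=
  forall (J : {fset I}) (B : I -> set R),
    (forall m, m \in J -> measurable (B m)) ->
    P (\bigcap_(m in [set` J]) (X m @^-1` B m)) =
      (\prod_(m <- J) P (X m @^-1` B m))%E.

Definition iid_signs (X : int -> {RV P >-> R}) :=
  mutually_independent X /\
  forall m, P (X m @^-1` [set 1]) = (2^-1)%:E /\
            P (X m @^-1` [set -1]) = (2^-1)%:E.

(* On [0, 1], t = m only at (m, t) = (0, 0) and (1, 1), where the continuous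
   extension of (e(t) - 1) / (2 pi i (m - t)) is -1. *)
Definition coef (t : R) (m : int) : R[i] :=
  if t == m%:~R then -1
  else (e t - 1) / ((2 * pi)%:C * 'i%C * (m%:~R - t)%:C).

Definition GX_partial (X : int -> {RV P >-> R}) (t : R) (w : T) (M : nat)
    : R[i] :=
  \sum_(0 <= k < M.*2.+1)
    coef t (k%:Z - M%:Z) * (X (k%:Z - M%:Z) w)%:C.

(* Limit for the norm topology of R[i]; lim_in is total and returns 0 on the
   null set of w where the partial sums diverge. *)
Definition GX (X : int -> {RV P >-> R}) (t : R) (w : T) : R[i] :=
  [lim (GX_partial X t w M @[M --> \oo]) in (R[i] : numFieldType)].

Definition kq (X : int -> {RV P >-> R}) (q : R) : \bar R :=
  ((\int[lebesgue_measure]_(t in `[0%R, 1%R])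
      'E_P[(fun w => Normc.normc (GX X t w) `^ q)%R]) `^ q^-1)%E.

End Process.

(* Main.v *)
Require Import Defs.
From HB Require Import structures.
From mathcomp Require Import all_boot all_order all_algebra.
From mathcomp Require Import finfield zify ring lra.

Set Implicit Arguments.
Unset Strict Implicit.
Unset Printing Implicit Defensive.

Import Order.TTheory GRing.Theory Num.Theory.

Local Open Scope ring_scope.

(** Let p be an odd prime, chi the quadratic character modulo p and
    h = (p - 1) / 2. Multiplying F_p by its Gauss sum, whose modulus is
    sqrt p, turns its values into geometric sums, and for 0 < s < 1 this gives
    [[
      |F_p(e((k + s) / p))| = sqrt p * |sum_(|m| <= h) a_p(s, m) chi(k + m)|,
      a_p(s, m) = sin(pi s) / p * cot(pi (m - s) / p)
    ]]
    ([fekete_kernel]). As p grows, a_p(s, m) tends to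
    a(s, m) = sin(pi s) / (pi (m - s)), which up to a factor of modulus 1
    depending on s alone is the coefficient of X(m) in G_X(s) ([coef_phase]).
    Cutting [0, 1] into the intervals [k / p, (k + 1) / p] writes
    (M_q(F_p) / sqrt p)^q as the integral over s of the mean over k of
    |sum_m a_p(s, m) chi(k + m)|^q ([fekete_mean]). That mean converges to
    E |G_X(s)|^q uniformly in s, so the integrals converge as well.

    For random k the values chi(k + m) behave like independent signs because
    their correlations, the means over k of chi(k + c_1) ... chi(k + c_n),
    are small ([stepanov_bound]). A saving of any power of p is enough: the
    coefficients are O(1 / (1 + |m|)), so that passing from correlations to
    the n-th moment of the sum costs only a factor (log p)^n. Such a saving
    comes from Stepanov's method ([stepanov_count]), where an auxiliary
    polynomial vanishes to high order at all points at which a given product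
    of shifts takes a given quadratic character. Consequently even moments of
    the character sums are close to those of sums of independent signs
    ([power_compare]), hence bounded ([avgS_moment]), and for a fixed number
    of shifts the distribution of the characters itself converges to that of
    signs ([pattern_compare]).

    The function |x|^q is not a polynomial. For an even n > q and any eta > 0,
    [[
      | |a|^q - |b|^q | <= eta (1 + a^n + b^n) + C (a - b)^2
    ]]
    ([powR_diff_bound]), which reduces the comparison of two sums to a bound
    on their n-th moments and to the smallness of the second moment of their
    difference; for a tail |m| > M the latter is O(1 / M). This argument is
    used twice, to restrict the character sum to |m| <= M
    ([fekete_truncate]), and to compare the partial sum over |m| <= M of the
    random series with its almost sure limit ([limit_expectation]). Between
    the two, M is fixed and the characters are replaced by signs
    ([signs_limit]). Every estimate is uniform in s. *)

(** * Stepanov's method *)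

(** The Taylor coefficients at x are the derivatives divided by factorials
    l! with l < L; these are invertible modulo p because L <= p. *)
Lemma dvdp_derivn (p : nat) (P : {poly 'F_p}) (L : nat) (x : 'F_p) :
  prime p -> (L <= p)%N -> (forall l, (l < L)%N -> P^`(l).[x] = 0) ->
  ('X - x%:P) ^+ L %| P.
Proof.
move=> p_pr leLp H.
have HN l : (l < L)%N -> P^`N(l).[x] = 0.
  move=> ltlL; have := H _ ltlL; rewrite nderivn_def hornerMn -mulr_natr.
  move/eqP; rewrite mulf_eq0 => /orP[/eqP //|].
  have chp : p \in [pchar 'F_p] by apply: pchar_Fp.
  rewrite -(dvdn_pcharf chp) => dv; exfalso.
  have : (l < p)%N by apply: leq_trans leLp.
  elim: l dv {ltlL} => [|l IH]; first by rewrite fact0 Euclid_dvd1.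
  rewrite factS Euclid_dvdM // => /orP[/dvdn_leq dv|/IH IH'] lt.
    by have := dv isT; lia.
  by apply: IH'; lia.
have -> : P = \sum_(i < size P) (P^`N(i).[x])%:P * ('X - x%:P) ^+ i.
  have := @nderiv_taylor _ (P ^:P) x%:P ('X - x%:P) (mulrC _ _).
  rewrite addrC subrK -/('X \Po _) => E.
  rewrite -{1}(comp_polyXr P) /comp_poly E size_map_polyC.
  by apply: eq_bigr => i _; rewrite nderivn_map horner_map.
apply: (big_ind (fun u => ('X - x%:P) ^+ L %| u)) => [|u v|i _].
- exact: dvdp0.
- exact: dvdp_add.
case: (ltnP i L) => ltiL; first by rewrite HN // mul0r dvdp0.
by apply: dvdp_mull; apply: dvdp_exp2l.
Qed.

(** The factors ('X - x)^L are pairwise coprime, so their product divides P.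
    This is where Stepanov's method turns zeros of high order into an upper
    bound for the number of points. *)
Lemma size_high_mult (K : fieldType) (P : {poly K}) (L : nat) (s : seq K) :
  P != 0 -> uniq s -> (forall x, x \in s -> ('X - x%:P) ^+ L %| P) ->
  (L * size s < size P)%N.
Proof.
move=> P0 us H.
suff dv : (\prod_(x <- s) ('X - x%:P)) ^+ L %| P.
  have := dvdp_leq P0 dv.
  have m : (\prod_(x <- s) ('X - x%:P)) ^+ L \is monic.
    by rewrite rpredX // monic_prod_XsubC.
  have n0 : \prod_(x <- s) ('X - x%:P) != 0 by rewrite monic_neq0 ?monic_prod_XsubC.
  have := size_exp (\prod_(x <- s) ('X - x%:P)) L.
  rewrite size_prod_XsubC /= => E; move: (monic_neq0 m).
  rewrite -size_poly_gt0 mulnC -E => s0 le; apply: leq_trans le.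
  by rewrite prednK.
elim: s us H => [|x s IH] /= us H; first by rewrite big_nil expr1n dvd1p.
case/andP: us => xs us.
rewrite big_cons exprMn Gauss_dvdp; last first.
  apply: coprimep_expl; rewrite coprimep_sym; apply: coprimep_expl.
  by rewrite coprimep_XsubC root_prod_XsubC.
by rewrite H ?inE ?eqxx // IH // => y ys; apply: H; rewrite inE ys orbT.
Qed.

Section DerivNum.
Variable K : fieldType.
Implicit Types (f r : {poly K}).

(** The cofactor of f^(m - l) in the l-th derivative of f^m r. The point of
    isolating it is that its degree grows by deg f per derivation whatever m
    is, while m itself will be of the order of p. *)
Fixpoint deriv_num f (m l : nat) r : {poly K} :=
  if l is l'.+1 then (f^`() * deriv_num f m l' r) *+ (m - l') + f * (deriv_num f m l' r)^`()
  else r.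

Lemma deriv_numE f m l r : (l <= m)%N -> (f ^+ m * r)^`(l) = f ^+ (m - l) * deriv_num f m l r.
Proof.
elim: l => [|l IH] lm; first by rewrite subn0.
rewrite derivnS IH ?(ltnW lm) // derivM deriv_exp /=.
have -> : (m - l = (m - l.+1).+1)%N by lia.
move: (m - l.+1)%N => n; rewrite /=; move: (deriv_num f m l r) => u.
rewrite mulrDr mulrnAr mulrnAl !mulrA -exprSr.
by rewrite (mulrC (f^`())).
Qed.

Lemma deriv_numB f m l r r' : deriv_num f m l (r - r') = deriv_num f m l r - deriv_num f m l r'.
Proof.
elim: l => [//|l /= ->]; by rewrite derivB !mulrBr mulrnBl opprD addrACA.
Qed.

Lemma size_deriv_num f m l r k D : (size f <= k.+1)%N -> (size r <= D)%N ->
  (size (deriv_num f m l r) <= D + l * k)%N.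
Proof.
move=> sf sr; elim: l => [|l IH] /=; first by rewrite addn0.
move: (deriv_num f m l r) IH => u su.
have su' : (size u^`() <= (D + l * k).-1)%N.
  have [->|u0] := eqVneq u 0; first by rewrite deriv0 size_poly0.
  by have := lt_size_deriv u0; lia.
have sf' : (size f^`() <= k)%N.
  have [->|f0] := eqVneq f 0; first by rewrite deriv0 size_poly0.
  by have := lt_size_deriv f0; lia.
have s1 := size_polyMleq f^`() u.
have s2 := size_polyMleq f u^`().
apply: leq_trans (size_polyD _ _) _; rewrite geq_max; apply/andP; split.
  rewrite -scaler_nat; apply: leq_trans (size_scale_leq _ _) _.
  by apply: leq_trans s1 _; rewrite mulSn; lia.
have [->|u0] := eqVneq u^`() 0; first by rewrite mulr0 size_poly0.
move: u0; rewrite -size_poly_gt0 => u0.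
by apply: leq_trans s2 _; rewrite mulSn; lia.
Qed.
End DerivNum.

(** Modulo 'X^p the polynomial f^p is the constant f(0)^p. Squaring the
    relation and multiplying by f shows that r_0^2 f and f(0)^p s_0^2 agree
    modulo 'X^p, hence are equal, their degrees being smaller than p. A root
    of f occurs an odd number of times on the left and an even number of
    times on the right, unless both sides vanish. Then the relation is
    divisible by 'X^p and the argument starts again. *)
Lemma stepanov_nonvanish (p : nat) (J : seq 'F_p) (D n : nat) (r s : nat -> {poly 'F_p}) :
  prime p -> odd p -> uniq J -> (0 < size J)%N -> 0 \notin J ->
  (0 < D)%N -> (D.*2 + size J <= p.+1)%N ->
  let f := \prod_(c <- J) ('X - c%:P) in
  (forall j, size (r j) <= D)%N -> (forall j, size (s j) <= D)%N ->
  \sum_(j < n) (r j + s j * f ^+ p./2) * 'X^(p * j) = 0 ->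
  forall j, (j < n)%N -> r j = 0 /\ s j = 0.
Proof.
move=> p_pr podd uJ J0 nJ D0 szp f.
have chp : p \in [pchar {poly 'F_p}] by rewrite pchar_poly pchar_Fp.
have f0 : f != 0 by rewrite monic_neq0 // monic_prod_XsubC.
have szf : size f = (size J).+1 by rewrite size_prod_XsubC.
elim: n r s => [//|n IH] r s szr szs.
rewrite big_ord_recl /= muln0 expr0 mulr1 => E.
pose A := \sum_(j < n) r j.+1 * 'X^(p * j).
pose B := \sum_(j < n) s j.+1 * 'X^(p * j).
have E' : (r 0%N + s 0%N * f ^+ p./2) +
    'X^p * (\sum_(j < n) (r j.+1 + s j.+1 * f ^+ p./2) * 'X^(p * j)) = 0.
  rewrite -[RHS]E mulr_sumr; congr (_ + _); apply: eq_bigr => j _.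
  by rewrite /bump /= add1n mulnSr addnC exprD; ring.
have EAB : (r 0%N + 'X^p * A) + (s 0%N + 'X^p * B) * f ^+ p./2 = 0.
  rewrite -[RHS]E' /A /B.
  under [in RHS]eq_bigr => j _ do rewrite mulrDl mulrAC.
  rewrite big_split /= -mulr_suml; ring.
have p0 : (0 < p)%N by exact: prime_gt0.
have [g Ef] : exists g, f = f.[0]%:P + 'X * g.
  have : root (f - f.[0]%:P) 0 by rewrite rootE !hornerE subrr.
  rewrite root_factor_theorem subr0 => /dvdpP [g Eg]; exists g.
  by rewrite mulrC -Eg addrC subrK.
have fp : f ^+ p = (f.[0] ^+ p)%:P + 'X^p * g ^+ p.
  rewrite {1}Ef exprDn_pchar ?exprMn ?rmorphXn //.
  by rewrite pnatE.
have fz : f.[0] ^+ p != 0.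
  by rewrite expf_neq0 // -rootE root_prod_XsubC.
move: fz fp; set c := (f.[0] ^+ p) => cz fp.
have E2 : (r 0%N + 'X^p * A) ^+ 2 * f = (s 0%N + 'X^p * B) ^+ 2 * f ^+ p.
  have -> : r 0%N + 'X^p * A = - ((s 0%N + 'X^p * B) * f ^+ p./2).
    by apply/eqP; rewrite -addr_eq0 EAB.
  rewrite sqrrN exprMn -mulrA -exprM -exprSr; congr (_ * f ^+ _).
  by rewrite -[RHS]odd_double_half podd muln2.
have Z0 : r 0%N ^+ 2 * f - c%:P * s 0%N ^+ 2 = 0.
  set Z := LHS.
  have [W EZ] : exists W, Z = 'X^p * W.
    exists ((2%:R * s 0%N * B + 'X^p * B ^+ 2) * f ^+ p + s 0%N ^+2 * g ^+ p
            - (2%:R * r 0%N * A + 'X^p * A ^+ 2) * f).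
    rewrite /Z; have -> : r 0%N ^+ 2 * f = (r 0%N + 'X^p * A) ^+ 2 * f
      - 'X^p * (2%:R * r 0%N * A + 'X^p * A ^+ 2) * f by ring.
    by rewrite E2 mulrBr mulrDr fp; ring.
  have szZ : (size Z <= p)%N.
    apply: leq_trans (size_polyD _ _) _; rewrite geq_max size_polyN.
    apply/andP; split.
      have := size_polyMleq (r 0%N ^+ 2) f; have := size_polyMleq (r 0%N) (r 0%N).
      by have := szr 0%N; rewrite szf -expr2; lia.
    apply: leq_trans (size_polyMleq _ _) _; rewrite size_polyC cz /=.
    apply: (@leq_trans (D + D).-1); last by lia.
    rewrite add0n expr2; apply: leq_trans (size_polyMleq _ _) _.
    by rewrite -!subn1 leq_sub2r // leq_add // szs.
  have [W0|W0] := eqVneq W 0; first by rewrite EZ W0 mulr0.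
  have := szZ; rewrite EZ mulrC size_mulXn //.
  by move: W0; rewrite -size_poly_gt0; lia.
have [r0 s0] : r 0%N = 0 /\ s 0%N = 0.
  have cP : c%:P != 0 by rewrite polyC_eq0.
  have [r0|r0] := eqVneq (r 0%N) 0.
    split=> //; move/eqP: Z0; rewrite r0 expr0n mul0r sub0r oppr_eq0.
    by rewrite mulf_eq0 (negPf cP) /= expf_eq0 => /eqP.
  exfalso; have s0 : s 0%N != 0.
    apply: contraNneq r0 => s0; move/eqP: Z0; rewrite s0 expr0n mulr0 subr0.
    by rewrite mulf_eq0 (negPf f0) orbF expf_eq0.
  have [x xJ] : exists x, x \in J by case: (J) J0 => // x ? _; exists x; rewrite inE eqxx.
  move/eqP: Z0; rewrite subr_eq0 => /eqP/(congr1 (mup x)).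
  rewrite !expr2 !mupM ?mulf_neq0 // mu_prod_XsubC count_uniq_mem // xJ.
  rewrite (@mupNroot _ _ c%:P) ?rootC // => /(congr1 odd).
  by rewrite addn1 add0n !addnn /= !odd_double.
move: E'; rewrite r0 s0 mul0r !add0r => /eqP.
rewrite mulf_eq0 expf_eq0 polyX_eq0 andbF /= => /eqP H.
have := IH (fun j => r j.+1) (fun j => s j.+1) (fun j => szr _) (fun j => szs _) H.
by move=> IH' [|j] //=; rewrite ltnS; apply: IH'.
Qed.

(** Write h = (p - 1) / 2 and consider P = f^L * sum_(j <= l) (r_j + s_j
    f^h) 'X^(p j) with deg r_j, s_j < D. At a point x where f^h = a, using
    x^p = x, the m-th derivative of P is a power of f times the value of a
    polynomial of degree less than E that depends linearly on (r, s). The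
    hypothesis on the parameters says that there are more families (r, s)
    than tuples of L such polynomials, so that some nonzero family
    annihilates all of them. Its P is nonzero by [stepanov_nonvanish] and
    vanishes to order L at every x of the set, whose size is then bounded
    through the degree of P. *)
Lemma stepanov_count (p l : nat) (J : seq 'F_p) (a : 'F_p) :
  prime p -> odd p -> uniq J -> (0 < size J)%N -> 0 \notin J -> a != 0 ->
  let k := size J in let L := l.*2 in let D := ((p.+1 - k)./2)%N in
  let f := \prod_(c <- J) ('X - c%:P) in
  (0 < l)%N -> (k < p)%N -> (L <= p)%N ->
  (L * (D + L * k + l.+1) < (l.+1).*2 * D)%N ->
  (L * #|[set x : 'F_p | f.[x] ^+ p./2 == a]| <= L * k + D + p./2 * k + p * l.+1)%N.
Proof.
move=> p_pr podd uJ J0 nJ a0 k L D f l0 kp Lp cond.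
set N := #|_|; set h := p./2.
have szf : size f = k.+1 by rewrite size_prod_XsubC.
have f0 : f != 0 by rewrite monic_neq0 // monic_prod_XsubC.
have D0 : (0 < D)%N by rewrite /D; lia.
have szp : (D.*2 + size J <= p.+1)%N by rewrite /D -/k; lia.
pose E := (D + L * k + l.+1)%N.
pose T := {ffun 'I_l.+1 -> 'rV['F_p]_D * 'rV['F_p]_D}.
pose T' := {ffun 'I_L -> 'rV['F_p]_E}.
pose Q (r s : nat -> {poly 'F_p}) (m : nat) := \sum_(j < l.+1)
  (deriv_num f L m (r j) + a *: deriv_num f (L + h) m (s j)) * 'X^j.
pose dr (v : T) (j : nat) : {poly 'F_p} := rVpoly (v (inord j)).1.
pose ds (v : T) (j : nat) : {poly 'F_p} := rVpoly (v (inord j)).2.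
(* The linear map from coefficients of (r, s) to those of the L polynomials
   that have to vanish; it cannot be injective by cardinality. *)
pose phi (v : T) : T' := [ffun m : 'I_L => poly_rV (Q (dr v) (ds v) m)].
have [v [v' [vv' Ev]]] : exists v v', v != v' /\ phi v = phi v'.
  have ninj : ~~ injectiveb phi.
    apply/injectiveP => /leq_card; rewrite !card_ffun card_prod !card_mx (card_Fp p_pr) !card_ord.
    rewrite -expnD -!expnM !mul1n leq_exp2l ?prime_gt1 //.
    by move: cond; rewrite -/E; lia.
  have /injectivePn[v [v' ne e]] := ninj.
  by exists v, v'.
pose r j := dr v j - dr v' j; pose s j := ds v j - ds v' j.
have szr j : (size (r j) <= D)%N.
  by apply: leq_trans (size_polyD _ _) _; rewrite geq_max size_polyN !size_poly.
have szs j : (size (s j) <= D)%N.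
  by apply: leq_trans (size_polyD _ _) _; rewrite geq_max size_polyN !size_poly.
have szQ (r1 s1 : nat -> {poly 'F_p}) m : (m < L)%N -> (forall j, size (r1 j) <= D)%N ->
    (forall j, size (s1 j) <= D)%N -> (size (Q r1 s1 m) <= E)%N.
  move=> mL sr ss; apply: (leq_trans (size_sum _ _ _)).
  apply/bigmax_leqP => j _.
  apply: leq_trans (size_polyMleq _ _) _; rewrite size_polyXn addnS /=.
  apply: leq_add; last exact/ltnW.
  have le1 : (D + m * k <= D + L * k)%N by rewrite leq_add2l leq_mul2r ltnW ?orbT.
  apply: leq_trans (size_polyD _ _) _; rewrite geq_max.
  rewrite (leq_trans (size_deriv_num _ _ _ _) le1) ?szf //=.
  apply: leq_trans (size_scale_leq _ _) _.
  by rewrite (leq_trans (size_deriv_num _ _ _ _) le1) ?szf.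
have Q0 m : (m < L)%N -> Q r s m = 0.
  move=> mL; have := congr1 (fun g : T' => rVpoly (g (Ordinal mL))) Ev.
  rewrite !ffunE /= !poly_rV_K; last 2 first.
  - by apply: szQ => // j; rewrite size_poly.
  - by apply: szQ => // j; rewrite size_poly.
  move/eqP; rewrite -subr_eq0 /Q -sumrB => /eqP; rewrite -[RHS]/(0 : {poly 'F_p}) => E0.
  rewrite -[RHS]E0; apply: eq_bigr => j _.
  by rewrite -mulrBl !deriv_numB scalerBr addrACA -opprD.
pose P := f ^+ L * \sum_(j < l.+1) (r j + s j * f ^+ h) * 'X^(p * j).
have P0 : P != 0.
  rewrite mulf_neq0 ?expf_neq0 //; apply: contra vv' => /eqP S0.
  have NV := stepanov_nonvanish p_pr podd uJ J0 nJ D0 szp szr szs S0.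
  apply/eqP/ffunP => j; have [/eqP + /eqP] := NV j (ltn_ord j).
  rewrite /r /s /dr /ds !inord_val !subr_eq0.
  case: (v j) => x y; case: (v' j) => x' y' /= /eqP e1 /eqP e2.
  by rewrite -[x]rVpolyK e1 rVpolyK -[y]rVpolyK e2 rVpolyK.
have PE : P = \sum_(j < l.+1) (f ^+ L * r j + f ^+ (L + h) * s j) * 'X^(p * j).
  rewrite /P mulr_sumr; apply: eq_bigr => j _; rewrite exprD; ring.
have dX (u : {poly 'F_p}) n : (u * 'X^(p * n))^`() = u^`() * 'X^(p * n).
  rewrite derivM derivXn -mulr_natr natrM.
  have -> : (p%:R : {poly 'F_p}) = 0 by apply: pcharf0; rewrite pchar_poly pchar_Fp.
  by rewrite mul0r !mulr0 addr0.
have dXn (u : {poly 'F_p}) n m : (u * 'X^(p * n))^`(m) = u^`(m) * 'X^(p * n).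
  by elim: m => // m IHm; rewrite !derivnS IHm dX.
have dP x m : (m < L)%N -> f.[x] ^+ h == a -> P^`(m).[x] = 0.
  move=> mL /eqP fx.
  (* On points of the prime field 'X^(p j) takes the value of 'X^j. *)
  have xp j : x ^+ (p * j) = x ^+ j.
    by rewrite exprM; have := expf_card x; rewrite (card_Fp p_pr) => ->.
  transitivity (f.[x] ^+ (L - m) * (Q r s m).[x]); last by rewrite Q0 // horner0 mulr0.
  rewrite PE raddf_sum /= /Q !horner_sum mulr_sumr; apply: eq_bigr => j _.
  rewrite dXn derivnD !deriv_numE ?(leq_trans (ltnW mL) (leq_addr _ _)) ?(ltnW mL) //.
  rewrite !hornerE xp.
  rewrite -addnBAC ?(ltnW mL) //.
  by rewrite exprD fx; congr (_ * _); rewrite -mulrA -mulrDr.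
have dv x : x \in enum [set x : 'F_p | f.[x] ^+ p./2 == a] -> ('X - x%:P) ^+ L %| P.
  rewrite mem_enum inE => fx; apply: (@dvdp_derivn p) => // m mL.
  exact: dP.
have := size_high_mult P0 (enum_uniq _) dv; rewrite -cardE -/N => lt.
rewrite -ltnS; apply: leq_trans lt _.
have sfn n : (size (f ^+ n) <= n * k + 1)%N.
  by have := size_poly_exp_leq f n; rewrite szf /= mulnC addn1.
rewrite /P; apply: leq_trans (size_polyMleq _ _) _.
have -> : (L * k + D + h * k + p * l.+1).+1 =
  ((L * k + 1) + (D + h * k + p * l.+1).+1).-1 by clear; lia.
rewrite -!subn1 leq_sub2r // leq_add //.
apply: leq_trans (size_sum _ _ _) _; apply/bigmax_leqP => j _.
apply: leq_trans (size_polyMleq _ _) _; rewrite size_polyXn addnS /=.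
have jp : (p * j <= p * l.+1)%N by rewrite leq_mul2l (ltnW (ltn_ord j)) orbT.
suff H : (size (r j + s j * f ^+ h)%R <= (D + h * k).+1)%N.
  by apply: leq_trans (leq_add H jp) _; rewrite addSn.
apply: leq_trans (size_polyD _ _) _; rewrite geq_max; apply/andP; split.
  by apply: leq_trans (szr j) _; rewrite -addnS leq_addr.
apply: leq_trans (size_polyMleq _ _) _.
apply: leq_trans (leq_pred _) _.
by apply: leq_trans (leq_add (szs j) (sfn h)) _; rewrite addn1 addnS.
Qed.

(** * The quadratic character and its correlations *)

Section QuadraticCharacter.
Variable p : nat.
Hypotheses (p_pr : prime p) (podd : odd p).

(** The quadratic character through Euler's criterion, the form in which its
    values 1 and -1 are level sets of a polynomial. Its agreement with the
    Legendre symbol is [legendreE]. *)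
Definition qchar (x : 'F_p) : int :=
  if x == 0 then 0 else if x ^+ p./2 == 1 then 1 else -1.

Lemma expF_half (x : 'F_p) : x != 0 -> (x ^+ p./2 == 1) || (x ^+ p./2 == -1).
Proof.
move=> x0; rewrite -eqf_sqr expr1n -exprM muln2 -[X in x ^+ X]add0n.
have : x ^+ p = x by have := expf_card x; rewrite (card_Fp p_pr).
have := odd_double_half p; rewrite podd => pE.
rewrite -[X in x ^+ X = _]pE exprS -[RHS]mulr1.
by rewrite add0n -mul2n mulnC muln2 => /(mulfI x0)->.
Qed.

Lemma F1_neqN1 : (1 : 'F_p) != -1.
Proof.
rewrite -subr_eq0 opprK -[1 + 1]/(2%:R) -(dvdn_pcharf (pchar_Fp p_pr)).
apply: contraL podd => /dvdn_leq => /(_ isT) le2.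
by have := prime_gt1 p_pr; case: (p) le2 => [|[|[]]].
Qed.

Lemma half_gt0 : (0 < p./2)%N.
Proof. by have := odd_double_half p; rewrite podd; have := prime_gt1 p_pr; lia. Qed.

Lemma qchar_eq1 x : (qchar x == 1) = (x ^+ p./2 == 1).
Proof.
rewrite /qchar; have [->|x0] := eqVneq x 0; last by case: ifP.
by rewrite expr0n eqn0Ngt half_gt0 /= eq_sym oner_eq0.
Qed.

Lemma qchar_eqN1 x : (qchar x == -1) = (x ^+ p./2 == -1).
Proof.
rewrite /qchar; have [->|x0] := eqVneq x 0.
  by rewrite expr0n eqn0Ngt half_gt0 /= [RHS]eq_sym oppr_eq0 oner_eq0.
have := expF_half x0; case: eqP => [->|_] /= => [_|->] //.
by rewrite (negPf F1_neqN1).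
Qed.

Lemma qchar_cases x : [\/ x = 0 /\ qchar x = 0, x != 0 /\ qchar x = 1 | x != 0 /\ qchar x = -1].
Proof.
rewrite /qchar; have [->|x0] := eqVneq x 0; first by constructor 1.
by case: ifP => _; [constructor 2|constructor 3].
Qed.

Lemma qcharM : {morph qchar : x y / x * y}.
Proof.
move=> x y; rewrite {1}/qchar mulf_eq0.
have [->|x0] := eqVneq x 0; first by rewrite /qchar eqxx /= mul0r.
have [->|y0] := eqVneq y 0; first by rewrite /qchar eqxx orbT /= mulr0.
rewrite /= exprMn /qchar (negPf x0) (negPf y0).
have := expF_half x0; have := expF_half y0.
have n1 := negPf F1_neqN1; have n1' : (-1 == 1 :> 'F_p) = false by rewrite eq_sym.
case: (eqVneq (x ^+ p./2) 1) => [->|_] /=;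
  case: (eqVneq (y ^+ p./2) 1) => [->|_] /=.
- by rewrite mul1r.
- by move=> /eqP-> _; rewrite mul1r n1' mul1r.
- by move=> _ /eqP->; rewrite mulr1 n1' mulr1.
- by move=> /eqP-> /eqP->; rewrite mulrNN mulr1 eqxx.
Qed.

Lemma qchar1 : qchar 1 = 1.
Proof. by rewrite /qchar oner_eq0 expr1n eqxx. Qed.

Lemma qchar_prod (I : Type) (r : seq I) (F : I -> 'F_p) :
  qchar (\prod_(i <- r) F i) = \prod_(i <- r) qchar (F i).
Proof. exact: (big_morph qchar qcharM qchar1). Qed.

Lemma sum_qchar_count (J : {set 'F_p}) (g : 'F_p -> 'F_p) :
  \sum_(x in J) qchar (g x) = #|[set x in J | qchar (g x) == 1]|%:Z -
     #|[set x in J | qchar (g x) == -1]|%:Z.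
Proof.
rewrite -(natz #|[set x in J | qchar (g x) == 1]|).
rewrite -(natz #|[set x in J | qchar (g x) == -1]|) -!sumr_const.
rewrite big_mkcond [in RHS]big_mkcond [X in _ - X]big_mkcond -sumrB /=.
apply: eq_bigr => x _; rewrite !inE; case: (x \in J) => //=.
by case: (qchar_cases (g x)) => -[_ ->].
Qed.

(** Otherwise 'X^((p - 1) / 2) - 1 would have p - 1 roots. *)
Lemma exists_nonresidue : exists g, qchar g = -1.
Proof.
have [g /eqP|H] := pickP (fun g => qchar g == -1); first by exists g.
exfalso; have a1 (x : 'F_p) : x != 0 -> x ^+ p./2 = 1.
  move=> x0; have := H x; rewrite /= qchar_eqN1.
  by have := expF_half x0; case: eqP => //= _ ->.
pose s := enum [pred x : 'F_p | x != 0].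
have := @max_poly_roots _ ('X^(p./2) - 1) s.
rewrite -size_poly_gt0 size_XnsubC ?half_gt0 // => /(_ isT).
have -> : all (root ('X^(p./2) - 1)) s.
  apply/allP => x; rewrite mem_enum inE => x0.
  by rewrite rootE !hornerE a1 // subrr.
rewrite enum_uniq => /(_ isT isT); rewrite -cardE.
have -> : #|[pred x : 'F_p | x != 0]| = p.-1.
  transitivity #|'F_p|.-1; last by rewrite card_Fp.
  by rewrite -(cardC1 (0 : 'F_p)); apply: eq_card.
by have := odd_double_half p; rewrite podd; have := half_gt0; lia.
Qed.

(** Multiplication by a nonresidue permutes the field and changes the sign
    of the sum. *)
Lemma sum_qchar0 : \sum_x qchar x = 0.
Proof.
have [g g1] := exists_nonresidue.
have g0 : g != 0 by apply: contra_eq_neq g1 => ->; rewrite /qchar eqxx.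
have : \sum_x qchar x = - \sum_x qchar x.
  rewrite {1}(reindex_inj (mulfI g0)) /= -sumrN.
  by apply: eq_bigr => x _; rewrite qcharM g1 mulN1r.
by move=> H; lia.
Qed.

(** Stepanov's method bounds from above by about p / 2 both the number of x
    at which the character of the product is 1 and the number of those at
    which it is -1. Together these are all x but the zeros of the product,
    so each number is also bounded from below and their difference is small. *)
Lemma stepanov_bound_seq (l : nat) (J : seq 'F_p) :
  uniq J -> (0 < size J)%N -> 0 \notin J -> (0 < l)%N ->
  (4 * l ^ 2 * (size J).+1 + size J < p)%N ->
  (l.*2)%:Z * `|\sum_x qchar (\prod_(c <- J) (x - c))| <=
  ((3 * l.*2 * size J + p * (size J + 3))%N : int).
Proof.
move=> uJ J0 nJ l0 cond.
have cond' : (l.*2 * ((p.+1 - size J)./2 + l.*2 * size J + l.+1) < (l.+1).*2 * (p.+1 - size J)./2)%N.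
  set k := size J in cond *; set D := (_./2).
  have D2 : (p - k <= D.*2)%N by rewrite /D; clear; lia.
  have -> : ((l.+1).*2 * D = l.*2 * D + D.*2)%N by clear; lia.
  rewrite -addnA mulnDr ltn_add2l.
  apply: leq_trans D2.
  have : (l.*2 * (l.*2 * k + l.+1) <= 4 * l ^ 2 * k.+1)%N.
    by rewrite -mulnn; clear -l0; nia.
  by move: cond; clear; lia.
have kp : (size J < p)%N by move: cond; clear; lia.
have Lp : (l.*2 <= p)%N.
  by move: cond; rewrite -mulnn; clear -l0; nia.
pose g x := \prod_(c <- J) (x - c).
have gE x : (\prod_(c <- J) ('X - c%:P)).[x] = g x.
  by rewrite horner_prod; apply: eq_bigr => c _; rewrite !hornerE.
have c1 := stepanov_count p_pr podd uJ J0 nJ (oner_neq0 _) l0 kp Lp cond'.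
have cN1 := stepanov_count p_pr podd uJ J0 nJ (_ : -1 != 0) l0 kp Lp cond'.
rewrite oppr_eq0 oner_eq0 in cN1; have {}cN1 := cN1 isT.
have := sum_qchar_count setT g.
have -> : \sum_(x in setT) qchar (g x) = \sum_x qchar (g x) by apply: eq_bigl => x; rewrite inE.
rewrite -/(g _) => ->.
set N1 := #|_|; set N2 := #|_|.
have c1' : (l.*2 * N1 <= l.*2 * size J + (p.+1 - size J)./2 + p./2 * size J + p * l.+1)%N.
  apply: leq_trans c1; rewrite leq_eqVlt; apply/orP; left; apply/eqP; congr (_ * _)%N.
  by apply: eq_card => x; rewrite !inE qchar_eq1 gE.
have c2' : (l.*2 * N2 <= l.*2 * size J + (p.+1 - size J)./2 + p./2 * size J + p * l.+1)%N.
  apply: leq_trans cN1; rewrite leq_eqVlt; apply/orP; left; apply/eqP; congr (_ * _)%N.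
  by apply: eq_card => x; rewrite !inE qchar_eqN1 gE.
have tot : (N1 + N2 + size J = p)%N.
  rewrite -[RHS](card_Fp p_pr) -cardsT -(cardsID [set x in J] setT) addnC.
  congr (_ + _)%N.
    by rewrite setTI cardsE; apply/esym/card_uniqP.
  rewrite /N1 /N2 -cardsUI.
  rewrite [X in (_ + X)%N](_ : _ = 0%N) ?addn0.
    apply: eq_card => x; rewrite !inE andbT.
    have : (g x == 0) = (x \in J).
      rewrite /g -[in RHS]root_prod_XsubC rootE gE //.
    by case: (qchar_cases (g x)) => -[+ ->]; [move=> -> | move=> /negPf-> | move=> /negPf->];
       rewrite ?eqxx => <-.
  apply: eq_card0 => x; rewrite !inE.
  by case: (qchar_cases (g x)) => -[_ ->].
move: N1 N2 c1' c2' tot J0 => N1 N2 c1' c2' tot J0; move: (size J) c1' c2' tot kp J0 => k c1' c2' tot kp J0.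
have d1 : (2 * (l.*2 * k + (p.+1 - k)./2 + p./2 * k + p * l.+1) <=
   2 * l.*2 * k + p + p * k + p * l.*2 + p.*2)%N.
  have h1 : ((p.+1 - k)./2 * 2 <= p)%N by clear -kp J0; lia.
  have h2 : (p./2 * 2 <= p)%N by clear; lia.
  have h3 : (p./2 * k * 2 <= p * k)%N by rewrite mulnAC leq_mul2r h2 orbT.
  by clear -h1 h3; lia.
move: c1' c2' d1; set B := (_ + p * l.+1)%N => c1' c2' d1.
have lp : (l.*2 * N1 + l.*2 * N2 + l.*2 * k = l.*2 * p)%N by rewrite -tot; clear; lia.
have [h|h] := leP N2 N1.
  rewrite ger0_norm; last by lia.
  rewrite mulrBr -!PoszM; clear - lp d1 c1' c2'; lia.
rewrite ler0_norm; last by lia.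
rewrite mulrN mulrBr -!PoszM; clear - lp d1 c1' c2'; lia.
Qed.

(** [stepanov_bound_seq] after a translation of x, chosen such that 0 is not
    among the zeros. *)
Lemma stepanov_bound (l : nat) (J : {set 'F_p}) :
  J != set0 -> (0 < l)%N ->
  (4 * l ^ 2 * #|J|.+1 + #|J| < p)%N ->
  (l.*2)%:Z * `|\sum_x \prod_(c in J) qchar (x + c)| <=
  ((3 * l.*2 * #|J| + p * (#|J| + 3))%N : int).
Proof.
move=> J0 l0 cond.
have [c0 c0J] : exists c0, - c0 \notin J.
  have /subsetPn[c _ cJ] : ~~ ([set: 'F_p] \subset J).
    apply/negP => /subset_leq_card; rewrite cardsT card_Fp //.
    by move: cond; clear; lia.
  by exists (- c); rewrite opprK.
pose s := [seq - (c + c0) | c <- enum J].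
have ss : size s = #|J| by rewrite size_map -cardE.
have := @stepanov_bound_seq l s; rewrite ss.
have -> : \sum_x qchar (\prod_(c <- s) (x - c)) = \sum_x \prod_(c in J) qchar (x + c).
  rewrite [RHS](reindex_inj (addIr c0)) /=; apply: eq_bigr => x _.
  rewrite qchar_prod big_map big_enum /=; apply: eq_bigr => c _.
  by rewrite opprK addrA addrAC.
apply=> //.
- by rewrite map_inj_uniq ?enum_uniq // => x y /oppr_inj/addIr.
- by rewrite card_gt0.
- apply/mapP => -[c]; rewrite mem_enum => cJ /eqP; rewrite eq_sym oppr_eq0 addr_eq0 => /eqP E.
  by rewrite -E cJ in c0J.
Qed.
End QuadraticCharacter.

(** * Averages over signs and over residues *)

Section SignAverage.
Variables (R : realFieldType) (I : finType).

Definition sg (b : bool) : R := (-1) ^+ b.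

Definition avgS (h : {ffun I -> bool} -> R) : R := (\sum_e h e) / 2 ^+ #|I|.

Lemma avgS_prod (g : I -> bool -> R) :
  avgS (fun e => \prod_i g i (e i)) = \prod_i ((g i true + g i false) / 2).
Proof.
rewrite /avgS -(bigA_distr_bigA g) -prodr_const -prodf_div.
by apply: eq_bigr => i _; rewrite big_bool.
Qed.

Lemma avgSD h1 h2 : avgS (fun e => h1 e + h2 e) = avgS h1 + avgS h2.
Proof. by rewrite /avgS big_split mulrDl. Qed.

Lemma avgSZ a h : avgS (fun e => a * h e) = a * avgS h.
Proof. by rewrite /avgS -mulr_sumr mulrA. Qed.

Lemma avgS_sum (T : finType) (h : T -> {ffun I -> bool} -> R) :
  avgS (fun e => \sum_t h t e) = \sum_t avgS (h t).
Proof. by rewrite /avgS exchange_big mulr_suml. Qed.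

Lemma avgS_cst a : avgS (fun=> a) = a.
Proof.
rewrite /avgS sumr_const card_ffun card_bool -[a *+ _]mulr_natr natrX mulfK //.
by rewrite expf_neq0 // pnatr_eq0.
Qed.

Lemma le_avgS h1 h2 : (forall e, h1 e <= h2 e) -> avgS h1 <= avgS h2.
Proof.
move=> H; rewrite ler_pM2r ?invr_gt0 ?exprn_gt0 ?ltr0n //.
by apply: ler_sum.
Qed.

Lemma eq_avgS h1 h2 : h1 =1 h2 -> avgS h1 = avgS h2.
Proof. by move=> H; rewrite /avgS; congr (_ / _); apply: eq_bigr. Qed.

Lemma avgS_char (O : {set I}) :
  avgS (fun e => \prod_(i in O) sg (e i)) = (O == set0)%:R.
Proof.
under eq_avgS do rewrite big_mkcond /=.
rewrite (avgS_prod (fun i b => if i \in O then sg b else 1)) /sg.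
have [->|/set0Pn[i iO]] := eqVneq O set0.
  by rewrite big1 // => i _; rewrite inE -[1 + 1]/(2%:R) divff ?pnatr_eq0.
by rewrite (bigD1 i) //= iO expr1 expr0 addNr !mul0r.
Qed.

End SignAverage.

Section Expansion.
Variables (R : comNzRingType) (I : finType) (n : nat).

Lemma expr_sum_ffun (F : I -> R) :
  (\sum_c F c) ^+ n = \sum_(t : {ffun 'I_n -> I}) \prod_i F (t i).
Proof.
rewrite -(bigA_distr_bigA (fun=> F)) prodr_const card_ord //.
Qed.

Definition oddset (t : {ffun 'I_n -> I}) : {set I} :=
  [set c | odd #|[set i | t i == c]|].

Lemma card_oddset t : (#|oddset t| <= n)%N.
Proof.
suff /subset_leq_card : oddset t \subset t @: setT.
  by move/leq_trans; apply; rewrite -[X in (_ <= X)%N]card_ord -cardsT leq_imset_card.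
apply/subsetP => c; rewrite inE => /odd_gt0; rewrite card_gt0.
by case/set0Pn => i; rewrite inE => /eqP <-; rewrite imset_f.
Qed.

(** Squares of signs being 1, a product of signs depends only on which
    indices occur an odd number of times. *)
Lemma prod_oddset (t : {ffun 'I_n -> I}) (y : I -> R) :
  (forall i, y (t i) ^+ 2 = 1) ->
  \prod_i y (t i) = \prod_(c in oddset t) y c.
Proof.
move=> y2; rewrite (partition_big t xpredT) //= [RHS]big_mkcond /=.
apply: eq_bigr => c _.
rewrite (eq_bigr (fun=> y c)); last by move=> i /eqP->.
rewrite prodr_const inE -(cardsE (fun i => t i == c)).
rewrite (_ : [set i in _] = [set i | t i == c]); last by apply/setP => i; rewrite !inE.
have [E|/card_gt0P[i]] := posnP #|[set i | t i == c]|; first by rewrite E.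
rewrite inE => /eqP tic; have := y2 i; rewrite tic => yc.
rewrite -[X in _ ^+ X = _]odd_double_half; set m := #|_|.
by rewrite exprD -mul2n exprM yc expr1n mulr1; case: (odd m).
Qed.

End Expansion.

Section Correlations.
Variables (R : realFieldType) (p : nat).
Hypotheses (p_pr : prime p) (podd : odd p).

Definition chi (x : 'F_p) : R := (qchar x)%:~R.

Definition avgF (g : 'F_p -> R) : R := (\sum_x g x) / p%:R.

Let p0 : 0 < p%:R :> R.
Proof. by rewrite ltr0n prime_gt0. Qed.

Lemma avgFD g1 g2 : avgF (fun e => g1 e + g2 e) = avgF g1 + avgF g2.
Proof. by rewrite /avgF big_split mulrDl. Qed.

Lemma avgFZ a g : avgF (fun e => a * g e) = a * avgF g.
Proof. by rewrite /avgF -mulr_sumr mulrA. Qed.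

Lemma avgF_sum (T : finType) (g : T -> 'F_p -> R) :
  avgF (fun e => \sum_t g t e) = \sum_t avgF (g t).
Proof. by rewrite /avgF exchange_big mulr_suml. Qed.

Lemma avgF_cst a : avgF (fun=> a) = a.
Proof. by rewrite /avgF sumr_const (card_Fp p_pr) -[a *+ _]mulr_natr mulfK ?gt_eqF. Qed.

Lemma le_avgF g1 g2 : (forall x, g1 x <= g2 x) -> avgF g1 <= avgF g2.
Proof. by move=> H; rewrite ler_pM2r ?invr_gt0 //; apply: ler_sum. Qed.

Lemma eq_avgF g1 g2 : g1 =1 g2 -> avgF g1 = avgF g2.
Proof. by move=> H; rewrite /avgF; congr (_ / _); apply: eq_bigr. Qed.

Lemma ler_norm_avgF g : `|avgF g| <= avgF (fun e => `|g e|).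
Proof.
rewrite /avgF normrM [X in _ * X]ger0_norm ?invr_ge0 ?ler0n //.
by rewrite ler_pM2r ?invr_gt0 // ler_norm_sum.
Qed.

Lemma chi_cases x : [\/ x = 0 /\ chi x = 0, x != 0 /\ chi x = 1 | x != 0 /\ chi x = -1].
Proof.
rewrite /chi; case: (qchar_cases x) => -[h ->].
- by constructor 1.
- by constructor 2.
- by constructor 3.
Qed.

Lemma chi_sqr x : x != 0 -> chi x ^+ 2 = 1.
Proof.
case: (chi_cases x) => -[h ->]; rewrite ?h ?eqxx // => _.
  by rewrite expr1n.
by rewrite sqrrN expr1n.
Qed.

Lemma chi_le1 x : `|chi x| <= 1.
Proof. by case: (chi_cases x) => -[_ ->]; rewrite ?normr0 ?normrN ?normr1. Qed.

Lemma avgF_supp_le (S : {set 'F_p}) (g : 'F_p -> R) (H : R) :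
  (forall x, x \notin S -> g x = 0) -> (forall x, `|g x| <= H) ->
  `|avgF g| <= H * #|S|%:R / p%:R.
Proof.
move=> gS gH; apply: le_trans (ler_norm_avgF _) _.
rewrite ler_pM2r ?invr_gt0 //.
rewrite (bigID (mem S)) /= [X in _ + X]big1 ?addr0; last first.
  by move=> x /gS->; rewrite normr0.
apply: le_trans (ler_sum _ (fun x _ => gH x)) _.
by rewrite sumr_const mulr_natr.
Qed.

(** For x outside this set every chi (x + c i) is a genuine sign. *)
Definition zero_shifts (I : finType) (c : I -> 'F_p) : {set 'F_p} := [set - c i | i : I].

Lemma card_zero_shifts (I : finType) (c : I -> 'F_p) : (#|zero_shifts c| <= #|I|)%N.
Proof. exact: leq_imset_card. Qed.

Lemma shift_neq0 (I : finType) (c : I -> 'F_p) x i : x \notin zero_shifts c -> x + c i != 0.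
Proof.
apply: contra => /eqP h; apply/imsetP; exists i => //.
by apply/eqP; rewrite -addr_eq0 h.
Qed.

Section Compare.
Variables (n : nat) (dlt : R).
Hypothesis dltP : forall K : {set 'F_p}, K != set0 -> (#|K| <= n)%N ->
  `|avgF (fun x => \prod_(c in K) chi (x + c))| <= dlt.
Variables (I : finType) (c : I -> 'F_p).
Hypothesis c_inj : injective c.

Lemma avgF_prod_set (O : {set I}) : (#|O| <= n)%N ->
  `|avgF (fun x => \prod_(i in O) chi (x + c i)) - (O == set0)%:R| <= dlt + (O == set0)%:R * `|dlt|.
Proof.
move=> On; have [->|O0] := eqVneq O set0.
  rewrite (@eq_avgF _ (fun=> 1)); last by move=> x; rewrite big_set0.
  by rewrite avgF_cst subrr normr0 mul1r -lerBlDl sub0r -normrN ler_norm.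
rewrite subr0 mul0r addr0.
have := @dltP (c @: O); rewrite card_imset // => H.
rewrite (@eq_avgF _ (fun x => \prod_(d in c @: O) chi (x + d))).
  by apply: H => //; rewrite imset_eq0.
by move=> x; rewrite big_imset //= => i j _ _; apply: c_inj.
Qed.

Hypothesis dlt0 : 0 <= dlt.

(** Where no factor vanishes the two products reduce to products over the
    same set of indices, for which the correlation bound applies; the at
    most n remaining x contribute O(n / p). *)
Lemma avgF_prod_tuple (t : {ffun 'I_n -> I}) :
  `|avgF (fun x => \prod_i chi (x + c (t i))) - avgS (fun e => \prod_i sg R (e (t i)))|
    <= 2 * dlt + n%:R * 2 / p%:R.
Proof.
rewrite (@eq_avgS _ _ _ (fun e => \prod_(i in oddset t) sg R (e i))); last first.
  move=> e; rewrite (prod_oddset (y := fun i => sg R (e i))) // => i.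
  by rewrite /sg -exprM mulnC exprM sqrrN expr1n expr1n.
rewrite avgS_char.
set A := avgF _; set B := (_)%:R.
have h1 := avgF_prod_set (card_oddset t).
rewrite -/B in h1; set A' := avgF _ in h1.
have -> : A - B = (A' - B) + (A - A') by ring.
apply: le_trans (ler_normD _ _) _; apply: lerD.
  apply: le_trans h1 _; rewrite /B (ger0_norm dlt0).
  by case: (_ == _); rewrite /= ?mulr0n ?mulr1n; have d0 := dlt0; lra.
have -> : A - A' = avgF (fun x => \prod_i chi (x + c (t i)) + (-1) * \prod_(i in oddset t) chi (x + c i)).
  by rewrite avgFD avgFZ mulN1r.
apply: le_trans (@avgF_supp_le (zero_shifts (c \o t)) _ 2 _ _) _.
- move=> x xb; rewrite (prod_oddset (y := fun i => chi (x + c i))) ?mulN1r ?subrr //.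
  by move=> i; rewrite chi_sqr // (@shift_neq0 _ (c \o t)).
- move=> x; apply: le_trans (ler_normD _ _) _; rewrite mulN1r normrN -[2]/(1 + 1).
  by apply: lerD; rewrite normr_prod; apply: prodr_ile1 => i; rewrite normr_ge0 chi_le1.
rewrite ler_pM2r ?invr_gt0 // mulrC ler_pM2r // ler_nat.
by apply: leq_trans (card_zero_shifts _) _; rewrite card_ord.
Qed.

(** The n-th power expands into one correlation for each n-tuple of indices. *)
Lemma power_compare (a : I -> R) :
  `|avgF (fun x => (\sum_i a i * chi (x + c i)) ^+ n) -
    avgS (fun e => (\sum_i a i * sg R (e i)) ^+ n)|
  <= (2 * dlt + n%:R * 2 / p%:R) * (\sum_i `|a i|) ^+ n.
Proof.
rewrite (@eq_avgF _ (fun x => \sum_(t : {ffun 'I_n -> I}) (\prod_i a (t i)) * \prod_i chi (x + c (t i)))); last first.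
  by move=> x; rewrite expr_sum_ffun; apply: eq_bigr => t _; rewrite big_split.
rewrite (@eq_avgS _ _ _ (fun e => \sum_(t : {ffun 'I_n -> I}) (\prod_i a (t i)) * \prod_i sg R (e (t i)))); last first.
  by move=> x; rewrite expr_sum_ffun; apply: eq_bigr => t _; rewrite big_split.
rewrite avgF_sum avgS_sum -sumrB expr_sum_ffun mulr_sumr.
apply: le_trans (ler_norm_sum _ _ _) _; apply: ler_sum => t _.
rewrite avgFZ avgSZ -mulrBr normrM normr_prod mulrC.
by apply: ler_wpM2r; [apply: prodr_ge0 => i _; exact: normr_ge0 | exact: avgF_prod_tuple].
Qed.

(** The indicator of a pattern of signs e is the product of the (1 + e_i
    chi_i) / 2, a combination of correlations among which only the empty one
    is not small. So each of the 2^|I| patterns occurs with frequency close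
    to 2^-|I|. *)
Lemma pattern_compare (h : (I -> R) -> R) (H : R) : (#|I| <= n)%N ->
  (forall y1 y2, y1 =1 y2 -> h y1 = h y2) ->
  (forall y, (forall i, `|y i| <= 1) -> `|h y| <= H) ->
  `|avgF (fun x => h (fun i => chi (x + c i))) - avgS (fun e => h (fun i => sg R (e i)))|
  <= H * (2 ^+ #|I| * (2 * dlt) + #|I|%:R * 2 / p%:R).
Proof.
move=> In hext hH.
have sg1 b : `|sg R b| <= 1 by rewrite /sg normrX normrN normr1 expr1n.
have H0 : 0 <= H by apply: le_trans (hH (fun=> 0) _) => [|i]; rewrite ?normr_ge0 ?normr0.
(* Outside of the zero shifts, ind e is the indicator of the x whose
   characters form the pattern e. *)
pose ind (e : {ffun I -> bool}) (x : 'F_p) : R := \prod_i ((1 + sg R (e i) * chi (x + c i)) / 2).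
have Eind e : `|avgF (ind e) - (2 ^+ #|I|)^-1| <= 2 * dlt.
  have -> : avgF (ind e) = (2 ^+ #|I|)^-1 * \sum_(O : {set I})
     (\prod_(i in O) sg R (e i)) * avgF (fun x => \prod_(i in O) chi (x + c i)).
    rewrite mulr_sumr /=.
    under eq_bigr do rewrite -!avgFZ.
    rewrite -avgF_sum; apply: eq_avgF => x; rewrite -mulr_sumr.
    rewrite /ind prodf_div prodr_const mulrC; congr (_ * _).
    rewrite (eq_bigr (fun i => sg R (e i) * chi (x + c i) + 1)); last by move=> i _; rewrite addrC.
    rewrite bigA_distr; apply: eq_bigr => O _.
    by rewrite -big_mkcond /= big_split.
  set s := fun O : {set I} => _.
  rewrite [X in _ - X](_ : _ = (2 ^+ #|I|)^-1 * \sum_(O : {set I}) (\prod_(i in O) sg R (e i)) * (O == set0)%:R); last first.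
    rewrite (bigD1 set0) //= big_set0 eqxx mulr1 big1 ?addr0 ?mulr1 //.
    by move=> O /negPf->; rewrite mulr0.
  rewrite -mulrBr -sumrB normrM.
  rewrite ger0_norm ?invr_ge0 ?exprn_ge0 //.
  rewrite mulrC ler_pdivrMr ?exprn_gt0 //.
  apply: le_trans (ler_norm_sum _ _ _) _.
  apply: (@le_trans _ _ (\sum_(O : {set I}) (2 * dlt))).
    apply: ler_sum => O _; rewrite /s -mulrBr normrM -[leRHS]mul1r.
    apply: ler_pM => //.
      by rewrite normr_prod; apply: prodr_ile1 => i _; rewrite normr_ge0 sg1.
    apply: le_trans (avgF_prod_set _) _; first by apply: leq_trans In; exact: max_card.
    rewrite (ger0_norm dlt0).
    by case: (_ == _); rewrite /= ?mulr0n ?mulr1n; have d0 := dlt0; lra.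
  rewrite sumr_const -[_ *+ _]mulr_natr ler_wpM2l ?mulr_ge0 //.
  have -> : #|{set I}| = (2 ^ #|I|)%N.
    by have := card_powerset [set: I]; rewrite powersetT !cardsT.
  by rewrite natrX.
pose hs (e : {ffun I -> bool}) := h (fun i => sg R (e i)).
have hsH e : `|hs e| <= H by apply: hH.
have sumind x : \sum_e ind e x = 1.
  rewrite /ind -(bigA_distr_bigA (fun i b => (1 + sg R b * chi (x + c i)) / 2)).
  rewrite big1 // => i _; rewrite big_bool /sg /= expr1 expr0.
  by field.
have ind0 e x : 0 <= ind e x.
  apply: prodr_ge0 => i _; rewrite divr_ge0 //.
  rewrite -lerBlDl sub0r.
  have : `|sg R (e i) * chi (x + c i)| <= 1.
    by rewrite normrM -[leRHS]mul1r ler_pM ?chi_le1.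
  by rewrite ler_norml => /andP[].
rewrite -/(hs _).
set A := avgF _; set B := avgS _.
pose A' := avgF (fun x => \sum_e hs e * ind e x).
have -> : A - B = (A' - B) + (A - A') by ring.
rewrite mulrDr; apply: le_trans (ler_normD _ _) _; apply: lerD.
  have -> : A' - B = \sum_e hs e * (avgF (ind e) - (2 ^+ #|I|)^-1).
    rewrite /A' /B avgF_sum /avgS mulr_suml -sumrB; apply: eq_bigr => e _.
    by rewrite avgFZ mulrBr.
  apply: le_trans (ler_norm_sum _ _ _) _.
  apply: (@le_trans _ _ (\sum_(e : {ffun I -> bool}) H * (2 * dlt))).
    by apply: ler_sum => e _; rewrite normrM ler_pM.
  by rewrite sumr_const card_ffun card_bool -[_ *+ _]mulr_natr natrX -mulrA (mulrC (2 * dlt)).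
have -> : A - A' = avgF (fun x => h (fun i => chi (x + c i)) + (-1) * \sum_e hs e * ind e x).
  by rewrite avgFD avgFZ mulN1r.
apply: le_trans (@avgF_supp_le (zero_shifts c) _ (2 * H) _ _) _.
- move=> x xb; pose ex := [ffun i => chi (x + c i) == -1].
  rewrite (bigD1 ex) //= big1 ?addr0 => [|e ne].
    have sgE i : sg R (ex i) = chi (x + c i).
      rewrite /sg ffunE; have := shift_neq0 i xb.
      case: (chi_cases (x + c i)) => -[h0 ->] _; rewrite ?eqxx ?expr1 //.
        by have := shift_neq0 i xb; rewrite h0 eqxx.
      by rewrite -subr_eq0 opprK -[1 + 1]/(2%:R) pnatr_eq0 expr0.
    rewrite /hs (hext _ _ sgE) /ind big1 ?mulr1 ?mulN1r ?subrr // => i _.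
    by rewrite sgE -expr2 chi_sqr ?shift_neq0 // -[1 + 1]/(2%:R) divff ?pnatr_eq0.
  have [i nei] : exists i, e i != ex i.
    apply/existsP; move: ne; apply: contraR; rewrite negb_exists => /forallP H1.
    by apply/eqP/ffunP => i; apply/eqP; have := H1 i; rewrite negbK.
  suff ind_i : (1 + sg R (e i) * chi (x + c i)) / 2 = 0.
    by rewrite /ind (bigD1 i) //= ind_i mul0r mulr0.
  move: nei; rewrite ffunE /sg; have := shift_neq0 i xb.
  case: (chi_cases (x + c i)) => -[h0 ->]; rewrite ?eqxx ?h0 ?eqxx // => _.
    have -> : (1 == -1 :> R) = false by rewrite -subr_eq0 opprK -[1 + 1]/(2%:R) pnatr_eq0.
    by case: (e i) => // _; rewrite /= ?expr1 mulr1 subrr mul0r.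
  by case: (e i) => // _; rewrite /= ?expr0 mul1r subrr mul0r.
- move=> x; apply: le_trans (ler_normD _ _) _; rewrite mulN1r normrN -[2]/(1 + 1) mulrDl mul1r.
  apply: lerD; first by apply: hH => i; exact: chi_le1.
  apply: le_trans (ler_norm_sum _ _ _) _; rewrite -[leRHS]mulr1 -(sumind x) mulr_sumr.
  by apply: ler_sum => e _; rewrite normrM (ger0_norm (ind0 _ _)) ler_wpM2r.
rewrite !mulrA (mulrC 2 H) -!mulrA (mulrCA _ 2 p%:R^-1).
by do 2 (apply: ler_wpM2l => //); rewrite ler_pM2r ?invr_gt0 // ler_nat card_zero_shifts.
Qed.
End Compare.
End Correlations.

From mathcomp Require Import finmap complex.
From mathcomp Require Import all_classical all_reals all_analysis.
From mathcomp Require Import measurable_realfun.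

Import numFieldNormedType.Exports.

Local Open Scope classical_set_scope.
Local Open Scope ring_scope.

(** * Elementary inequalities *)

Section RealLemmas.
Variable R : realType.
Implicit Types x y a b : R.

Lemma expr_le_expR (n : nat) x : 0 <= x -> x ^+ n <= n`!%:R * expR x.
Proof.
move=> x0; case: n => [|n]; first by rewrite expr0 fact0 mul1r -expR0 ler_expR.
have /(le_trans _) h := expR_ge1Dxn n x0.
rewrite -ler_pdivrMl ?ltr0n ?fact_gt0 // mulrC; apply: le_trans (expR_ge1Dxn n x0).
by rewrite lerDr.
Qed.

Lemma expR_upper x : x <= 1/2 -> expR x <= 1 + x + 2 * x ^+ 2.
Proof.
move=> x2; have h := expR_ge1Dx (- x).
have p1 : 0 < 1 - x by lra.
have e1 : expR x * expR (- x) = 1 by rewrite -expRD subrr expR0.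
have e0 := expR_gt0 x.
have h2 : expR x * (1 - x) <= 1 by rewrite -[leRHS]e1 ler_pM2l.
rewrite -(ler_pM2r p1); apply: le_trans h2 _.
have : 0 <= x ^+ 2 * (1 - 2 * x) by rewrite mulr_ge0 ?sqr_ge0 //; lra.
nra.
Qed.

(** The exponential moment of a sign with weight a is sub-Gaussian. The
    constant 2 in place of 1 / 2 leaves enough room to compare only the
    first terms of the series when a <= 1 / 2, and to bound trivially
    otherwise. *)
Lemma cosh_le a : (expR a + expR (- a)) / 2 <= expR (2 * a ^+ 2).
Proof.
wlog a0 : a / 0 <= a.
  move=> H; have [/H //|/ltW a0] := leP 0 a.
  by have := H (- a); rewrite opprK sqrrN addrC; apply; rewrite oppr_ge0.
have [a2|a2] := leP a (1/2).
  have h1 := expR_upper a2.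
  have h2 : expR (- a) <= 1 - a + 2 * a ^+ 2.
    by rewrite -(sqrrN a); apply: expR_upper; lra.
  by have h3 := expR_ge1Dx (2 * a ^+ 2); lra.
have h1 : expR (- a) <= expR a by rewrite ler_expR; lra.
have h2 : expR a <= expR (2 * a ^+ 2) by rewrite ler_expR; nra.
lra.
Qed.

Lemma sin_MVT x : 0 < x -> exists c, [/\ 0 <= c, c <= x & sin x = cos c * x].
Proof.
move=> x0.
have [c cx E] : exists2 c, c \in `[0, x]%R & sin x - sin 0 = cos c * (x - 0).
  apply: MVT_segment ; first exact: ltW.
  by apply: continuous_subspaceT => y; exact: continuous_sin.
exists c; move: cx; rewrite in_itv /= => /andP[-> ->]; split => //.
by move: E; rewrite sin0 !subr0.
Qed.

Lemma sin_le_id x : 0 <= x -> sin x <= x.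
Proof.
rewrite le_eqVlt => /predU1P[<-|x0]; first by rewrite sin0.
have [c [_ _ ->]] := sin_MVT x0.
by rewrite ler_piMl ?cos_le1 // ltW.
Qed.

Lemma norm_sin_le x : `|sin x| <= `|x|.
Proof.
wlog x0 : x / 0 <= x.
  move=> H; have [/H //|/ltW x0] := leP 0 x.
  by rewrite -normrN -sinN -[leRHS]normrN H // oppr_ge0.
have [x1|x1] := leP x 1.
  rewrite !ger0_norm ?sin_le_id //; apply: sin_ge0_pi; rewrite x0 /=.
  by have := pi_ge2 R; lra.
by apply: le_trans (sin_max _) _; rewrite ger0_norm // ltW.
Qed.

Lemma cos_lower x : 1 - x ^+ 2 / 2 <= cos x.
Proof.
have E : cos x = 1 - 2 * sin (x / 2) ^+ 2.
  by rewrite {1}[x]splitr -mulr2n cos_mulr2n cos2sin2; ring.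
rewrite E; have := norm_sin_le (x / 2); rewrite -ler_sqr ?nnegrE // !real_normK ?num_real //.
nra.
Qed.

(** Two duplications bring the argument down to x / 4, where cosines are
    bounded away from 0. The range is dictated by [kernel_arg_le]. *)
Lemma sin_lower x : 0 <= x -> x <= 24 / 11 -> x / 5 <= sin x.
Proof.
rewrite le_eqVlt => /predU1P[<-|x0]; first by rewrite sin0 mul0r.
move=> x1.
have x4 : 0 < x / 4 by lra.
have [c [c0 cx E]] := sin_MVT x4.
have D1 : sin x = 2 * (cos (x / 2) * sin (x / 2)).
  by rewrite {1}[x]splitr -mulr2n sin_mulr2n mulr_natl.
have D2 : sin (x / 2) = 2 * (cos (x / 4) * sin (x / 4)).
  have -> : x / 2 = (x / 4) *+ 2 by rewrite mulr2n; field.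
  by rewrite sin_mulr2n mulr_natl.
have c2 : 2 / 5 <= cos (x / 2) by have := cos_lower (x / 2); nra.
have c4 : 4 / 5 <= cos (x / 4) by have := cos_lower (x / 4); nra.
have cc : 4 / 5 <= cos c by have := cos_lower c; nra.
rewrite D1 D2 E.
have h1 : 4 / 5 * (x / 4) <= cos c * (x / 4) by apply: ler_wpM2r => //; lra.
have h2 : 4 / 5 * (4 / 5 * (x / 4)) <= cos (x / 4) * (cos c * (x / 4)).
  by apply: ler_pM => //; lra.
have h3 : 2 / 5 * (2 * (4 / 5 * (4 / 5 * (x / 4)))) <= cos (x / 2) * (2 * (cos (x / 4) * (cos c * (x / 4)))).
  by apply: ler_pM => //; lra.
lra.
Qed.

(** By the mean value theorem x cos x - sin x = x (cos x - cos c) with 0 <=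
    c <= x, which is O(x^3), while sin x is at least x / 5. *)
Lemma cot_approx x : x != 0 -> `|x| <= 24 / 11 -> `|cos x / sin x - x^-1| <= 5 * `|x|.
Proof.
wlog x0 : x / 0 < x.
  move=> H xn0 xb; have [x0|x0|/eqP] := ltgtP x 0; last by rewrite (negPf xn0).
    have := H (- x); rewrite oppr_gt0 oppr_eq0 normrN xn0 => /(_ x0 isT xb).
    by rewrite cosN sinN invrN mulrN invrN -opprD normrN.
  exact: H.
move=> xn0; rewrite (ger0_norm (ltW x0)) => xb.
have s5 := sin_lower (ltW x0) xb.
have s0 : 0 < sin x by apply: lt_le_trans s5; rewrite divr_gt0.
have -> : cos x / sin x - x^-1 = (x * cos x - sin x) / (x * sin x).
  by field; rewrite xn0 gt_eqF.
rewrite normrM normfV ler_pdivrMr; last by rewrite normr_gt0 mulf_neq0 // gt_eqF.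
rewrite (@ger0_norm _ (x * sin x)); last by rewrite mulr_ge0 // ltW.
have [c [c0 cx E]] := sin_MVT x0.
have -> : x * cos x - sin x = x * (cos x - cos c) by rewrite E; ring.
rewrite normrM (ger0_norm (ltW x0)).
have h : `|cos x - cos c| <= x ^+ 2.
  have c1 := cos_le1 x; have c2 := cos_le1 c.
  have c3 := cos_lower x; have c4 := cos_lower c.
  have c5 : c ^+ 2 <= x ^+ 2 by rewrite ler_sqr ?nnegrE // ltW.
  by rewrite ler_norml; apply/andP; split; nra.
have h1 : x * `|cos x - cos c| <= x * x ^+ 2 by rewrite ler_pM2l.
apply: le_trans h1 _; nra.
Qed.

End RealLemmas.

(** * Symmetric sums and moments of sums of signs *)

Section SymmetricSums.
Variable (V : zmodType).

(** Symmetric summation, the order in which the random series is summed. *)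
Definition ssum (M : nat) (F : int -> V) : V :=
  \sum_(0 <= k < M.*2.+1) F (k%:Z - M%:Z).

Lemma ssum_ord M F : ssum M F = \sum_(i < M.*2.+1) F (i%:Z - M%:Z).
Proof. by rewrite /ssum big_mkord. Qed.

Lemma ssum0 F : ssum 0 F = F 0.
Proof. by rewrite /ssum big_nat1. Qed.

Lemma ssumS M F : ssum M.+1 F = ssum M F + (F (- M.+1%:Z) + F M.+1%:Z).
Proof.
rewrite /ssum doubleS big_nat_recl // big_nat_recr //= sub0r addrCA; congr (_ + (_ + F _)).
  by apply: eq_bigr => i _; congr F; lia.
by lia.
Qed.

Lemma eq_ssum M F G : (forall m : int, (`|m| <= M)%N -> F m = G m) -> ssum M F = ssum M G.
Proof.
move=> FG; rewrite !ssum_ord; apply: eq_bigr => i _; apply: FG.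
by have := ltn_ord i; lia.
Qed.

Lemma ssumD M F G : ssum M (fun m => F m + G m) = ssum M F + ssum M G.
Proof. by rewrite /ssum big_split. Qed.

Lemma ssum_trunc h M F : (M <= h)%N ->
  ssum h (fun m => if (`|m| <= M)%N then F m else 0) = ssum M F.
Proof.
elim: h => [|h IH]; first by rewrite leqn0 => /eqP ->; rewrite !ssum0.
rewrite leq_eqVlt => /predU1P[<-|lt].
  by apply: eq_ssum => m ->.
by rewrite ssumS IH // !ifF ?addr0 //; lia.
Qed.

End SymmetricSums.

Section RealSums.
Variable R : realType.

Lemma ler_ssum M (F G : int -> R) : (forall m : int, (`|m| <= M)%N -> F m <= G m) ->
  ssum M F <= ssum M G.
Proof.
move=> FG; rewrite !ssum_ord; apply: ler_sum => i _; apply: FG.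
by have := ltn_ord i; lia.
Qed.

Lemma ssumZ M a (F : int -> R) : ssum M (fun m => a * F m) = a * ssum M F.
Proof. by rewrite /ssum mulr_sumr. Qed.

Lemma ssum_abs M (g : nat -> R) :
  ssum M (fun m => g `|m|%N) = g 0%N + 2 * \sum_(1 <= j < M.+1) g j.
Proof.
elim: M => [|M IH]; first by rewrite ssum0 big_geq // mulr0 addr0.
rewrite ssumS IH (@big_nat_recr _ _ _ M.+1) //=.
ring.
Qed.

Lemma ssum_abs_le M (g : nat -> R) : (forall j, 0 <= g j) ->
  ssum M (fun m => g `|m|%N) <= 2 * \sum_(0 <= j < M.+1) g j.
Proof.
move=> g0; rewrite ssum_abs [X in _ <= 2 * X]big_nat_recl // big_add1 /=.
by have := g0 0%N; lra.
Qed.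

(** From the second term on, 1 / (j + 1)^2 <= 1 / j - 1 / (j + 1)
    telescopes. *)
Lemma sum_invsq_le (M N : nat) :
  \sum_(M <= j < N) (j.+1%:R ^+ 2)^-1 <= 2 / M.+1%:R :> R.
Proof.
have [NM|MN] := leqP N M; first by rewrite big_geq // divr_ge0.
suff : \sum_(M <= j < N) (j.+1%:R ^+ 2)^-1 <= 2 / M.+1%:R - N%:R^-1 :> R.
  by move/le_trans; apply; rewrite lerBlDr lerDl invr_ge0.
elim: N MN => // N IH; rewrite ltnS leq_eqVlt => /predU1P[<-|MN].
  rewrite big_nat1; set x : R := M.+1%:R.
  have x1 : 1 <= x by rewrite ler1n.
  have -> : 2 / x - x^-1 = x^-1 by field; lra.
  by rewrite lef_pV2 ?posrE ?exprn_gt0 //; nra.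
rewrite big_nat_recr /=; last by lia.
apply: le_trans (lerD (IH MN) (lexx _)) _.
rewrite -addrA lerD2l -subr_ge0.
have N1 : 1 <= N%:R :> R by rewrite ler1n; lia.
rewrite -natr1; move: (N%:R : R) N1 => x x1.
have -> : - (x + 1)^-1 - (- x^-1 + ((x + 1) ^+ 2)^-1) = (x * (x + 1) ^+ 2)^-1.
  by field; apply/andP; split; lra.
by rewrite invr_ge0 mulr_ge0 ?sqr_ge0 //; lra.
Qed.

(** The tail of the sum of the squares of coefficients that decay like 1 /
    |m|. *)
Lemma ssum_tail_le (M N : nat) (B : R) : 0 <= B ->
  ssum N (fun m => if (`|m| <= M)%N then 0 else B * (`|m|%N.+1%:R ^+ 2)^-1) <=
  4 * B / M.+1%:R.
Proof.
move=> B0; pose g j : R := if (j <= M)%N then 0 else B * (j.+1%:R ^+ 2)^-1.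
have g0 j : 0 <= g j by rewrite /g; case: ifP => _ //; rewrite mulr_ge0 ?invr_ge0 ?sqr_ge0.
apply: le_trans (ssum_abs_le _ g0) _.
apply: (@le_trans _ _ (2 * (B * (2 / M.+1%:R)))); last first.
  by move: (M.+1%:R^-1) => z; rewrite (_ : 2 * (B * (2 * z)) = 4 * B * z) //; ring.
rewrite ler_wpM2l //; have [NM|MN] := leqP N.+1 M.+1.
  rewrite big_nat_cond big1 ?mulr_ge0 ?invr_ge0 // => j; rewrite andbT => /andP[_ jN].
  by rewrite /g -ltnS (leq_trans jN NM).
rewrite (big_cat_nat (n := M.+1)) //=; last exact: ltnW.
rewrite [X in X + _]big_nat_cond [X in X + _]big1 ?add0r; last first.
  by move=> j; rewrite andbT => /andP[_ jM]; rewrite /g -ltnS jM.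
apply: (@le_trans _ _ (\sum_(M.+1 <= j < N.+1) B * (j.+1%:R ^+ 2)^-1)).
  by apply: ler_sum => j _; rewrite /g; case: ifP => // _; rewrite mulr_ge0 ?invr_ge0 ?sqr_ge0.
rewrite -mulr_sumr ler_wpM2l //; apply: le_trans (sum_invsq_le _ _) _.
by rewrite ler_wpM2l // lef_pV2 ?posrE ?ltr0n // ler_nat.
Qed.

Definition harm (N : nat) : R := \sum_(0 <= j < N) j.+1%:R^-1.

Lemma harm_ge0 N : 0 <= harm N.
Proof. by apply: sumr_ge0. Qed.

Lemma harm_ge1 N : 1 <= harm N.+1.
Proof.
by rewrite /harm big_nat_recl // invr1 lerDl; apply: sumr_ge0.
Qed.

Lemma le_harm N N' : (N <= N')%N -> harm N <= harm N'.
Proof.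
move=> NN; rewrite /harm (big_cat_nat (n := N) (p := N')) //= lerDl; exact: sumr_ge0.
Qed.

Lemma harm_exp2 k : harm (2 ^ k) <= k.+1%:R.
Proof.
elim: k => [|k IH]; first by rewrite /harm expn0 big_nat1 invr1.
have l2 : (2 ^ k <= 2 ^ k.+1)%N by rewrite leq_exp2l.
rewrite /harm (big_cat_nat (n := 2 ^ k)) //= -[leRHS]natr1.
apply: lerD => //.
apply: le_trans (_ : \sum_(2 ^ k <= j < 2 ^ k.+1) (2 ^ k)%:R^-1 <= 1 :> R).
  rewrite big_nat_cond [leRHS]big_nat_cond; apply: ler_sum => j /andP[/andP[h _] _].
  by rewrite lef_pV2 ?posrE ?ltr0n ?expn_gt0 // ler_nat; lia.
by rewrite sumr_const_nat expnS mul2n -addnn addnK -[_ *+ _]mulr_natr mulVf //.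
Qed.

(** Powers of the logarithm b are absorbed by a small power of 2^b; this is
    what lets a power of p beat powers of log p. *)
Lemma expn_le_fact_exp2 (n b : nat) : (b.+1 ^ n <= n`! * 2 ^ (b + n))%N.
Proof.
apply: (@leq_trans ((b + n) ^_ n)).
  elim: n => [|n IH]; first by rewrite ffactn0.
  rewrite addnS ffactSS expnS leq_mul //; lia.
rewrite -bin_ffact mulnC leq_mul //.
have := expnDn 1 1 (b + n); rewrite addn1 => ->.
rewrite (bigD1 (inord n)) //= inordK; last by lia.
by rewrite !exp1n !muln1 leq_addr.
Qed.

End RealSums.

Section ExponentialMoment.
Variables (R : realType) (I : finType) (a : I -> R).
Notation S e := (\sum_i a i * sg R (e i)).

Lemma avgS_expR : avgS (fun e : {ffun I -> bool} => expR (S e)) <= expR (2 * \sum_i a i ^+ 2).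
Proof.
rewrite (@eq_avgS _ _ _ (fun e : {ffun I -> bool} => \prod_i expR (a i * sg R (e i)))); last first.
  by move=> e; rewrite expR_sum.
rewrite (avgS_prod (fun i b => expR (a i * sg R b))) mulr_sumr expR_sum.
apply: ler_prod => i _; rewrite divr_ge0 ?addr_ge0 ?expR_ge0 //=.
by rewrite /sg expr1 expr0 mulr1 mulrN1 addrC cosh_le.
Qed.

End ExponentialMoment.

Section SignMoments.
Variables (R : realType) (I : finType) (a : I -> R).
Notation S e := (\sum_i a i * sg R (e i)).

(** A form of Khinchine's inequality: |S|^n <= n! (exp S + exp (- S)), and
    the exponential moments factor over the independent signs. *)
Lemma avgS_moment (n : nat) :
  avgS (fun e : {ffun I -> bool} => `|S e| ^+ n) <= 2 * n`!%:R * expR (2 * \sum_i a i ^+ 2).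
Proof.
apply: (@le_trans _ _ (avgS (fun e : {ffun I -> bool} => n`!%:R * (expR (S e) + expR (\sum_i (- a i) * sg R (e i)))))).
  apply: le_avgS => e; apply: le_trans (expr_le_expR _ (normr_ge0 _)) _.
  rewrite ler_wpM2l //.
  have -> : \sum_i (- a i) * sg R (e i) = - S e.
    by rewrite -sumrN; apply: eq_bigr => i _; rewrite mulNr.
  have [h|h] := leP 0 (S e).
    by rewrite ger0_norm // lerDl expR_ge0.
  by rewrite ltr0_norm // lerDr expR_ge0.
rewrite avgSZ avgSD (mulrC 2) -mulrA ler_wpM2l // [leRHS]mulr_natl mulr2n lerD ?avgS_expR //.
apply: le_trans (avgS_expR _) _.
by rewrite (eq_bigr (fun i => a i ^+ 2)) // => i _; rewrite sqrrN.
Qed.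

Lemma avgS_sqr : avgS (fun e : {ffun I -> bool} => (S e) ^+ 2) = \sum_i a i ^+ 2.
Proof.
rewrite (@eq_avgS _ _ _ (fun e : {ffun I -> bool} => \sum_i \sum_j (a i * a j) * (sg R (e i) * sg R (e j)))); last first.
  move=> e; rewrite expr2 mulr_suml; apply: eq_bigr => i _.
  by rewrite mulr_sumr; apply: eq_bigr => j _; rewrite mulrACA.
rewrite avgS_sum; apply: eq_bigr => i _.
rewrite avgS_sum (bigD1 i) //= [X in _ + X]big1 ?addr0.
  rewrite avgSZ (@eq_avgS _ _ _ (fun=> 1)) ?avgS_cst ?mulr1 ?expr2 // => e.
  by rewrite /sg -expr2 -exprM mulnC exprM sqrrN expr1n expr1n.
move=> j ji; rewrite avgSZ (@eq_avgS _ _ _ (fun e => \prod_(k in [set i; j]%SET) sg R (e k))).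
  rewrite avgS_char (_ : [set i; j]%SET == finset.set0 = false) ?mulr0 //.
  by apply/negP => /eqP/setP/(_ i); rewrite !inE eqxx.
move=> e; rewrite big_setU1 ?big_set1 //=.
by rewrite inE eq_sym.
Qed.

End SignMoments.

(** * Powers and interpolation coefficients *)

Lemma powR_mono (R : realType) (q x y : R) : 0 < q -> 0 <= x -> x <= y -> x `^ q <= y `^ q.
Proof.
move=> q0 x0 xy; apply: ge0_ler_powR; rewrite ?nnegrE ?(ltW q0) //.
exact: le_trans xy.
Qed.

Section PowerFunction.
Variables (R : realType) (q : R).
Hypothesis q0 : 0 < q.

(** For small x the power itself is at most eta; for larger x the ratio y /
    x is close to 1, and the power is multiplicative. *)
Lemma powR_unif_cont (K eta : R) : 0 < K -> 0 < eta ->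
  exists2 delta, 0 < delta & forall x y, 0 <= y -> y <= x -> x <= K -> x - y < delta ->
    x `^ q - y `^ q <= eta.
Proof.
move=> K0 eta0.
pose rho := eta `^ q^-1.
have rho0 : 0 < rho by rewrite powR_gt0.
have Kq0 : 0 < K `^ q by rewrite powR_gt0.
pose v := eta / (K `^ q + eta).
have v1 : v < 1 by rewrite ltr_pdivrMr ?addr_gt0 // mul1r ltrDr.
have v0 : 0 < v by rewrite divr_gt0 ?addr_gt0.
pose u := (1 - v) `^ q^-1.
have uq : u `^ q = 1 - v by rewrite /u -powRrM mulVf ?gt_eqF // powRr1 // subr_ge0 ltW.
have u1 : u < 1.
  have -> : 1 = 1 `^ q^-1 :> R by rewrite powR1.
  by apply: gt0_ltr_powR; rewrite ?invr_gt0 ?nnegrE ?ler01 //; lra.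
exists (rho * (1 - u)); first by rewrite mulr_gt0 // subr_gt0.
move=> x y y0 yx xK dxy.
have x0 : 0 <= x by apply: le_trans yx.
have [xr|xr] := ltP x rho.
  apply: (@le_trans _ _ (x `^ q)); first by rewrite gerBl powR_ge0.
  rewrite (_ : eta = rho `^ q); last first.
    by rewrite /rho -powRrM mulVf ?gt_eqF // powRr1 // ltW.
  by apply: powR_mono => //; apply: ltW.
have xu : x * u <= y.
  have h : rho * (1 - u) <= x * (1 - u) by rewrite ler_pM2r // subr_gt0.
  lra.
have h1 : x `^ q * (1 - v) <= y `^ q.
  rewrite -uq -powRM ?powR_ge0 //; apply: powR_mono => //.
  by rewrite mulr_ge0 // powR_ge0.
have h2 : x `^ q <= K `^ q by apply: powR_mono.
have h3 : x `^ q * v <= K `^ q * v by rewrite ler_pM2r.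
have h4 : K `^ q * v <= eta.
  rewrite /v mulrA ler_pdivrMr ?addr_gt0 // mulrC ler_pM2l //; lra.
lra.
Qed.

(** Let |a| be the larger one. If |a| > K then |a|^q is a small multiple of
    |a|^n. If |a| <= K, either |a| - |b| is small and uniform continuity
    applies, or (a - b)^2 is bounded from below. *)
Lemma powR_diff_bound (n : nat) (eta : R) : ~~ odd n -> q < n%:R -> 0 < eta ->
  exists2 C, 0 <= C & forall a b,
   `| `|a| `^ q - `|b| `^ q| <= eta * (1 + a ^+ n + b ^+ n) + C * (a - b) ^+ 2.
Proof.
move=> nodd qn eta0.
have nq0 : 0 < n%:R - q by rewrite subr_gt0.
(* The threshold beyond which |a|^q <= eta |a|^n. *)
pose K := (eta^-1) `^ (n%:R - q)^-1.
have K0 : 0 < K by rewrite powR_gt0 // invr_gt0.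
have [delta d0 H] := powR_unif_cont K0 eta0.
pose C := K `^ q / delta ^+ 2.
have C0 : 0 <= C by rewrite divr_ge0 ?powR_ge0 ?sqr_ge0.
exists C => // a b.
have en (z : R) : z ^+ n = `|z| ^+ n.
  by rewrite -normrX ger0_norm // exprn_even_ge0.
wlog ba : a b / `|b| <= `|a|.
  move=> W; have [/W //|/ltW/W] := leP `|b| `|a|.
  by rewrite distrC -(opprB b) sqrrN (addrAC 1).
have dab : `|a| - `|b| <= `|a - b| by exact: lerB_dist.
have fb : `|b| `^ q <= `|a| `^ q by apply: powR_mono.
rewrite ger0_norm ?subr_ge0 // (en a) (en b).
have pa : 0 <= `|a| ^+ n by rewrite exprn_ge0.
have pb : 0 <= `|b| ^+ n by rewrite exprn_ge0.
have CC : 0 <= C * (a - b) ^+ 2 by rewrite mulr_ge0 ?sqr_ge0.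
have [aK|aK] := leP `|a| K.
  have [dd|dd] := ltP (`|a| - `|b|) delta.
    have h := H _ _ (normr_ge0 b) ba aK dd.
    have : 0 <= eta * (`|a| ^+ n + `|b| ^+ n) by rewrite mulr_ge0 ?addr_ge0 // ltW.
    lra.
  have h1 : `|a| `^ q <= K `^ q by apply: powR_mono.
  have h2 : delta ^+ 2 <= (a - b) ^+ 2.
    rewrite -[leRHS]real_normK ?num_real // ler_sqr ?nnegrE ?(ltW d0) //.
    exact: le_trans dab.
  have h3 : K `^ q <= C * (a - b) ^+ 2.
    rewrite /C mulrAC ler_pdivlMr ?exprn_gt0 // ler_pM2l ?powR_gt0 //.
    by rewrite invr_gt0.
  have : 0 <= eta * (1 + `|a| ^+ n + `|b| ^+ n) by rewrite mulr_ge0 ?addr_ge0 // ltW.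
  have := powR_ge0 `|b| q; lra.
have a0 : 0 < `|a| by apply: lt_trans aK.
have h : `|a| `^ q <= eta * `|a| ^+ n.
  rewrite -powR_mulrn // -[in leRHS](subrK q n%:R) powRD; last by rewrite (gt_eqF a0) implybT.
  rewrite mulrA ler_peMl ?powR_ge0 // -ler_pdivrMl // mulr1.
  have -> : eta^-1 = K `^ (n%:R - q).
    by rewrite /K -powRrM mulVf ?gt_eqF // powRr1 // invr_ge0 ltW.
  by apply: powR_mono => //; exact: ltW.
have : 0 <= eta * (1 + `|b| ^+ n) by rewrite mulr_ge0 ?addr_ge0 // ltW.
have := powR_ge0 `|b| q; lra.
Qed.

End PowerFunction.

Section Kernel.
Variable R : realType.
Implicit Types (s : R) (m : int).

(** Up to a factor of modulus 1 that depends on s alone, the coefficient of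
    X(m) in G_X(s). *)
Definition limit_coef s m : R := sin (pi * s) / (pi * (m%:~R - s)).

(** The weight of chi(k + m) in F_p / sqrt p at the point e((k + s) / p). *)
Definition fekete_coef (p : nat) s m : R :=
  let x := pi * (m%:~R - s) / p%:R in sin (pi * s) / p%:R * (cos x / sin x).

Lemma dist_int_gt0 s m : 0 < s -> s < 1 -> 0 < `|m%:~R - s|.
Proof.
move=> s0 s1; rewrite normr_gt0 subr_eq0; apply: contraTneq s0 => E.
move: s1; rewrite -E -leNgt ltrz1 lerz0; lia.
Qed.

Lemma dist_int_le s m : 0 < s -> s < 1 -> `|m%:~R - s| <= `|m|%N%:R + 1.
Proof.
move=> s0 s1; apply: le_trans (ler_normB _ _) _.
by rewrite (gtr0_norm s0) -intr_norm -abszE lerD // ltW.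
Qed.

(** For m = 0 and m = 1 the factor sin(pi s), which vanishes at 0 and at 1,
    compensates the small denominator; for any other m the distance to s is
    at least (|m| + 1) / 3. *)
Lemma sin_pi_le s m : 0 < s -> s < 1 ->
  `|sin (pi * s)| * (`|m|%N%:R + 1) <= 3 * (pi * `|m%:~R - s|).
Proof.
move=> s0 s1; have pi2 := pi_ge2 R; have d0 := dist_int_gt0 m s0 s1.
have s1' := sin_max (pi * s).
have [m0|mn0] := eqVneq m 0.
  rewrite m0 sub0r normrN absz0 add0r mulr1.
  have := norm_sin_le (pi * s); rewrite normrM (ger0_norm (pi_ge0 R)).
  rewrite (gtr0_norm s0); have : 0 < pi * s by rewrite mulr_gt0 // pi_gt0.
  lra.
have [m1|mn1] := eqVneq m 1.
  have -> : sin (pi * s) = sin (pi * (1 - s)).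
    rewrite mulrBr mulr1 sinB cospi sinpi; ring.
  rewrite m1 absz1 -[1 + 1]/(2%:R).
  have := norm_sin_le (pi * (1 - s)); rewrite normrM (ger0_norm (pi_ge0 R)).
  rewrite (@gtr0_norm _ (1 - s)) ?subr_gt0 //.
  have : 0 < pi * (1 - s) by rewrite mulr_gt0 ?pi_gt0 // subr_gt0.
  lra.
have h : (`|m|%N%:R + 1) <= 3 * `|m%:~R - s|.
  have [m2|m2] := leP 2 m.
    have -> : `|m|%N%:R = m%:~R :> R by rewrite -[in RHS](gez0_abs (_ : 0 <= m)) //; lia.
    have : (2%:~R : R) <= m%:~R by rewrite ler_int.
    by move=> h2; rewrite ger0_norm; lra.
  have mneg : m <= -1 by lia.
  have -> : `|m|%N%:R = - m%:~R :> R.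
    by rewrite -mulrNz -[in RHS](lez0_abs (_ : m <= 0)) //; lia.
  have : m%:~R <= ((-1)%:~R : R) by rewrite ler_int.
  by move=> h2; rewrite ltr0_norm; lra.
apply: (@le_trans _ _ (1 * (3 * `|m%:~R - s|))).
  by apply: ler_pM => //; rewrite addr_ge0.
rewrite mul1r ler_pM2l //.
by rewrite ler_peMl ?ltW //; lra.
Qed.

Lemma limit_coef_le s m : 0 < s -> s < 1 -> `|limit_coef s m| <= 3 / `|m|%N.+1%:R.
Proof.
move=> s0 s1; have pi0 := pi_gt0 R; have d0 := dist_int_gt0 m s0 s1.
rewrite /limit_coef normrM normfV normrM (gtr0_norm pi0).
rewrite ler_pdivrMr ?mulr_gt0 // mulrAC ler_pdivlMr ?ltr0n //.
by rewrite -natr1 sin_pi_le.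
Qed.

(** From pi < 4, |m - s| <= h + 1 and h >= 5: the ratio 4 (h + 1) / (2 h +
    1) is largest at h = 5. Staying below 24 / 11 keeps the argument of the
    cotangent away from pi. *)
Lemma kernel_arg_le h p s m : p = h.*2.+1 -> (5 <= h)%N -> (`|m| <= h)%N ->
  0 < s -> s < 1 -> `|pi * (m%:~R - s) / p%:R| <= 24 / 11.
Proof.
move=> pE h5 mh s0 s1; have pi0 := pi_gt0 R.
have pi4 : pi < 4 :> R by have := pihalf_lt2 R; lra.
have p0 : 0 < p%:R :> R by rewrite ltr0n pE.
rewrite !normrM normfV (gtr0_norm pi0) (gtr0_norm p0) ler_pdivrMr //.
have dle := dist_int_le m s0 s1.
apply: (@le_trans _ _ (4 * (`|m|%N%:R + 1))); first by apply: ler_pM => //; exact: ltW.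
have : (`|m|%N%:R : R) <= h%:R by rewrite ler_nat.
have : (5 : R) <= h%:R by rewrite ler_nat.
have -> : p%:R = 2 * h%:R + 1 :> R by rewrite pE -mul2n -natr1 natrM.
lra.
Qed.

Lemma fekete_coef_near h p s m : p = h.*2.+1 -> (5 <= h)%N -> (`|m| <= h)%N -> 0 < s -> s < 1 ->
  `|fekete_coef p s m - limit_coef s m| <= 20 * `|m|%N.+1%:R / p%:R ^+ 2.
Proof.
move=> pE h5 mh s0 s1; have pi0 := pi_gt0 R; have d0 := dist_int_gt0 m s0 s1.
have pi4 : pi < 4 :> R by have := pihalf_lt2 R; lra.
have p0 : 0 < p%:R :> R by rewrite ltr0n pE.
have dle := dist_int_le m s0 s1.
rewrite /fekete_coef /limit_coef; set x := pi * _ / _.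
have mn0 : m%:~R - s != 0 by rewrite -normr_gt0.
have x0 : x != 0 by rewrite /x !mulf_neq0 ?invr_eq0 // lt0r_neq0.
have nx : `|x| = pi * `|m%:~R - s| / p%:R.
  by rewrite /x !normrM normfV (gtr0_norm pi0) (gtr0_norm p0).
have xle : `|x| <= 4 * `|m|%N.+1%:R / p%:R.
  rewrite nx ler_pM2r ?invr_gt0 // -[ `|m|%N.+1%:R]natr1; apply: ler_pM => //; exact: ltW.
have xb : `|x| <= 24 / 11 by exact: (kernel_arg_le pE).
have -> : sin (pi * s) / p%:R * (cos x / sin x) - sin (pi * s) / (pi * (m%:~R - s)) =
   sin (pi * s) / p%:R * (cos x / sin x - x^-1).
  by rewrite [RHS]mulrBr; congr (_ - _); rewrite /x invf_div mulrA divfK // lt0r_neq0.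
clearbody x; rewrite !normrM normfV (gtr0_norm p0) expr2 invfM !mulrA.
rewrite [leLHS]mulrAC ler_pM2r ?invr_gt0 //.
have c := cot_approx x0 xb; have s1' := sin_max (pi * s).
apply: (@le_trans _ _ (1 * (5 * `|x|))); first exact: ler_pM.
rewrite mul1r; apply: (@le_trans _ _ (5 * (4 * `|m|%N.+1%:R / p%:R))); first by rewrite ler_pM2l.
by rewrite le_eqVlt; apply/orP; left; apply/eqP; field; rewrite gt_eqF.
Qed.

Lemma fekete_coef_le h p s m : p = h.*2.+1 -> (5 <= h)%N -> (`|m| <= h)%N -> 0 < s -> s < 1 ->
  `|fekete_coef p s m| <= 23 / `|m|%N.+1%:R.
Proof.
move=> pE h5 mh s0 s1.
have h1 := fekete_coef_near pE h5 mh s0 s1; have h2 := limit_coef_le m s0 s1.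
have m0 : 0 < `|m|%N.+1%:R :> R by rewrite ltr0n.
have mp : `|m|%N.+1%:R <= p%:R :> R by rewrite ler_nat pE; lia.
have -> : fekete_coef p s m = limit_coef s m + (fekete_coef p s m - limit_coef s m) by ring.
apply: le_trans (ler_normD _ _) _; apply: le_trans (lerD h2 h1) _.
have -> : 23 / `|m|%N.+1%:R = 3 / `|m|%N.+1%:R + 20 / `|m|%N.+1%:R :> R.
  by rewrite -mulrDl; congr (_ / _); ring.
rewrite lerD2l -!mulrA ler_pM2l // ler_pdivrMr ?exprn_gt0 ?(lt_le_trans m0) //.
by rewrite ler_pdivlMl // -expr2 ler_sqr ?nnegrE // ltW // (lt_le_trans m0).
Qed.

End Kernel.

(** * Character sums against sums of signs *)

Lemma chi_corr_bound (R : realFieldType) (p l n : nat) (K : {set 'F_p}) :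
  prime p -> odd p -> (0 < l)%N -> (4 * l ^ 2 * n.+1 + n < p)%N ->
  K != finset.set0 -> (#|K| <= n)%N ->
  `|avgF (fun x => \prod_(c in K) chi R (x + c))| <= (3 * n)%:R / p%:R + (n + 3)%:R / (l.*2)%:R.
Proof.
move=> p_pr podd l0 cond K0 Kn.
have p0 : 0 < p%:R :> R by rewrite ltr0n prime_gt0.
have L0 : 0 < (l.*2)%:R :> R by rewrite ltr0n double_gt0.
have := @stepanov_bound p p_pr podd l K K0 l0.
have -> : (4 * l ^ 2 * #|K|.+1 + #|K| < p)%N.
  by apply: leq_ltn_trans cond; rewrite leq_add // leq_mul2l ltnS Kn orbT.
move=> /(_ isT); rewrite -(ler_int R) intrM intr_norm rmorph_sum /= => h.
have E : avgF (fun x => \prod_(c in K) chi R (x + c)) =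
   (\sum_(x : 'F_p) (\prod_(c in K) qchar (x + c))%:~R) / p%:R.
  by congr (_ / _); apply: eq_bigr => x _; rewrite rmorph_prod.
rewrite E normrM normfV (gtr0_norm p0) ler_pdivrMr //.
set S := `|_| in h *.
rewrite -(ler_pM2l L0); apply: le_trans h _.
rewrite mulrDl divfK ?gt_eqF // mulrDr [leLHS]natrD.
apply: lerD.
  by rewrite -natrM ler_nat mulnCA -mulnA !leq_mul2l Kn !orbT.
have -> : (l.*2)%:R * ((n + 3)%:R / (l.*2)%:R * p%:R) = (p * (n + 3))%:R :> R.
  by rewrite natrM; field; rewrite gt_eqF.
by rewrite ler_nat leq_mul2l leq_add2r Kn orbT.
Qed.

(** With l close to p^(1/4) the correlations of at most n factors are
    O(p^(-1/4)), whereas the harmonic sum, which times a constant bounds the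
    sum of the |a_p(s, m)|, is O(log p). *)
Lemma corr_error_small (R : realType) (n : nat) (C eps : R) : 1 <= C -> 0 < eps ->
  exists p0 : nat, forall p, (p0 <= p)%N -> prime p -> odd p ->
  exists dlt : R, [/\ 0 <= dlt,
    forall K : {set 'F_p}, K != finset.set0 -> (#|K| <= n)%N ->
      `|avgF (fun x => \prod_(c in K) chi R (x + c))| <= dlt &
    (2 * dlt + n%:R * 2 / p%:R) * (C * harm R (p./2).+1) ^+ n <= eps].
Proof.
move=> C1 eps0.
pose D : R := (10 * n + 6)%:R * (5 * C) ^+ n * (n.+1`! * 2 ^ n.+1)%:R.
have D0 : 0 <= D.
  by rewrite !mulr_ge0 // exprn_ge0 // mulr_ge0 //; lra.
pose B := ((Num.bound (D / eps)) + (5 * n + 6))%N.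
(* With 16^b <= p < 16^(b + 1), the parameter l is 2^b. *)
exists (16 ^ B)%N => p Bp p_pr podd.
pose b := trunc_log 16 p.
have p00 := prime_gt0 p_pr.
have bB : (B <= b)%N by apply: trunc_log_max.
have bp : (16 ^ b <= p)%N by apply: trunc_logP.
have pb : (p < 16 ^ b.+1)%N by apply: trunc_log_ltn.
have e2p : (2 ^ b <= p)%N by apply: leq_trans bp; case: (b) => // k; rewrite leq_exp2r.
have lt4 : (b < 4 ^ b)%N by apply: ltn_expl.
have cond : (4 * (2 ^ b) ^ 2 * n.+1 + n < p)%N.
  have e4 : ((2 ^ b) ^ 2 = 4 ^ b)%N by rewrite -expnM mulnC expnM.
  have e16 : (16 ^ b = 4 ^ b * 4 ^ b)%N by rewrite -expnMn.
  apply: leq_trans bp; rewrite e4 e16.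
  by move: lt4 bB; rewrite /B; move: (4 ^ b)%N => x; clear; nia.
exists ((3 * n)%:R / p%:R + (n + 3)%:R / ((2 ^ b).*2)%:R); split.
- by rewrite addr_ge0 // divr_ge0.
- by move=> K K0 Kn; apply: chi_corr_bound => //; rewrite expn_gt0.
have b0 : 0 < (2 ^ b)%:R :> R by rewrite ltr0n expn_gt0.
have pinv : p%:R^-1 <= (2 ^ b)%:R^-1 :> R by rewrite lef_pV2 ?posrE // ?ltr0n // ler_nat.
have p0 : 0 < p%:R^-1 :> R by rewrite invr_gt0 ltr0n.
have h1 : 2 * ((3 * n)%:R / p%:R + (n + 3)%:R / ((2 ^ b).*2)%:R) + n%:R * 2 / p%:R
    <= (10 * n + 6)%:R / (2 ^ b)%:R :> R.
  have -> : (10 * n + 6)%:R = 10 * n%:R + 6 :> R by rewrite natrD natrM.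
  have -> : (3 * n)%:R = 3 * n%:R :> R by rewrite natrM.
  have -> : (n + 3)%:R = n%:R + 3 :> R by rewrite natrD.
  have -> : ((2 ^ b).*2)%:R = 2 * (2 ^ b)%:R :> R by rewrite -mul2n natrM.
  rewrite invfM.
  have n0 : 0 <= n%:R :> R by [].
  have := ler_wpM2l n0 pinv.
  have : n%:R * 0 <= n%:R / (2 ^ b)%:R :> R by rewrite ler_wpM2l // invr_ge0 ltW.
  have : 0 < (2 ^ b)%:R^-1 :> R by rewrite invr_gt0.
  move: ((2 ^ b)%:R^-1 : R) (p%:R^-1 : R) (n%:R : R) => x y z; lra.
have h2 : harm R (p./2).+1 <= 5 * b.+1%:R.
  apply: (@le_trans _ _ (harm R (2 ^ (4 * b.+1)))).
    apply: le_harm; rewrite expnM -[(2 ^ 4)%N]/16%N.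
    by move: pb p00; clear; lia.
  apply: le_trans (harm_exp2 _ _) _.
  by rewrite -natrM ler_nat; clear; lia.
have h3 : (C * harm R (p./2).+1) ^+ n <= (5 * C) ^+ n * (b.+1 ^ n)%:R.
  rewrite natrX -exprMn lerXn2r ?nnegrE ?mulr_ge0 ?harm_ge0 //; try lra.
  by rewrite (mulrC 5) -mulrA ler_pM2l //; lra.
have h4 : (b.+1 ^ n)%:R / (2 ^ b)%:R <= (n.+1`! * 2 ^ n.+1)%:R / b.+1%:R :> R.
  rewrite ler_pdivrMr // mulrAC ler_pdivlMr ?ltr0n // -!natrM ler_nat.
  have := expn_le_fact_exp2 n.+1 b; rewrite expnSr => /leq_trans; apply.
  by rewrite addnC expnD mulnA.
apply: (@le_trans _ _ ((10 * n + 6)%:R / (2 ^ b)%:R * ((5 * C) ^+ n * (b.+1 ^ n)%:R))).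
  apply: ler_pM => //.
  by rewrite exprn_ge0 // mulr_ge0 ?harm_ge0 //; lra.
apply: (@le_trans _ _ (D / b.+1%:R)).
  rewrite /D -!mulrA ler_wpM2l // mulrCA ler_wpM2l ?exprn_ge0 ?mulr_ge0 //; first lra.
  by rewrite mulrC.
rewrite ler_pdivrMr ?ltr0n // mulrC -ler_pdivrMr //.
apply/ltW/(lt_le_trans (archi_boundP _)); first by rewrite divr_ge0 // ltW.
by rewrite ler_nat; apply: leq_trans (leqW bB); exact: leq_addr.
Qed.

Section CharacterSums.
Variable R : realType.

Definition sym_idx (h : nat) (i : 'I_h.*2.+1) : int := i%:Z - h%:Z.

(** These residues are pairwise distinct as soon as 2 h + 1 <= p, and form a
    complete system when there is equality. *)
Definition sym_res (p h : nat) (i : 'I_h.*2.+1) : 'F_p := (sym_idx i)%:~R.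

Lemma sym_res_inj p h : prime p -> (h.*2.+1 <= p)%N -> injective (@sym_res p h).
Proof.
move=> p_pr hp i j; rewrite /sym_res /sym_idx !intrB => /addIr.
rewrite -!pmulrn => /(congr1 val) /=.
rewrite !val_Fp_nat // !modn_small.
- by move/val_inj.
- by apply: leq_trans hp.
- by apply: leq_trans hp.
Qed.

Lemma sym_idx_le h (i : 'I_h.*2.+1) : (`|sym_idx i| <= h)%N.
Proof. by rewrite /sym_idx; have := ltn_ord i; lia. Qed.

Definition char_sum (p : nat) (M : nat) (a : int -> R) (x : 'F_p) : R :=
  ssum M (fun m => a m * chi R (x + m%:~R)).

Lemma char_sum_ord p M a x : @char_sum p M a x = \sum_(i < M.*2.+1) a (sym_idx i) * chi R (x + sym_res p i).
Proof. by rewrite /char_sum ssum_ord. Qed.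

Lemma char_sumB p M a b (x : 'F_p) : char_sum M a x - char_sum M b x = char_sum M (fun m => a m - b m) x.
Proof.
by rewrite /char_sum /ssum -sumrB; apply: eq_bigr => i _; rewrite mulrBl.
Qed.

Lemma char_sum_trunc p M h a (x : 'F_p) : (M <= h)%N ->
  char_sum h (fun m => if (`|m| <= M)%N then a m else 0) x = char_sum M a x.
Proof.
move=> Mh; rewrite /char_sum -[RHS](ssum_trunc _ Mh); apply: eq_ssum => m _.
by case: ifP => // _; rewrite mul0r.
Qed.

Definition sign_avg (M : nat) (a : int -> R) (f : R -> R) : R :=
  avgS (fun e : {ffun 'I_M.*2.+1 -> bool} => f (\sum_i a (sym_idx i) * sg R (e i))).

Section Decay.
Variables (h : nat) (a : int -> R) (c : R).
Hypotheses (c0 : 0 <= c).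
Hypothesis aP : forall m : int, (`|m| <= h)%N -> `|a m| <= c / `|m|%N.+1%:R.

Lemma sum_norm_decay : \sum_(i < h.*2.+1) `|a (sym_idx i)| <= 2 * c * harm R h.+1.
Proof.
rewrite -(ssum_ord h (fun m => `|a m|)).
apply: le_trans (ler_ssum aP) _.
have g0 j : 0 <= c / j.+1%:R by rewrite divr_ge0.
apply: le_trans (@ssum_abs_le _ h (fun j => c / j.+1%:R) g0) _.
by rewrite -mulr_sumr mulrA.
Qed.

Lemma sqr_decay (m : int) : (`|m| <= h)%N -> a m ^+ 2 <= c ^+ 2 * (`|m|%N.+1%:R ^+ 2)^-1.
Proof.
move=> mh; rewrite -[leLHS]real_normK ?num_real // -expr_div_n.
by rewrite lerXn2r ?nnegrE ?divr_ge0 // aP.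
Qed.

Lemma sum_sqr_decay : \sum_(i < h.*2.+1) a (sym_idx i) ^+ 2 <= 4 * c ^+ 2.
Proof.
rewrite -(ssum_ord h (fun m => a m ^+ 2)).
apply: (@le_trans _ _ (ssum h (fun m => c ^+ 2 * (`|m|%N.+1%:R ^+ 2)^-1))).
  by apply: ler_ssum => m; exact: sqr_decay.
rewrite ssumZ mulrC; apply: ler_wpM2r; first exact: sqr_ge0.
have g0 j : 0 <= (j.+1%:R ^+ 2)^-1 :> R by rewrite invr_ge0 sqr_ge0.
apply: le_trans (@ssum_abs_le _ h (fun j => (j.+1%:R ^+ 2)^-1) g0) _.
have := @sum_invsq_le R 0 h.+1; rewrite divr1; lra.
Qed.

Lemma sign_avg_moment n : sign_avg h a (fun x => `|x| ^+ n) <= 2 * n`!%:R * expR (2 * (4 * c ^+ 2)).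
Proof.
apply: le_trans (avgS_moment _ _) _.
by apply: ler_wpM2l; rewrite ?mulr_ge0 // ler_expR ler_wpM2l // sum_sqr_decay.
Qed.

Variables (p n : nat) (dlt : R).
Hypotheses (p_pr : prime p) (podd : odd p) (hp : (h.*2.+1 <= p)%N) (dlt0 : 0 <= dlt).
Hypothesis dltP : forall K : {set 'F_p}, K != finset.set0 -> (#|K| <= n)%N ->
      `|avgF (fun x => \prod_(c in K) chi R (x + c))| <= dlt.

(** [power_compare] for the shifts |m| <= h, the sum of the |a m| being
    bounded by a harmonic sum. *)
Lemma char_sum_power : `|avgF (fun x : 'F_p => char_sum h a x ^+ n) - sign_avg h a (fun x => x ^+ n)|
  <= (2 * dlt + n%:R * 2 / p%:R) * (2 * c * harm R h.+1) ^+ n.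
Proof.
rewrite (@eq_avgF _ _ _ (fun x => (\sum_(i < h.*2.+1) a (sym_idx i) * chi R (x + sym_res p i)) ^+ n)); last first.
  by move=> x; rewrite char_sum_ord.
apply: le_trans (power_compare p_pr dltP (sym_res_inj p_pr hp) dlt0 _) _.
rewrite ler_wpM2l ?addr_ge0 ?mulr_ge0 //.
by rewrite lerXn2r ?nnegrE ?mulr_ge0 ?harm_ge0 ?sumr_ge0 // sum_norm_decay.
Qed.

End Decay.

Variable q : R.
Hypothesis q0 : 0 < q.
Notation f := (fun x : R => `|x| `^ q).

(** The comparison inequality [powR_diff_bound] applied to the full sum with
    coefficients a_p(s, m) and to the sum over |m| <= M with coefficients
    a(s, m). Their n-th moments are bounded, and the second moment of their
    difference is small: for |m| <= M the coefficients converge to each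
    other as p grows, and the others contribute O(1 / M). *)
Lemma fekete_truncate (eps : R) : 0 < eps -> exists M0 : nat, forall M, (M0 <= M)%N ->
  exists p0 : nat, forall p, (p0 <= p)%N -> prime p -> odd p -> forall s, 0 < s -> s < 1 ->
  `|avgF (fun x : 'F_p => f (char_sum p./2 (fekete_coef p s) x)) - avgF (fun x : 'F_p => f (char_sum M (limit_coef s) x))| <= eps.
Proof.
move=> eps0.
(* The decay constant of [fekete_coef_le], larger than that of
   [limit_coef_le]. *)
have [c [c0 c1 c3 c23]] : exists c : R, [/\ 0 <= c, 1 <= 2 * c, 3 <= c & c = 23] by exists 23; split; lra.
pose V := 4 * c ^+ 2; have V0 : 0 <= V by rewrite mulr_ge0 // sqr_ge0.
pose n := (Num.bound q).*2.
have nodd : ~~ odd n by rewrite odd_double.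
have qn : q < n%:R.
  apply: lt_le_trans (archi_boundP (ltW q0)) _; rewrite ler_nat /n -addnn leq_addr //.
pose K : R := 2 * n`!%:R * expR (2 * (4 * c ^+ 2)).
have K0 : 0 <= K by rewrite !mulr_ge0 // expR_ge0.
pose eta := eps / (4 * (1 + (K + 1) + (K + 1))).
have den0 : 0 < 4 * (1 + (K + 1) + (K + 1)) by lra.
have eta0 : 0 < eta by rewrite divr_gt0.
have [C C0 HC] := powR_diff_bound q0 nodd qn eta0.
have [C' C'0 CC'] : exists2 C', 0 < C' & C <= C' by exists (C + 1); lra.
pose M0 := Num.bound (C' * V * 4 / eps).
exists M0 => M M0M.
have [pn Hn] := @corr_error_small R n (2 * c) 1 c1 ltr01.
have [p2 H2] := @corr_error_small R 2 (2 * c) (eps / (4 * C')) c1 (divr_gt0 eps0 (mulr_gt0 (ltr0n _ 4) C'0)).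
pose N : R := M.*2.+1%:R * (20 * M.+1%:R) ^+ 2.
pose p3 := Num.bound (C' * N * 4 / eps).
have N0 : 0 <= N by rewrite mulr_ge0 ?sqr_ge0.
exists (pn + p2 + p3 + M.*2 + 11)%N => p pge p_pr podd s s0 s1.
have p11 : (11 <= p)%N by apply: leq_trans pge; exact: leq_addl.
have pE : p = (p./2).*2.+1 by rewrite -[in LHS](odd_double_half p) podd.
have h5 : (5 <= p./2)%N by move: p11; clear; lia.
have Mh : (M <= p./2)%N by move: pge; clear; lia.
have [dn [dn0 dnP dnE]] := Hn p ltac:(move: pge; clear; lia) p_pr podd.
have [d2 [d20 d2P d2E]] := H2 p ltac:(move: pge; clear; lia) p_pr podd.
have hp : ((p./2).*2.+1 <= p)%N by rewrite -pE.
set h := p./2 in pE h5 Mh dnE d2E hp *.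
have p0 : 0 < p%:R :> R by rewrite ltr0n; move: p11; clear; lia.
pose b m := if (`|m| <= M)%N then limit_coef s m else 0.
have apP (m : int) : (`|m| <= h)%N -> `|fekete_coef p s m| <= c / `|m|%N.+1%:R.
  by move=> mh; rewrite c23; apply: (fekete_coef_le pE).
have bP (m : int) : (`|m| <= h)%N -> `|b m| <= c / `|m|%N.+1%:R.
  move=> mh; rewrite /b; case: ifP => _; last by rewrite normr0 divr_ge0.
  apply: le_trans (limit_coef_le _ s0 s1) _; rewrite ler_pM2r ?invr_gt0 ?ltr0n //; lra.
pose d m := fekete_coef p s m - b m.
have mp (m : int) : (`|m| <= h)%N -> (`|m|%N.+1%:R : R) <= p%:R.
  by move=> mh; rewrite ler_nat pE; move: mh; clear; lia.
have dsmall (m : int) : (`|m| <= M)%N -> `|d m| <= 20 * `|m|%N.+1%:R / p%:R ^+ 2.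
  by move=> mM; rewrite /d /b mM; apply: (fekete_coef_near pE) => //; apply: leq_trans Mh.
have dP (m : int) : (`|m| <= h)%N -> `|d m| <= c / `|m|%N.+1%:R.
  move=> mh; have [mM|mM] := leqP `|m| M; last first.
    by rewrite /d /b leqNgt mM /= subr0 apP.
  apply: le_trans (dsmall _ mM) _.
  rewrite ler_pdivlMr ?ltr0n // mulrAC ler_pdivrMr ?exprn_gt0 // -mulrA -expr2.
  apply: ler_pM => //; first by lra.
  by rewrite lerXn2r ?nnegrE ?mp // ltW.
have en (z : R) : z ^+ n = `|z| ^+ n by rewrite -normrX ger0_norm // exprn_even_ge0.
have mom a : (forall m : int, (`|m| <= h)%N -> `|a m| <= c / `|m|%N.+1%:R) ->
    avgF (fun x : 'F_p => char_sum h a x ^+ n) <= K + 1.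
  move=> aP; have h1 := char_sum_power c0 aP p_pr hp dn0 dnP.
  have h2 := le_trans h1 dnE.
  have h3 := sign_avg_moment c0 aP n.
  have h4 : sign_avg h a (fun x => `|x| ^+ n) = sign_avg h a (fun x => x ^+ n).
    by apply: eq_avgS => e; rewrite -en.
  rewrite h4 in h3; have h6 := le_trans (ler_norm _) h2; rewrite lerBlDl in h6.
  by apply: le_trans h6 _; rewrite lerD2r.
(* Only d = a_p - b enters: it is at most 20 (|m| + 1) / p^2 for |m| <= M,
   hence the term N / p, and O(1 / |m|) beyond, hence V / (M + 1). *)
have sqd : avgF (fun x : 'F_p => char_sum h d x ^+ 2) <= N / p%:R + V / M.+1%:R + eps / (4 * C').
  have h1 := char_sum_power c0 dP p_pr hp d20 d2P.
  have h2 := le_trans h1 d2E.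
  suff : sign_avg h d (fun x => x ^+ 2) <= N / p%:R + V / M.+1%:R.
    move=> h3; have h4 := le_trans (ler_norm _) h2; rewrite lerBlDl in h4.
    by apply: le_trans h4 _; rewrite lerD2r.
  rewrite /sign_avg avgS_sqr -(ssum_ord h (fun m => d m ^+ 2)).
  pose g j : R := if (j <= M)%N then 0 else c ^+ 2 * (j.+1%:R ^+ 2)^-1.
  apply: (@le_trans _ _ (ssum h (fun m => (if (`|m| <= M)%N then (20 * M.+1%:R) ^+ 2 / p%:R else 0) + g `|m|%N))).
    apply: ler_ssum => m mh; rewrite /g; case: ifP => mM.
      rewrite addr0 -[leLHS]real_normK ?num_real //.
      apply: (@le_trans _ _ ((20 * M.+1%:R / p%:R ^+ 2) ^+ 2)).
        rewrite lerXn2r ?nnegrE ?divr_ge0 ?mulr_ge0 ?exprn_ge0 ?(ltW p0) //.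
        apply: le_trans (dsmall _ mM) _.
        by rewrite ler_pM2r ?invr_gt0 ?exprn_gt0 // ler_pM2l // ler_nat.
      rewrite expr_div_n ler_wpM2l ?sqr_ge0 // lef_pV2 ?posrE ?exprn_gt0 //.
      rewrite -exprM -[leLHS]expr1 ler_weXn2l // ler1n; move: p11; clear; lia.
    by rewrite add0r (sqr_decay c0 dP).
  rewrite ssumD ssum_trunc //; apply: lerD.
    rewrite /ssum sumr_const_nat subn0 /N -[_ *+ _]mulr_natl mulrA //.
  by apply: ssum_tail_le; exact: sqr_ge0.
have Yb (x : 'F_p) : char_sum M (limit_coef s) x = char_sum h b x by symmetry; exact: (char_sum_trunc (limit_coef s) x Mh).
rewrite [X in `|_ - X|](_ : _ = avgF (fun x : 'F_p => f (char_sum h b x))); last first.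
  by apply: eq_avgF => x; rewrite Yb.
have -> : avgF (fun x : 'F_p => f (char_sum h (fekete_coef p s) x)) - avgF (fun x : 'F_p => f (char_sum h b x)) =
    avgF (fun x : 'F_p => f (char_sum h (fekete_coef p s) x) + (-1) * f (char_sum h b x)).
  by rewrite avgFD avgFZ mulN1r.
apply: le_trans (ler_norm_avgF p_pr _) _.
apply: (@le_trans _ _ (avgF (fun x : 'F_p => (eta * 1 + eta * (char_sum h (fekete_coef p s) x ^+ n)) +
    (eta * (char_sum h b x ^+ n) + C * (char_sum h d x ^+ 2))))).
  apply: le_avgF => // x; rewrite mulN1r.
  apply: le_trans (HC _ _) _; rewrite char_sumB.
  by rewrite le_eqVlt; apply/orP; left; apply/eqP; ring.
rewrite !avgFD !avgFZ avgF_cst //.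
have m1 := mom _ apP; have m2 := mom _ bP.
have e1 : eta * 1 + eta * avgF (fun x : 'F_p => char_sum h (fekete_coef p s) x ^+ n) + eta * avgF (fun x : 'F_p => char_sum h b x ^+ n) <= eps / 4.
  have -> : eps / 4 = eta * (1 + (K + 1) + (K + 1)) by rewrite /eta; field; lra.
  by rewrite -!mulrDr ler_pM2l // !lerD.
have e2 : C * avgF (fun x : 'F_p => char_sum h d x ^+ 2) <= C' * (N / p%:R + V / M.+1%:R + eps / (4 * C')).
  apply: ler_pM => //.
  by rewrite divr_ge0 ?sumr_ge0 // => x _; rewrite sqr_ge0.
have e3 : C' * (N / p%:R) <= eps / 4.
  rewrite mulrA ler_pdivrMr // mulrAC ler_pdivlMr // mulrC -[eps * _]mulrC -ler_pdivrMr //.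
  rewrite mulrC; apply/ltW/(lt_le_trans (archi_boundP _)).
    by rewrite divr_ge0 ?mulr_ge0 // ltW.
  by rewrite ler_nat -/p3; move: pge; clear; lia.
have e4 : C' * (V / M.+1%:R) <= eps / 4.
  rewrite mulrA ler_pdivrMr ?ltr0n // mulrAC ler_pdivlMr // -[eps * _]mulrC -ler_pdivrMr //.
  apply/ltW/(lt_le_trans (archi_boundP _)).
    by rewrite divr_ge0 ?mulr_ge0 // ltW.
  by rewrite ler_nat -/M0; apply: leq_trans M0M _.
have e5 : C' * (eps / (4 * C')) = eps / 4 by field; lra.
have e6 : C' * (N / p%:R + V / M.+1%:R + eps / (4 * C')) <= eps / 4 + eps / 4 + eps / 4.
  by rewrite !mulrDr e5; apply: lerD => //; exact: lerD.
rewrite addrA; apply: le_trans (lerD e1 (le_trans e2 e6)) _; lra.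
Qed.

End CharacterSums.

Section FeketeVsSigns.
Variables (R : realType) (q : R).
Hypothesis q0 : 0 < q.
Notation f := (fun x : R => `|x| `^ q).

(** For a fixed M the sum involves only 2 M + 1 characters, whose joint
    distribution tends to that of independent signs. *)
Lemma signs_limit (M : nat) (eps : R) : 0 < eps ->
  exists p0 : nat, forall p, (p0 <= p)%N -> prime p -> odd p -> forall s, 0 < s -> s < 1 ->
  `|avgF (fun x : 'F_p => f (char_sum M (limit_coef s) x)) - sign_avg M (limit_coef s) f| <= eps.
Proof.
move=> eps0.
pose n := M.*2.+1; pose H : R := (3 * n%:R) `^ q + 1.
have H0 : 0 < H by rewrite ltr_wpDl // powR_ge0.
pose W := H * 2 ^+ n.
have W0 : 0 < W by rewrite mulr_gt0 // exprn_gt0.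
have [p0 Hp] := @corr_error_small R n 1 (eps / W) (lexx _) (divr_gt0 eps0 W0).
exists (p0 + n)%N => p pge p_pr podd s s0 s1.
have [dlt [d0 dP dE]] := Hp p ltac:(apply: leq_trans pge; exact: leq_addr) p_pr podd.
have np : (n <= p)%N by apply: leq_trans pge; exact: leq_addl.
have p00 : 0 < p%:R :> R by rewrite ltr0n prime_gt0.
pose h (y : 'I_n -> R) := f (\sum_i limit_coef s (sym_idx i) * y i).
rewrite (@eq_avgF _ _ _ (fun x => h (fun i => chi R (x + sym_res p i)))); last first.
  by move=> x; rewrite /h char_sum_ord.
have hext y1 y2 : y1 =1 y2 -> h y1 = h y2.
  by move=> e; rewrite /h; congr (`| _ | `^ q); apply: eq_bigr => i _; rewrite e.
have hH y : (forall i, `|y i| <= 1) -> `|h y| <= H.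
  move=> y1; rewrite ger0_norm ?powR_ge0 //.
  apply: (@le_trans _ _ ((3 * n%:R) `^ q)); last by rewrite lerDl.
  apply: powR_mono => //.
  apply: le_trans (ler_norm_sum _ _ _) _.
  apply: (@le_trans _ _ (\sum_(i < n) 3)); last first.
    by rewrite sumr_const card_ord -[_ *+ _]mulr_natr.
  apply: ler_sum => i _; rewrite normrM -[leRHS]mulr1; apply: ler_pM => //.
  apply: le_trans (limit_coef_le _ s0 s1) _.
  by rewrite ler_pdivrMr ?ltr0n // ler_peMr // ler1n.
have In : (#|'I_n| <= n)%N by rewrite card_ord.
have := @pattern_compare R p p_pr n dlt dP 'I_n (@sym_res p M) (sym_res_inj p_pr np) d0 h H In hext hH.
rewrite card_ord => /le_trans; apply.
have n0 : 0 <= n%:R * 2 / p%:R :> R by rewrite mulr_ge0 // invr_ge0 ltW.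
have t2 : (1 : R) <= 2 ^+ n by rewrite exprn_ege1 // ler1n.
apply: (@le_trans _ _ (W * (2 * dlt + n%:R * 2 / p%:R))).
  rewrite /W -[leRHS]mulrA ler_pM2l // [leRHS]mulrDr lerD2l.
  by rewrite ler_peMl.
rewrite mulrC -ler_pdivlMr //; apply: le_trans dE.
rewrite ler_peMr ?addr_ge0 ?mulr_ge0 ?invr_ge0 //.
by rewrite exprn_ege1 // mul1r harm_ge1.
Qed.

Lemma fekete_vs_signs (eps : R) : 0 < eps -> exists M0 : nat, forall M, (M0 <= M)%N ->
  exists p0 : nat, forall p, (p0 <= p)%N -> prime p -> odd p -> forall s, 0 < s -> s < 1 ->
  `|avgF (fun x : 'F_p => f (char_sum p./2 (fekete_coef p s) x)) - sign_avg M (limit_coef s) f| <= eps.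
Proof.
move=> eps0; have e2 : 0 < eps / 2 by rewrite divr_gt0.
have [M0 H] := fekete_truncate q0 e2; exists M0 => M MM0.
have [p1 H1] := H M MM0; have [p2 H2] := signs_limit M e2.
exists (maxn p1 p2) => p; rewrite geq_max => /andP[pp1 pp2] p_pr podd s s0 s1.
apply: le_trans (ler_distD (avgF (fun x : 'F_p => f (char_sum M (limit_coef s) x))) _ _) _.
rewrite [leRHS]splitr; apply: lerD; first exact: (H1 p pp1 p_pr podd s s0 s1).
exact: (H2 p pp2 p_pr podd s s0 s1).
Qed.

End FeketeVsSigns.

Local Open Scope complex_scope.
Local Open Scope ring_scope.

(** * Gauss sums and values of Fekete polynomials *)

Section EulerCriterion.
Variable p : nat.
Hypotheses (p_pr : prime p) (podd : odd p).

(** The squares of 1, ..., (p - 1) / 2 are already (p - 1) / 2 distinct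
    roots of 'X^((p - 1) / 2) - 1. *)
Lemma euler_criterion (x : 'F_p) : x ^+ p./2 = 1 -> exists y, x = y ^+ 2.
Proof.
move=> xh.
have h0 := half_gt0 p_pr podd.
pose s := [seq (i%:R : 'F_p) ^+ 2 | i <- iota 1 p./2].
have pE : p = (p./2).*2.+1 by rewrite -[in LHS](odd_double_half p) podd.
have [xs|xs] := boolP (x \in s).
  by have /mapP[i _ ->] := xs; exists (i%:R).
have natF0 i : (0 < i)%N -> (i < p)%N -> (i%:R : 'F_p) != 0.
  move=> i0 ip; rewrite -(dvdn_pcharf (pchar_Fp p_pr)).
  by apply/negP => /dvdn_leq => /(_ i0); rewrite leqNgt ip.
have us : uniq (x :: s).
  rewrite /= xs map_inj_in_uniq ?iota_uniq // => i j.
  rewrite !mem_iota => iI jI /eqP; rewrite eqf_sqr => /orP[/eqP|].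
    move/(congr1 val) => /=; rewrite !val_Fp_nat // !modn_small //; lia.
  rewrite -addr_eq0 -natrD => /eqP h; exfalso.
  by have := natF0 (i + j)%N; rewrite h eqxx; lia.
have root_s : all (root ('X^(p./2) - 1)) (x :: s).
  rewrite /= rootE !hornerE xh subrr eqxx /=; apply/allP => y /mapP[i iI ->].
  rewrite mem_iota in iI.
  have i0 : (i%:R : 'F_p) != 0 by apply: natF0; lia.
  rewrite rootE !hornerE -exprM mul2n subr_eq0.
  have : (i%:R : 'F_p) ^+ p = i%:R by have := expf_card (i%:R : 'F_p); rewrite (card_Fp p_pr).
  rewrite [X in _ ^+ X = _]pE exprS -[RHS]mulr1 => /(mulfI i0) ->; exact: eqxx.
have := @max_poly_roots _ ('X^(p./2) - 1) (x :: s).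
rewrite -size_poly_gt0 size_XnsubC // => /(_ isT root_s us).
by rewrite /= size_map size_iota ltnn.
Qed.

Lemma legendreE (n : nat) : legendre n p = qchar (n%:R : 'F_p).
Proof.
rewrite /legendre (dvdn_pcharf (pchar_Fp p_pr)).
have [n0|n0] := eqVneq; first by rewrite /qchar n0 eqxx.
have modE (a b : nat) : (a == b %[mod p]) = ((a%:R : 'F_p) == b%:R).
  by rewrite -[RHS]val_eqE /= !val_Fp_nat.
case: ifPn => [/existsP[x]|].
  rewrite modE => /eqP E; rewrite -E natrX (qcharM p_pr podd).
  have : (x%:R : 'F_p) != 0 by apply: contraNneq n0 => x0; rewrite -E natrX x0 expr0n.
  by case: (qchar_cases (x%:R : 'F_p)) => -[h ->] //; rewrite h eqxx.
rewrite negb_exists => /forallP H.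
case: (qchar_cases (n%:R : 'F_p)) => -[h] //; first by rewrite h eqxx in n0.
move=> /eqP; rewrite qchar_eq1 // => /eqP/euler_criterion[y yE]; exfalso.
have yp : (val y < p)%N by have := ltn_ord y; rewrite [in X in (_ < X)%N]Fp_cast.
have := H (Ordinal yp); rewrite modE natrX /= => /negP; apply.
by rewrite yE; apply/eqP; congr (_ ^+ 2); apply/val_inj; rewrite /= val_Fp_nat // modn_small.
Qed.
End EulerCriterion.

Section Exponential.
Variable R : realType.
Notation e := (@Defs.e R).

Lemma eD (a b : R) : e (a + b) = e a * e b.
Proof.
rewrite /Defs.e mulrDr cosD sinD; apply/eqP; rewrite eq_complex /= eqxx /=.
by rewrite addrC eqxx.
Qed.

Lemma e0 : e 0 = 1.
Proof. by rewrite /Defs.e mulr0 cos0 sin0. Qed.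

Lemma e_nat (n : nat) : e n%:R = 1.
Proof.
elim: n => [|n IH]; first exact: e0.
rewrite -natr1 eD IH mul1r /Defs.e mulr1 mulr_natl cos2pi sin2pi //.
Qed.

Lemma eN (a : R) : e (- a) * e a = 1.
Proof. by rewrite -eD addNr e0. Qed.

Lemma e_int (n : int) : e n%:~R = 1.
Proof.
case: n => n; first exact: e_nat.
by rewrite NegzE mulrNz; have := eN (n.+1%:R : R); rewrite e_nat mulr1.
Qed.

Lemma eX (a : R) (n : nat) : e a ^+ n = e (n%:R * a).
Proof.
elim: n => [|n IH]; first by rewrite mul0r e0.
by rewrite exprS IH -eD -natr1 mulrDl mul1r addrC.
Qed.

Lemma e_half (t : R) : e t - 1 = (2 * sin (pi * t))%:C * (- sin (pi * t) +i* cos (pi * t)).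
Proof.
have E : 2 * pi * t = (pi * t) *+ 2 by rewrite mulr2n; ring.
rewrite /Defs.e E cos_mulr2n sin_mulr2n; apply/eqP; rewrite eq_complex /=.
have := cos2Dsin2 (pi * t); move: (cos _) (sin _) => c s h.
by apply/andP; split; apply/eqP; [rewrite mul0r !mulr2n; nra | rewrite mul0r mulr2n; ring].
Qed.

Lemma normc_e_sub1 (t : R) : Normc.normc (e t - 1) = 2 * `|sin (pi * t)|.
Proof.
rewrite e_half Normc.normcM /= expr0n addr0 sqrrN addrC cos2Dsin2 sqrtr1 mulr1.
by rewrite sqrtr_sqr normrM ger0_norm.
Qed.

(** That is, 1 / (e(t) - 1) = - 1 / 2 - (i / 2) cot(pi t): the source of the
    cotangent. *)
Lemma e_sub1_inv (t : R) : sin (pi * t) != 0 ->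
  (e t - 1)^-1 = - (2^-1)%:C - 'i%C * (cos (pi * t) / sin (pi * t) / 2)%:C.
Proof.
move=> s0; have ne0 : e t - 1 != 0.
  apply/negP => /eqP h; have := normc_e_sub1 t; rewrite h Normc.normc0 => /esym/eqP.
  by rewrite mulf_eq0 normr_eq0 (negPf s0) orbF pnatr_eq0.
apply: (mulfI ne0); rewrite divff // e_half; apply/eqP; rewrite eq_sym eq_complex /=.
have := cos2Dsin2 (pi * t); move: (cos _) (sin _) s0 => c s s0 h.
apply/andP; split; apply/eqP.
  rewrite -[RHS]h; field.
  by [].
by field.
Qed.
End Exponential.

Section Gauss.
Variables (R : realType) (p : nat).
Hypotheses (p_pr : prime p) (podd : odd p).
Notation e := (@Defs.e R).
Notation normc := Normc.normc.

Let p0 : 0 < p%:R :> R.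
Proof. by rewrite ltr0n prime_gt0. Qed.

Let pn0 : p%:R != 0 :> R.
Proof. by rewrite gt_eqF. Qed.

Definition addchar (c : 'F_p) : R[i] := e ((val c)%:R / p%:R).

Lemma addchar_int (n : int) : addchar n%:~R = e (n%:~R / p%:R).
Proof.
rewrite /addchar; set c : 'F_p := n%:~R.
have : ((n - (val c)%:Z)%:~R : 'F_p) == 0.
  by rewrite intrB -pmulrn natr_Zp subrr.
rewrite -(dvdz_pcharf (pchar_Fp p_pr)) => /dvdzP[t tE].
have -> : n = (val c)%:Z + t * p by rewrite -tE addrC subrK.
rewrite intrD intrM mulrDl -!pmulrn mulfK //.
by rewrite eD e_int mulr1.
Qed.

Lemma addcharD a b : addchar (a + b) = addchar a * addchar b.
Proof.
have E (c : 'F_p) : c = ((val c)%:Z)%:~R by rewrite -pmulrn natr_Zp.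
by rewrite {1}(E a) {1}(E b) -intrD addchar_int intrD mulrDl eD.
Qed.

Lemma addchar0 : addchar 0 = 1.
Proof. by rewrite /addchar mul0r e0. Qed.

Lemma addchar_neq1 c : c != 0 -> addchar c != 1.
Proof.
move=> c0; rewrite -subr_eq0; apply/negP => /eqP E.
have := normc_e_sub1 ((val c)%:R / p%:R : R); rewrite [_ - 1]E Normc.normc0 => /esym/eqP.
rewrite mulf_eq0 pnatr_eq0 /= normr_eq0 gt_eqF //; apply: sin_gt0_pi.
have pi0 := pi_gt0 R.
have v0 : 0 < (val c)%:R :> R by rewrite ltr0n lt0n.
have vp : (val c)%:R < p%:R :> R.
  by rewrite ltr_nat; have := ltn_ord c; rewrite [X in (_ < X)%N]Fp_cast.
by rewrite mulr_gt0 ?divr_gt0 //= gtr_pMr // ltr_pdivrMr // mul1r.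
Qed.

Lemma addchar_orth c : \sum_a addchar (a * c) = if c == 0 then p%:R else 0.
Proof.
have [->|c0] := eqVneq c 0.
  under eq_bigr do rewrite mulr0 addchar0.
  by rewrite sumr_const card_Fp.
have E : \sum_a addchar (a * c) = addchar c * \sum_a addchar (a * c).
  rewrite mulr_sumr [LHS](reindex_inj (addrI 1)) /=; apply: eq_bigr => a _.
  by rewrite mulrDl mul1r addcharD.
apply/eqP; have : (addchar c - 1) * (\sum_a addchar (a * c)) = 0.
  by rewrite mulrBl mul1r -E subrr.
by move/eqP; rewrite mulf_eq0 subr_eq0 (negPf (addchar_neq1 c0)).
Qed.

Definition qcharC (x : 'F_p) : R[i] := (qchar x)%:~R.

Lemma qcharCM x y : qcharC (x * y) = qcharC x * qcharC y.
Proof. by rewrite /qcharC (qcharM p_pr podd) intrM. Qed.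

Lemma sum_qcharC : \sum_x qcharC x = 0.
Proof. by rewrite /qcharC -rmorph_sum /= (sum_qchar0 p_pr podd). Qed.

Definition gauss : R[i] := \sum_j qcharC j * addchar (- j).

(** Multiplication by n permutes the residues and multiplies the sum by the
    character of n. *)
Lemma gauss_twist n : \sum_j qcharC j * addchar (- (j * n)) = qcharC n * gauss.
Proof.
have [->|n0] := eqVneq n 0.
  rewrite /qcharC {2}/qchar eqxx mul0r -[RHS]sum_qcharC; apply: eq_bigr => j _.
  by rewrite mulr0 oppr0 addchar0 mulr1.
have nn : qcharC n * qcharC n = 1.
  by rewrite /qcharC; case: (qchar_cases n) => -[h ->]; rewrite ?mulrNN ?mulr1 //; rewrite h eqxx in n0.
rewrite /gauss mulr_sumr [RHS](reindex_inj (mulIf n0)) /=; apply: eq_bigr => j _.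
have -> : qcharC n * (qcharC (j * n) * addchar (- (j * n))) =
   qcharC n * qcharC n * (qcharC j * addchar (- (j * n))) by rewrite qcharCM; ring.
by rewrite nn mul1r.
Qed.

Lemma gauss_sqr : gauss ^+ 2 = p%:R * qcharC (-1).
Proof.
rewrite expr2 {1}/gauss mulr_suml.
transitivity (\sum_(a : 'F_p) \sum_(j : 'F_p) qcharC j * addchar (a * (- (1 + j)))).
  apply: eq_bigr => a _; rewrite mulrAC -gauss_twist mulr_suml; apply: eq_bigr => j _.
  by rewrite -mulrA -addcharD mulrN mulrDr mulr1 opprD [j * a]mulrC addrC.
rewrite exchange_big (bigD1 (-1)) //= [X in _ + X]big1 ?addr0.
  by rewrite -mulr_sumr addchar_orth subrr oppr0 eqxx mulrC.
move=> j jn; rewrite -mulr_sumr addchar_orth ifF ?mulr0 //.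
by apply/negbTE; rewrite oppr_eq0 addrC addr_eq0.
Qed.

Lemma normc_gauss : normc gauss = Num.sqrt p%:R.
Proof.
have g0 : 0 <= normc gauss by case: gauss => a b; exact: sqrtr_ge0.
apply/eqP; rewrite -(@eqrXn2 _ 2) ?sqrtr_ge0 // sqr_sqrtr ?ler0n //.
have h := congr1 (@Normc.normc R) gauss_sqr; rewrite expr2 !Normc.normcM in h.
rewrite expr2 h.
have -> : normc (p%:R : R[i]) = p%:R.
  by rewrite -(rmorph_nat (real_complex R)) /= expr0n addr0 sqrtr_sqr ger0_norm.
rewrite /qcharC; case: (qchar_cases (-1 : 'F_p)) => -[h' ->].
- by move/eqP: h'; rewrite oppr_eq0 oner_eq0.
- by rewrite Normc.normc1 mulr1.
- by rewrite mulrNz normcN Normc.normc1 mulr1.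
Qed.

Lemma fekete_eval z : (fekete R p).[z] = \sum_(n < p) qcharC n%:R * z ^+ n.
Proof.
rewrite /fekete horner_sum -(big_mkord predT (fun n => qcharC n%:R * z ^+ n)).
rewrite [RHS]big_ltn ?prime_gt0 // {1}/qcharC {1}/qchar eqxx mul0r add0r.
by apply: eq_bigr => n _; rewrite hornerZ hornerXn legendreE.
Qed.

(** The residues x + m with |m| <= h form a complete system. *)
Lemma sum_shift (V : zmodType) (F : 'F_p -> V) (x : 'F_p) :
  \sum_c F c = \sum_(i < (p./2).*2.+1) F (x + sym_res p i).
Proof.
have pE : p = (p./2).*2.+1 by rewrite -[in LHS](odd_double_half p) podd.
have hp : ((p./2).*2.+1 <= p)%N by rewrite -pE.
rewrite (reindex (fun i : 'I_(p./2).*2.+1 => x + sym_res p i)) //=.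
apply: onW_bij; apply: inj_card_bij; first exact: inj_comp (addrI _) (sym_res_inj p_pr hp).
by rewrite (card_Fp p_pr) card_ord -pE.
Qed.

(** Replacing each chi(n) gauss by the twisted Gauss sum turns F_p(z) gauss
    into a sum over residues j of chi(j) times a geometric sum of ratio w =
    e((s - m) / p), where j = k + m. Its value is (w^p - 1) / (w - 1) and
    w^p = e(s). *)
Lemma fekete_gauss (k : nat) (s : R) : 0 < s -> s < 1 ->
  (fekete R p).[e ((k%:R + s) / p%:R)] * gauss =
  \sum_(i < (p./2).*2.+1) qcharC (k%:R + sym_res p i) *
     ((e s - 1) / (e ((s - (sym_idx i)%:~R) / p%:R) - 1)).
Proof.
move=> s0 s1.
have pE : p = (p./2).*2.+1 by rewrite -[in LHS](odd_double_half p) podd.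
have hp : ((p./2).*2.+1 <= p)%N by rewrite -pE.
set z := e _.
have zp : z ^+ p = e s.
  by rewrite /z eX mulrCA divff // mulr1 eD e_nat mul1r.
rewrite fekete_eval mulr_suml.
transitivity (\sum_(n < p) \sum_j qcharC j * (addchar (- j) * z) ^+ n).
  apply: eq_bigr => n _; rewrite mulrAC -gauss_twist mulr_suml; apply: eq_bigr => j _.
  rewrite -mulrA exprMn; congr (_ * (_ * _)).
  elim: (nat_of_ord n) => [|m IH]; first by rewrite mulr0 oppr0 addchar0.
  by rewrite exprS -IH -addcharD -natr1 mulrDr mulr1 opprD addrC.
rewrite exchange_big /= (sum_shift _ k%:R).
apply: eq_bigr => i _; rewrite -mulr_sumr; congr (_ * _).
have E : addchar (- (k%:R + sym_res p i)) * z = e ((s - (sym_idx i)%:~R) / p%:R).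
  have -> : - (k%:R + sym_res p i) = (- (k%:Z + sym_idx i))%:~R :> 'F_p.
    by rewrite mulrNz intrD.
  rewrite addchar_int /z -eD -mulrDl; congr (e (_ / _)).
  rewrite mulrNz intrD -pmulrn; ring.
rewrite E; set w := e ((s - (sym_idx i)%:~R) / p%:R).
have wp : w ^+ p = e s.
  rewrite /w -E exprMn zp -[RHS]mul1r; congr (_ * _).
  by rewrite /addchar eX mulrCA divff // mulr1 e_nat.
have w1 : w - 1 != 0.
  apply/negP; rewrite subr_eq0 => /eqP w1.
  have : e s = 1 by rewrite -wp w1 expr1n.
  move=> es; have := normc_e_sub1 s; rewrite es subrr Normc.normc0 => /esym/eqP.
  rewrite mulf_eq0 pnatr_eq0 /= normr_eq0 gt_eqF //; apply: sin_gt0_pi.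
  by rewrite mulr_gt0 ?pi_gt0 //= gtr_pMr // pi_gt0.
by apply: (mulfI w1); rewrite -subrX1 wp mulrCA divff ?mulr1.
Qed.

Lemma sin_small_neq0 (x : R) : x != 0 -> `|x| <= 24 / 11 -> sin x != 0.
Proof.
wlog x0 : x / 0 < x.
  move=> H xn0 xb; have [x0|x0|/eqP] := ltgtP x 0; last by rewrite (negPf xn0).
    by have := H (- x); rewrite oppr_gt0 oppr_eq0 normrN sinN oppr_eq0; apply.
  exact: H.
move=> _; rewrite gtr0_norm // => xb; rewrite gt_eqF //.
by apply: lt_le_trans (sin_lower (ltW x0) xb); rewrite divr_gt0.
Qed.

(** In [fekete_gauss] the term - 1 / 2 of 1 / (w - 1) contributes a multiple
    of the sum of chi over a complete system, which is 0, so that only the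
    cotangents remain. *)
Lemma fekete_kernel (k : nat) (s : R) : (11 <= p)%N -> 0 < s -> s < 1 ->
  normc (fekete R p).[e ((k%:R + s) / p%:R)] = Num.sqrt p%:R * `|char_sum p./2 (fekete_coef p s) (k%:R : 'F_p)|.
Proof.
move=> p11 s0 s1.
have pE : p = (p./2).*2.+1 by rewrite -[in LHS](odd_double_half p) podd.
have hp : ((p./2).*2.+1 <= p)%N by rewrite -pE.
have h5 : (5 <= p./2)%N by move: p11; clear; lia.
have sp0 : Num.sqrt p%:R != 0 :> R by rewrite gt_eqF // sqrtr_gt0.
apply: (mulIf sp0); rewrite mulrAC -expr2 sqr_sqrtr ?ler0n //.
rewrite -{1}normc_gauss -Normc.normcM fekete_gauss //.
pose cot x : R := cos x / sin x.
pose th (i : 'I_(p./2).*2.+1) := pi * ((sym_idx i)%:~R - s) / p%:R.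
have th0 i : sin (th i) != 0.
  apply: sin_small_neq0; last by apply: (kernel_arg_le pE) => //; exact: sym_idx_le.
  have := dist_int_gt0 (sym_idx i) s0 s1; rewrite normr_gt0 => d0.
  by rewrite /th !mulf_neq0 ?invr_eq0 // gt_eqF // pi_gt0.
have qcharCE x : qcharC x = (chi R x)%:C by rewrite /chi rmorph_int.
pose S : R := \sum_(i < (p./2).*2.+1) chi R (k%:R + sym_res p i) * cot (th i).
have -> : \sum_(i < (p./2).*2.+1) qcharC (k%:R + sym_res p i) *
     ((e s - 1) / (e ((s - (sym_idx i)%:~R) / p%:R) - 1)) = (e s - 1) * ('i%C * (S / 2)%:C).
  transitivity ((e s - 1) * \sum_(i < (p./2).*2.+1)
     (qcharC (k%:R + sym_res p i) * (- (2^-1)%:C) + 'i%C * (chi R (k%:R + sym_res p i) * cot (th i) / 2)%:C)).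
    rewrite mulr_sumr; apply: eq_bigr => i _.
    rewrite mulrCA; congr (_ * _).
    have argE : pi * ((s - (sym_idx i)%:~R) / p%:R) = - th i by rewrite /th; ring.
    rewrite e_sub1_inv argE ?sinN ?oppr_eq0 // cosN qcharCE mulrBr; congr (_ + _).
    rewrite invrN mulrN mulNr rmorphN /= mulrN mulrN opprK mulrCA; congr (_ * _).
    by rewrite -rmorphM mulrA.
  congr (_ * _); rewrite big_split /= -mulr_suml.
  have -> : \sum_(i < (p./2).*2.+1) qcharC (k%:R + sym_res p i) = 0.
    by have := sum_shift qcharC k%:R; rewrite sum_qcharC => <-.
  rewrite mul0r add0r -mulr_sumr -rmorph_sum /=; congr (_ * _).
  by rewrite /S mulr_suml.
rewrite !Normc.normcM normc_e_sub1.
have -> : normc 'i%C = 1 :> R by rewrite /= expr0n expr1n add0r sqrtr1.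
rewrite /= expr0n addr0 sqrtr_sqr mul1r normrM (@ger0_norm _ (2^-1)) ?invr_ge0 //.
have -> : char_sum p./2 (fekete_coef p s) (k%:R : 'F_p) = sin (pi * s) / p%:R * S.
  rewrite char_sum_ord /S mulr_sumr; apply: eq_bigr => i _.
  by rewrite /fekete_coef -mulrA; congr (_ * _); rewrite mulrC.
rewrite !normrM normfV (gtr0_norm p0); move: `|sin _| => x.
by field.
Qed.
End Gauss.

(** * Means over the unit interval *)

Section Subdivision.
Variable R : realType.
Notation mu := (@lebesgue_measure R).

Lemma continuous_bigsum (n : nat) (F : nat -> R -> R) : (forall k, continuous (F k)) ->
  continuous (fun s => \sum_(k < n) F k s).
Proof.
move=> cF; elim: n => [|n IH] s.
  rewrite (_ : (fun s => _) = cst 0); first exact: cvg_cst.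
  by apply/funext => t; rewrite big_ord0.
rewrite (_ : (fun s => _) = (fun s => \sum_(k < n) F k s + F n s)).
  by apply: cvgD; [exact: IH | exact: cF].
by apply/funext => t; rewrite big_ord_recr.
Qed.

Lemma continuous_integrable_itv (g : R -> R) (a b : R) : continuous g ->
  mu.-integrable `[a, b] (EFin \o g).
Proof.
move=> cg; apply: continuous_compact_integrable; first exact: segment_compact.
exact: continuous_subspaceT.
Qed.

Lemma Rintegral_FTC (K k : R -> R) : continuous k ->
  (forall s : R, 0 <= s <= 1 -> is_derive s 1 K (k s)) ->
  \int[mu]_(s in `[0, 1]) k s = K 1 - K 0.
Proof.
move=> ck dK; rewrite /Rintegral.
have cK (s : R) : 0 <= s <= 1 -> {for s, continuous K}.
  move=> s01; apply: differentiable_continuous; apply/derivable1_diffP.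
  by have := dK s s01; case.
rewrite (@continuous_FTC2 _ k K 0 1) //.
- exact: continuous_subspaceT.
- split.
  + move=> s; rewrite in_itv /= => /andP[s0 s1].
    by have := dK s; rewrite !ltW // => /(_ isT); case.
  + by apply: cvg_at_right_filter; apply: cK; rewrite lexx ler01.
  + by apply: cvg_at_left_filter; apply: cK; rewrite lexx ler01.
- move=> s; rewrite in_itv /= => /andP[s0 s1]; rewrite derive1E.
  by have := dK s; rewrite !ltW // => /(_ isT); case.
Qed.

Lemma continuous_primitive (g : R -> R) : continuous g ->
  exists H, forall x : R, -1 < x < 2 -> is_derive x 1 H (g x).
Proof.
move=> cg; exists (fun x => \int[mu]_(t in `[-1, x]) g t) => x /andP[x1 x2].
have [dH EH] := @continuous_FTC1_closed R g (-1) x 2 x2 (continuous_integrable_itv _ _ cg) x1 (cg x).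
by apply: DeriveDef; [exact: dH | rewrite -derive1E; exact: EH].
Qed.

Lemma continuous_average (g : R -> R) (p : nat) : continuous g ->
  continuous (fun s : R => p%:R^-1 * \sum_(k < p) g ((k%:R + s) / p%:R)).
Proof.
move=> cg s; apply: cvgMr.
apply: (@continuous_bigsum p (fun k (s : R) => g ((k%:R + s) / p%:R))) => k {}s.
apply: continuous_comp; last exact: cg.
by apply: cvgMl; apply: cvgD; [exact: cvg_cst | exact: cvg_id].
Qed.

(** For a primitive H of g, the integrand is the derivative of s |-> sum_k
    H((k + s) / p), whose increment over [0, 1] telescopes to H 1 - H 0. *)
Lemma integral_subdivision (g : R -> R) (p : nat) : (0 < p)%N -> continuous g ->
  \int[mu]_(s in `[0, 1]) (p%:R^-1 * \sum_(k < p) g ((k%:R + s) / p%:R)) =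
  \int[mu]_(t in `[0, 1]) g t.
Proof.
move=> p0 cg; have [H dH] := continuous_primitive cg.
have pp : 0 < p%:R :> R by rewrite ltr0n.
have -> : \int[mu]_(t in `[0, 1]) g t = H 1 - H 0.
  by apply: Rintegral_FTC => // s /andP[s0 s1]; apply: dH; apply/andP; split; lra.
pose K s : R := \sum_(k < p) H ((k%:R + s) / p%:R).
transitivity (K 1 - K 0); last first.
  rewrite /K -sumrB -(big_mkord predT (fun k => H ((k%:R + 1) / p%:R) - H ((k%:R + 0) / p%:R))).
  rewrite (telescope_sumr_eq (fun k => H (k%:R / p%:R))) //.
    by rewrite divff ?gt_eqF // mul0r.
  by move=> k _; rewrite natr1 addr0.
apply: (@Rintegral_FTC K).
- exact: continuous_average.
- move=> s /andP[s0 s1].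
  have -> : p%:R^-1 * \sum_(k < p) g ((k%:R + s) / p%:R) = \sum_(k < p) g ((k%:R + s) / p%:R) * p%:R^-1.
    by rewrite mulrC mulr_suml.
  rewrite (_ : K = \sum_(k < p) (fun s => H ((k%:R + s) / p%:R))); last first.
    by apply/funext => t; rewrite /K fct_sumE.
  apply: is_derive_sum => k.
  apply: (@is_derive1_comp _ H (fun s => (k%:R + s) / p%:R)).
    have k0 : 0 <= k%:R :> R by [].
    have kp : k%:R + 1 <= p%:R :> R by rewrite natr1 ler_nat.
    apply: dH; apply/andP; split.
      by apply: (@lt_le_trans _ _ 0); rewrite ?ltrN10 // divr_ge0 ?addr_ge0 // ltW.
    by apply: (@le_lt_trans _ _ 1); rewrite ?ltr1n // ler_pdivrMr // mul1r; lra.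
  rewrite (_ : (fun s => _) = p%:R^-1 \*o (cst k%:R + id)); last first.
    by apply/funext => t /=; rewrite mulrC.
  apply: is_derive_eq.
  by rewrite add0r; exact: mulr1.
Qed.

End Subdivision.

Section FeketeMean.
Variable R : realType.
Notation mu := (@lebesgue_measure R).
Notation normc := Normc.normc.

Lemma continuous_powR (h : R -> R) (q : R) : 0 < q -> (forall t, 0 <= h t) ->
  continuous h -> continuous (fun t => h t `^ q).
Proof.
move=> q0 h0 ch t; apply/cvgrPdist_le => eta eta0.
have K0 : 0 < h t + 1 by rewrite ltr_wpDl.
have [dl dl0 H] := powR_unif_cont q0 K0 eta0.
have dl1 : 0 < Num.min dl 1 by rewrite lt_min dl0 ltr01.
have /cvgrPdist_lt/(_ _ dl1) := ch t; apply: filterS => s.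
rewrite lt_min => /andP[s1 s2].
have [ts|st] := leP (h t) (h s).
- rewrite distrC ger0_norm ?subr_ge0 ?powR_mono //; apply: H => //.
    by move: s2; rewrite ltr_norml => /andP[? ?]; lra.
  by move: s1; rewrite ltr_norml => /andP[? ?]; lra.
- rewrite ger0_norm ?subr_ge0 ?powR_mono ?(ltW st) //; apply: H => //.
    exact: ltW.
    by rewrite lerDl.
  by move: s1; rewrite ltr_norml => /andP[? ?].
Qed.

Lemma continuous_normc_horner (Q : {poly R[i]}) : continuous (fun t : R => normc Q.[e t]).
Proof.
have [A [B [cA cB E]]] : exists A B : R -> R,
    [/\ continuous A, continuous B & forall t, Q.[e t] = A t +i* B t].
  elim/poly_ind: Q => [|Q [u v] [A [B [cA cB E]]]].
    by exists (cst 0), (cst 0); split; [exact: cst_continuous | exact: cst_continuous | move=> t; rewrite horner0].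
  have clin : continuous (fun t : R => 2 * pi * t).
    by move=> t; apply: cvgMr; exact: cvg_id.
  have cc : continuous (fun t : R => cos (2 * pi * t)).
    by move=> t; apply: (@continuous_comp _ _ _ _ cos); [exact: clin | exact: continuous_cos].
  have cs : continuous (fun t : R => sin (2 * pi * t)).
    by move=> t; apply: (@continuous_comp _ _ _ _ sin); [exact: clin | exact: continuous_sin].
  exists (fun t => A t * cos (2 * pi * t) - B t * sin (2 * pi * t) + u),
    (fun t => A t * sin (2 * pi * t) + B t * cos (2 * pi * t) + v); split.
  - move=> t; apply: cvgD; last exact: cvg_cst.
    by apply: cvgB; apply: cvgM; [exact: cA | exact: cc | exact: cB | exact: cs].
  - move=> t; apply: cvgD; last exact: cvg_cst.
    by apply: cvgD; apply: cvgM; [exact: cA | exact: cs | exact: cB | exact: cc].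
  - by move=> t; rewrite hornerMXaddC E.
rewrite (_ : (fun t => _) = fun t => Num.sqrt (A t ^+ 2 + B t ^+ 2)); last first.
  by apply/funext => t; rewrite E.
move=> t; apply: (@continuous_comp _ _ _ (fun t => A t ^+ 2 + B t ^+ 2) Num.sqrt); last exact: sqrt_continuous.
by apply: cvgD; rewrite /continuous_at expr2; apply: cvgM; [exact: cA | exact: cA | exact: cB | exact: cB].
Qed.

Lemma normc_ge0 (z : R[i]) : 0 <= normc z.
Proof. by case: z => a b; exact: sqrtr_ge0. Qed.

Variables (p : nat) (p_pr : prime p) (podd : odd p) (p11 : (11 <= p)%N).
Variables (q : R) (q0 : 0 < q).

(** The values at (k + s) / p for k < p sweep over the residues modulo p, so
    the mean of |F_p|^q over the subdivision is an average over the field. *)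
Lemma fekete_mean : exists Phi : R -> R, [/\ continuous Phi, forall s, 0 <= Phi s,
  forall s, 0 < s -> s < 1 -> Phi s = avgF (fun x : 'F_p => `|char_sum p./2 (fekete_coef p s) x| `^ q) &
  Mq q (fekete R p) / Num.sqrt p%:R = (\int[mu]_(s in `[0, 1]) Phi s) `^ q^-1].
Proof.
have pp : 0 < p%:R :> R by rewrite ltr0n prime_gt0.
have sp : 0 < Num.sqrt p%:R :> R by rewrite sqrtr_gt0.
pose h t : R := normc (fekete R p).[e t] / Num.sqrt p%:R.
have h0 t : 0 <= h t by rewrite divr_ge0 ?normc_ge0 ?ltW.
have ch : continuous h.
  by move=> t; apply: cvgMl; exact: continuous_normc_horner.
pose g t := h t `^ q.
have cg : continuous g by exact: continuous_powR.
exists (fun s => p%:R^-1 * \sum_(k < p) g ((k%:R + s) / p%:R)); split.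
- exact: continuous_average.
- by move=> s; rewrite mulr_ge0 ?invr_ge0 ?(ltW pp) // sumr_ge0 // => k _; exact: powR_ge0.
- move=> s s0 s1; rewrite /avgF mulrC; congr (_ / _).
  have -> : \sum_(k < p) g ((k%:R + s) / p%:R) =
      \sum_(k < p) `|char_sum p./2 (fekete_coef p s) (k%:R : 'F_p)| `^ q.
    apply: eq_bigr => k _; rewrite /g /h (fekete_kernel p_pr podd k p11 s0 s1).
    by rewrite mulrAC divff ?mul1r // gt_eqF.
  rewrite -(big_mkord xpredT (fun k => `|char_sum p./2 (fekete_coef p s) (k%:R : 'F_p)| `^ q)).
  rewrite -[X in index_iota 0 X](Fp_cast p_pr) big_mkord.
  by apply: eq_bigr => x _; rewrite natr_Zp.
- rewrite integral_subdivision ?prime_gt0 //.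
  have cn : continuous (fun t : R => normc (fekete R p).[e t] `^ q).
    by apply: continuous_powR => //; [move=> t; exact: normc_ge0 | exact: continuous_normc_horner].
  have -> : \int[mu]_(t in `[0, 1]) g t = (Num.sqrt p%:R)^-1 `^ q *
      \int[mu]_(t in `[0, 1]) (normc (fekete R p).[e t] `^ q).
    rewrite -RintegralZl //; last exact: continuous_integrable_itv.
    apply: eq_Rintegral => t _; by rewrite /g /h mulrC powRM ?normc_ge0 ?invr_ge0 ?(ltW sp).
  rewrite powRM ?powR_ge0 //; last by apply: Rintegral_ge0 => t _; exact: powR_ge0.
  by rewrite -powRrM divff ?gt_eqF // powRr1 ?invr_ge0 ?ltW // mulrC.
Qed.

End FeketeMean.

(** * Expectations under independent signs *)

Import HBNNSimple.

Section NegligibleIntegral.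
Context {d : measure_display} {T : measurableType d} {R : realType}
  (mu : {measure set T -> \bar R}).
Local Open Scope ereal_scope.

(** The integral of a nonnegative function is a supremum over simple
    functions below it, and a simple function can be cut off on N without
    changing its integral. This form applies to |G_X(t)|^q, which is given
    pointwise as a limit. *)
Lemma ge0_integral_eq_off_null (N : set T) (f g : T -> \bar R) :
  measurable N -> mu N = 0 -> (forall x, 0 <= f x) -> (forall x, 0 <= g x) ->
  (forall x, ~ N x -> f x = g x) -> \int[mu]_x f x = \int[mu]_x g x.
Proof.
move=> mN N0.
suff le f1 g1 : (forall x, 0 <= f1 x) -> (forall x, 0 <= g1 x) ->
    (forall x, ~ N x -> f1 x = g1 x) -> \int[mu]_x f1 x <= \int[mu]_x g1 x.
  move=> f0 g0 fg; apply/eqP; rewrite eq_le !le //.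
  by move=> x /fg.
move=> f0 g0 fg; rewrite !ge0_integralTE //.
apply: ge_ereal_sup => _ [h /= hf <-].
have mNc : measurable (~` N) by exact: measurableC.
pose h' : {nnsfun T >-> R} := proj_nnsfun h mNc.
have -> : sintegral mu h = sintegral mu h'.
  rewrite -!integralT_nnsfun; apply: ge0_ae_eq_integral => //.
  - by apply/measurable_EFinP; exact: measurable_funPT.
  - by apply/measurable_EFinP; exact: measurable_funPT.
  - by move=> x _; rewrite lee_fin.
  - by move=> x _; rewrite lee_fin.
  exists N; split => // x /=; apply: contra_notP => Nx _.
  by rewrite mindicE mem_set ?mulr1.
apply: ereal_sup_ubound; exists h' => //= x.
rewrite mindicE; have [Nx|Nx] := pselect (N x).
  by rewrite memNset ?mulr0 //=; apply/not_notP.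
by rewrite mem_set // mulr1 -fg //; exact: hf.
Qed.

End NegligibleIntegral.

Section SignVariables.
Context {d : measure_display} {T : measurableType d} {R : realType}
  {P : probability T R}.
Variable X : int -> {RV P >-> R}.
Hypothesis hX : iid_signs X.

Lemma measurable_X m : measurable_fun setT (X m).
Proof. exact: measurable_funPT. Qed.

Lemma measurable_X_set m (A : set R) : measurable A -> measurable (X m @^-1` A).
Proof. by move=> mA; rewrite -[X in measurable X]setTI; exact: measurable_X. Qed.

Lemma prob_sg m b : P (X m @^-1` [set sg R b]) = (2^-1)%:E.
Proof.
have [h1 h2] := hX.2 m.
by case: b; rewrite /sg ?expr1 ?expr0.
Qed.

Definition pattern_set M (e : {ffun 'I_M.*2.+1 -> bool}) : set T :=
  [set w | forall i, X (sym_idx i) w = sg R (e i)].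

Lemma sym_idx_inj M : injective (@sym_idx M).
Proof. by move=> i j; rewrite /sym_idx => /addIr [] /val_inj. Qed.

Lemma pattern_set_bigcap M (e : {ffun 'I_M.*2.+1 -> bool}) :
  pattern_set e = \bigcap_(m in [set` [fset sym_idx i | i in 'I_M.*2.+1]%fset])
     (X m @^-1` [set sg R (e (inord `|(m + M%:Z)%R|%N))]).
Proof.
have E (i : 'I_M.*2.+1) : inord `|(sym_idx i + M%:Z)%R|%N = i.
  by apply/val_inj; rewrite /sym_idx subrK /= inordK.
apply/seteqP; split => w /=.
  by move=> H m /= /imfsetP[i _ ->] /=; rewrite H E.
move=> H i; rewrite -{2}(E i); apply: H => /=.
by apply/imfsetP; exists i.
Qed.

Lemma pattern_prob M (e : {ffun 'I_M.*2.+1 -> bool}) :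
  measurable (pattern_set e) /\ P (pattern_set e) = ((2 ^+ M.*2.+1)^-1)%:E.
Proof.
rewrite pattern_set_bigcap; split.
  apply: fin_bigcap_measurable => // m _; apply: (@measurable_X_set m).
rewrite (hX.1 _ (fun m => [set sg R (e (inord `|(m + M%:Z)%R|%N))])); last first.
  by move=> m _.
under eq_bigr do rewrite prob_sg.
rewrite prodEFin big_imfset /=; last by move=> i j _ _; exact: sym_idx_inj.
by rewrite big_const_seq count_predT iter_mulr_1 -cardE card_ord exprVn.
Qed.

(** The law of each X m only gives it sign values almost surely; countably
    many null sets are collected. *)
Lemma good_signs : exists N : set T, [/\ measurable N, P N = 0%E &
  forall w, ~ N w -> forall m, X m w = 1 \/ X m w = -1].
Proof.
have null m : P.-negligible (~` (X m @^-1` [set 1] `|` X m @^-1` [set -1])).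
  have m1 : measurable (X m @^-1` [set 1]) by apply: measurable_X_set => //.
  have m2 : measurable (X m @^-1` [set -1]) by apply: measurable_X_set => //.
  apply/negligibleP; first by apply: measurableC; exact: measurableU.
  have [h1 h2] := hX.2 m.
  have dis : X m @^-1` [set 1] `&` X m @^-1` [set -1] = set0.
    apply/seteqP; split => w //= [-> /eqP].
    by rewrite -subr_eq0 opprK -[1 + 1]/(2%:R) pnatr_eq0.
  have PU : P (X m @^-1` [set 1] `|` X m @^-1` [set -1]) = 1%E.
    apply: (eq_trans (measureU P m1 m2 dis)).
    apply: (eq_trans (congr2 adde h1 h2)).
    have e2 : 2^-1 + 2^-1 = 1 :> R by lra.
    exact: (congr1 EFin e2).
  apply: (eq_trans (@probability_setC d T R P _ (measurableU _ _ m1 m2))).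
  apply: (eq_trans (congr1 (fun z => 1 - z)%E PU)).
  by rewrite subee.
have [N [mN N0 sN]] : P.-negligible (\bigcup_k
   ((~` (X k%:Z @^-1` [set 1] `|` X k%:Z @^-1` [set -1])) `|`
    (~` (X (- k%:Z) @^-1` [set 1] `|` X (- k%:Z) @^-1` [set -1])))).
  by apply: negligible_bigcup => k; apply: negligibleU.
exists N; split => // w Nw m.
have : ~ (~ (X m w = 1 \/ X m w = -1)).
  move=> H; apply: Nw; apply: sN; exists `|m|%N => //.
  have mE : m = `|m|%N%:Z \/ m = - `|m|%N%:Z by lia.
  by case: mE => mE; [left|right]; rewrite -mE.
by move/contrapT.
Qed.

(** By independence every pattern of values of the X m with |m| <= M has
    probability 2^-(2 M + 1), and almost surely one of them occurs. *)
Lemma expectation_pattern M (h : ('I_M.*2.+1 -> R) -> R) :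
  (forall y, 0 <= h y) ->
  (\int[P]_w (h (fun i => X (sym_idx i) w))%:E =
   (avgS (fun e : {ffun 'I_M.*2.+1 -> bool} => h (fun i => sg R (e i))))%:E)%E.
Proof.
move=> h0; have [N [mN N0 HN]] := good_signs.
rewrite (@ge0_integral_eq_off_null _ _ _ P N _ (fun w =>
  \sum_(e : {ffun 'I_M.*2.+1 -> bool}) (h (fun i => sg R (e i)))%:E * (\1_(pattern_set e) w)%:E)%E) //.
- rewrite ge0_integral_sum //.
  + rewrite /avgS mulr_suml -sumEFin; apply: eq_bigr => e _.
    have [mA PA] := pattern_prob e.
    rewrite ge0_integralZl_EFin //.
    * rewrite integral_indic // setIT.
      apply: (eq_trans (congr1 (fun z => (h (fun i => sg R (e i)))%:E * z)%E PA)).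
      by rewrite -EFinM card_ord.
    * by apply/measurable_EFinP; exact: measurable_indic.
  + move=> e; apply: emeasurable_funM; first exact: measurable_cst.
    by apply/measurable_EFinP; apply: measurable_indic; exact: (pattern_prob e).1.
  + by move=> e w _; rewrite mule_ge0 ?lee_fin.
- by move=> w; rewrite lee_fin.
- by move=> w; apply: sume_ge0 => e _; rewrite mule_ge0 ?lee_fin.
move=> w Nw; pose ew : {ffun 'I_M.*2.+1 -> bool} := [ffun i => X (sym_idx i) w == -1].
have ewE i : X (sym_idx i) w = sg R (ew i).
  rewrite ffunE /sg; have [->|->] := HN w Nw (sym_idx i); last by rewrite eqxx expr1.
  by rewrite -subr_eq0 opprK -[1 + 1]/(2%:R) pnatr_eq0 expr0.
rewrite (bigD1 ew) //= big1 ?adde0.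
  rewrite indicE mem_set /= ?mule1; last by move=> i; exact: ewE.
  by congr ((h _)%:E); apply/funext => i; exact: ewE.
move=> e ne; rewrite indicE memNset ?mule0 //= => H.
move/negP: ne; apply; apply/eqP/ffunP => i.
have := H i; rewrite ewE /sg; case: (e i); case: (ew i) => //=; rewrite ?expr1 ?expr0 => /eqP.
  by rewrite -subr_eq0 opprK -[1 + 1]/(2%:R) pnatr_eq0.
by rewrite eq_sym -subr_eq0 opprK -[1 + 1]/(2%:R) pnatr_eq0.
Qed.

End SignVariables.

(** * The random series *)

Section BoundedFatou.
Context {d : measure_display} {T : measurableType d} {R : realType}
  (mu : {measure set T -> \bar R}).

(** Fatou's lemma. *)
Lemma ge0_integral_cvg_le (F : nat -> T -> R) (G : T -> R) (B : \bar R) (k0 : nat) :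
  (forall k, measurable_fun setT (F k)) -> (forall k w, 0 <= F k w) ->
  (forall w, F k w @[k --> \oo] --> G w) ->
  (forall k, (k0 <= k)%N -> (\int[mu]_w (F k w)%:E <= B)%E) ->
  (\int[mu]_w (G w)%:E <= B)%E.
Proof.
move=> mF F0 FG FB.
have E w : (G w)%:E = limn_einf (fun k => (F k w)%:E).
  have : (F k w)%:E @[k --> \oo] --> (G w)%:E by apply: cvg_EFin; [exact: nearW | exact: FG].
  by move=> /cvg_limn_einf_sup[-> _].
under eq_integral do rewrite E.
apply: le_trans (fatou _ _ _ _) _ => //.
- by move=> k; apply/measurable_EFinP.
- by move=> k w _; rewrite lee_fin.
rewrite limn_einf_lim; apply: lime_le; first exact: is_cvg_einfs.
near=> k; apply: (@le_trans _ _ (\int[mu]_w (F k w)%:E)%E).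
  by apply: ereal_inf_lbound; exists k => //=.
by apply: FB; near: k; exact: nbhs_infty_ge.
Unshelve. all: by end_near. Qed.

End BoundedFatou.

Lemma pow4_block (N : nat) (J : nat) : (J ^ 4 <= N)%N ->
  exists j, [/\ (J <= j)%N, (j ^ 4 <= N)%N & (N < j.+1 ^ 4)%N].
Proof.
move=> JN.
have ub i : (i ^ 4 <= N)%N -> (i <= N)%N.
  by apply: leq_trans; case: i => // i; rewrite -{1}[i.+1]expn1 leq_pexp2l.
have [j jN jmax] := @ex_maxnP (fun i => (i ^ 4 <= N)%N) N (ex_intro _ J JN) ub.
exists j; split => //; first exact: jmax.
by rewrite ltnNge; apply/negP => /jmax; rewrite ltnn.
Qed.

Section PartialSums.
Context {d : measure_display} {T : measurableType d} {R : realType}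
  {P : probability T R}.
Variable X : int -> {RV P >-> R}.
Hypothesis hX : iid_signs X.
Variable a : int -> R.
Hypothesis aP : forall m, `|a m| <= 3 / `|m|%N.+1%:R.

Definition partial_sum (N : nat) (w : T) : R := ssum N (fun m => a m * X m w).

Lemma measurable_partial_sum N : measurable_fun setT (partial_sum N).
Proof.
rewrite /partial_sum /ssum; apply: measurable_sum => k.
by apply: measurable_funM; [exact: measurable_cst | exact: measurable_X].
Qed.

Lemma partial_sum_expectation N (g : R -> R) : (forall x, 0 <= g x) ->
  (\int[P]_w (g (partial_sum N w))%:E = (sign_avg N a g)%:E)%E.
Proof.
move=> g0.
rewrite -(@expectation_pattern _ _ _ _ _ hX N (fun y => g (\sum_i a (sym_idx i) * y i))) //.
by apply: eq_integral => w _; rewrite /partial_sum ssum_ord.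
Qed.

(** The second moment of a sum of independent signs is the sum of the
    squares of its coefficients. *)
Lemma partial_sum_increment M N : (M <= N)%N ->
  (\int[P]_w ((partial_sum N w - partial_sum M w) ^+ 2)%:E <= (36 / M.+1%:R)%:E)%E.
Proof.
move=> MN; pose b m := if (`|m| <= M)%N then 0 else a m.
have E w : partial_sum N w - partial_sum M w = \sum_(i < N.*2.+1) b (sym_idx i) * X (sym_idx i) w.
  rewrite /partial_sum -(ssum_trunc (fun m => a m * X m w) MN) !ssum_ord -sumrB.
  apply: eq_bigr => i _; rewrite -/(sym_idx i) /b; case: ifP => _; rewrite ?mul0r ?subrr ?subr0 //.
under eq_integral do rewrite E.
have := @expectation_pattern _ _ _ _ _ hX N (fun y => (\sum_i b (sym_idx i) * y i) ^+ 2) (fun y => sqr_ge0 _).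
move=> ->; rewrite lee_fin avgS_sqr -(ssum_ord N (fun m => b m ^+ 2)).
pose g j : R := if (j <= M)%N then 0 else 9 * (j.+1%:R ^+ 2)^-1.
apply: (@le_trans _ _ (ssum N (fun m => g `|m|%N))).
  apply: ler_ssum => m _; rewrite /g /b; case: ifP => _; first by rewrite expr0n.
  rewrite -[leLHS]real_normK ?num_real //.
  apply: (@le_trans _ _ ((3 / `|m|%N.+1%:R) ^+ 2)); first by rewrite lerXn2r ?nnegrE ?divr_ge0.
  by rewrite expr_div_n; have -> : 3 ^+ 2 = 9 :> R by ring.
have -> : 36 = 4 * 9 :> R by ring.
exact: ssum_tail_le.
Qed.

Definition block (j : nat) (w : T) : R := partial_sum (j.+1 ^ 4) w - partial_sum (j ^ 4) w.

(** With J = (j + 1)^2, |x| <= J x^2 / 2 + 1 / (2 J). The second moment of a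
    block is O(J^-2), so its first moment is O(1 / J), which is summable. *)
Lemma block_L1 j : (\int[P]_w `|block j w|%:E <= (145 * (j.+1%:R ^+ 2)^-1)%:E)%E.
Proof.
pose J : R := j.+1%:R ^+ 2.
have J0 : 0 < J by rewrite exprn_gt0 // ltr0n.
have mblk : measurable_fun setT (block j).
  by apply: measurable_funB; exact: measurable_partial_sum.
apply: (@le_trans _ _ (\int[P]_w ((J / 2)%:E * ((block j w) ^+ 2)%:E + (J^-1 / 2)%:E))%E).
  apply: ge0_le_integral => //.
  - by apply/measurable_EFinP; exact: measurableT_comp.
  - apply: emeasurable_funD; last exact: measurable_cst.
    apply: emeasurable_funM; first exact: measurable_cst.
    by apply/measurable_EFinP; exact: measurable_funX.
  move=> w _; rewrite -EFinM -EFinD lee_fin.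
  rewrite -[in leRHS]real_normK ?num_real //; move: `|_| (normr_ge0 (block j w)) => x x0.
  rewrite -subr_ge0.
  have -> : J / 2 * x ^+ 2 + J^-1 / 2 - x = (J * x - 1) ^+ 2 / (2 * J) by field; rewrite gt_eqF.
  by rewrite divr_ge0 ?sqr_ge0 // mulr_ge0 // ltW.
rewrite ge0_integralD //; last 3 first.
- by move=> w _; rewrite mule_ge0 // lee_fin ?sqr_ge0 // divr_ge0 // ltW.
- apply: emeasurable_funM; first exact: measurable_cst.
  by apply/measurable_EFinP; exact: measurable_funX.
- by move=> w _; rewrite lee_fin divr_ge0 // invr_ge0 ltW.
rewrite ge0_integralZl_EFin //; last 3 first.
- by move=> w _; rewrite lee_fin sqr_ge0.
- by apply/measurable_EFinP; exact: measurable_funX.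
- by rewrite divr_ge0 // ltW.
rewrite integral_cst // [X in (_ + _ * X)%E](_ : _ = 1%E); last exact: probability_setT.
rewrite mule1.
have inc : (\int[P]_w ((block j w) ^+ 2)%:E <= (36 / (j ^ 4).+1%:R)%:E)%E.
  by apply: partial_sum_increment; rewrite leq_exp2r.
apply: le_trans (leeD (lee_wpmul2l _ inc) (lexx _)) _.
  by rewrite lee_fin divr_ge0 // ltW.
rewrite -EFinM -EFinD lee_fin -/J.
have h : 36 / (j ^ 4).+1%:R <= 288 / J ^+ 2.
  rewrite ler_pdivrMr ?ltr0n // mulrAC ler_pdivlMr ?exprn_gt0 //.
  rewrite /J -exprM -natrX -!natrM ler_nat.
  have sq (x : nat) : (x.+1 ^ 2 <= 2 * (x ^ 2).+1)%N by rewrite -!mulnn; clear; nia.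
  have : (j.+1 ^ 4 <= 8 * (j ^ 4).+1)%N.
    rewrite -[4%N]/(2 * 2)%N !expnM; have := sq j; have := sq (j ^ 2)%N.
    by move: (j.+1 ^ 2)%N (j ^ 2)%N => x y; rewrite -!mulnn; clear; nia.
  by clear; lia.
apply: (@le_trans _ _ (J / 2 * (288 / J ^+ 2) + J^-1 / 2)).
  by rewrite lerD2r ler_wpM2l // divr_ge0 // ltW.
have -> : J / 2 * (288 / J ^+ 2) + J^-1 / 2 = 289 / 2 * J^-1 by field; rewrite gt_eqF.
by rewrite ler_pM2r ?invr_gt0 //; lra.
Qed.

Lemma partial_sum_gap M k w : (forall m, `|X m w| <= 1) ->
  `|partial_sum (M + k) w - partial_sum M w| <= k%:R * (6 / M.+1%:R).
Proof.
move=> Xw; elim: k => [|k IH]; first by rewrite addn0 subrr normr0 mul0r.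
rewrite addnS {1}/partial_sum ssumS -/(partial_sum _ _) addrAC.
apply: le_trans (ler_normD _ _) _; rewrite -natr1 mulrDl mul1r; apply: lerD => //.
apply: le_trans (ler_normD _ _) _; rewrite !normrM.
have h (m : int) : (M < `|m|)%N -> `|a m| * `|X m w| <= 3 / M.+1%:R.
  move=> Mm; rewrite -[leRHS]mulr1; apply: ler_pM => //.
  apply: le_trans (aP m) _; rewrite ler_wpM2l // lef_pV2 ?posrE ?ltr0n // ler_nat.
  by apply: ltnW.
have -> : 6 / M.+1%:R = 3 / M.+1%:R + 3 / M.+1%:R :> R by rewrite -mulrDl; congr (_ / _); ring.
by apply: lerD; apply: h; lia.
Qed.

(** Along M = j^4 the increments have summable first moments, so that their
    absolute values are almost surely summable. Between j^4 and (j + 1)^4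
    there are O(j^3) further indices, each contributing O(j^-4), whence a
    deterministic O(1 / j). *)
Lemma partial_sum_as_cvg : exists N : set T, [/\ measurable N, P N = 0%E &
  forall w, ~ N w -> (forall m, `|X m w| <= 1) /\ cvgn (fun n => partial_sum n w)].
Proof.
have mblk j : measurable_fun setT (block j).
  by apply: measurable_funB; exact: measurable_partial_sum.
pose S w : \bar R := (\sum_(j <oo) `|block j w|%:E)%E.
have S0 w : (0 <= S w)%E by apply: nneseries_ge0 => j _ _; rewrite lee_fin.
have mS : measurable_fun setT S.
  apply: (@ge0_emeasurable_sum _ _ _ setT (fun j w => `|block j w|%:E) xpredT).
    by move=> j w _ _; rewrite lee_fin.
  by move=> j _; apply/measurable_EFinP; exact: measurableT_comp.
have intS : (\int[P]_w S w <= 290%:E)%E.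
  rewrite /S integral_nneseries //; last first.
    by move=> j; apply/measurable_EFinP; exact: measurableT_comp.
  apply: lime_le.
    by apply: is_cvg_nneseries => j _ _; apply: integral_ge0 => w _; rewrite lee_fin.
  apply: nearW => k.
  apply: (@le_trans _ _ (\sum_(0 <= j < k) (145 * (j.+1%:R ^+ 2)^-1)%:E)%E).
    by apply: lee_sum => j _; exact: block_L1.
  rewrite sumEFin lee_fin -mulr_sumr.
  have := @sum_invsq_le R 0 k; rewrite divr1 => h.
  have -> : 290 = 145 * 2 :> R by ring.
  by rewrite ler_wpM2l.
have iS : P.-integrable setT S.
  apply/integrableP; split => //.
  under eq_integral do rewrite gee0_abs //.
  by apply: le_lt_trans intS _; rewrite ltry.
have [N1 [mN1 N10 sN1]] := integrable_ae measurableT iS.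
have [N2 [mN2 N20 HN2]] := good_signs hX.
exists (N1 `|` N2); split.
- exact: measurableU.
- exact: null_set_setU.
move=> w Nw.
have X1 m : `|X m w| <= 1.
  have Nw2 : ~ N2 w by move=> h; apply: Nw; right.
  by case: (HN2 w Nw2 m) => ->; rewrite ?normrN normr1.
split => //.
have Sfin : S w \is a fin_num.
  apply: contrapT => h; apply: Nw; left; apply: sN1 => /=.
  by move=> H; apply: h; apply: H.
have c1 : cvgn [normed series (fun j => block j w)].
  apply: nondecreasing_is_cvgn.
    by apply: (@nondecreasing_series _ (fun j => `|block j w|) xpredT 0%N) => n _ _.
  exists (fine (S w)) => _ [n _ <-] /=.
  rewrite -lee_fin fineK // /series /= -sumEFin.
  by apply: nneseries_lim_ge => j _ _; rewrite lee_fin.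
have /cvg_ex[l cl] := normed_cvg c1.
have tel n : series (fun j => block j w) n = partial_sum (n ^ 4) w - partial_sum 0 w.
  rewrite /series /= (telescope_sumr_eq (fun j => partial_sum (j ^ 4) w)) //.
apply/cvg_ex; exists (l + partial_sum 0 w).
apply/cvgrPdist_le => e e0.
have e2 : 0 < e / 2 by rewrite divr_gt0.
have /cvgrPdist_le/(_ _ e2)[J1 _ HJ1] := cl.
pose J := (J1 + Num.bound (180 / e)).+1.
exists (J ^ 4)%N => // n /= Jn.
have [j [Jj jn nj]] := pow4_block Jn.
have j0 : (0 < j)%N by apply: leq_trans Jj.
have h1 : `|l + partial_sum 0 w - partial_sum (j ^ 4) w| <= e / 2.
  have := HJ1 j; rewrite /= tel => /(_ _).
  rewrite opprB addrA; apply.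
  by apply: leq_trans Jj; rewrite /J; clear; lia.
have h2 : `|partial_sum (j ^ 4) w - partial_sum n w| <= e / 2.
  rewrite distrC -[n in partial_sum n w](subnKC jn).
  apply: le_trans (partial_sum_gap _ _ X1) _.
  have jr : 0 < j%:R :> R by rewrite ltr0n.
  apply: (@le_trans _ _ (90 / j%:R)).
    rewrite mulrA ler_pdivrMr ?ltr0n // mulrAC ler_pdivlMr // -!natrM ler_nat.
    have : (n - j ^ 4 <= 15 * j ^ 3)%N.
      have h : (j.+1 ^ 4 <= j ^ 4 + 15 * j ^ 3)%N.
        have e4 : (j.+1 ^ 4 = j ^ 4 + (4 * j ^ 3 + 6 * (j * j) + 4 * j + 1))%N.
          by rewrite !expnS !expn0 !muln1; clear; ring.
        rewrite e4 leq_add2l !expnS expn0 muln1; clear -j0; nia.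
      by move: nj h; clear; lia.
    move: (n - j ^ 4)%N => r hr; clear -hr.
    by rewrite expnS; move: (j ^ 3)%N hr => c hr; nia.
  rewrite ler_pdivrMr // mulrAC ler_pdivlMr // mulrC -[e * _]mulrC -ler_pdivrMr //.
  have -> : 2 * 90 = 180 :> R by ring.
  apply/ltW/(lt_le_trans (archi_boundP _)); first by rewrite divr_ge0 // ltW.
  by rewrite ler_nat; apply: leq_trans Jj; apply: leqW; exact: leq_addl.
have -> : l + partial_sum 0 w - partial_sum n w = (l + partial_sum 0 w - partial_sum (j ^ 4) w) + (partial_sum (j ^ 4) w - partial_sum n w) by ring.
by apply: le_trans (ler_normD _ _) _; rewrite [leRHS]splitr lerD.
Qed.

End PartialSums.

Section LimitExpectation.
Context {d : measure_display} {T : measurableType d} {R : realType}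
  {P : probability T R}.

Lemma integral_realD (u v : T -> R) : measurable_fun setT u -> measurable_fun setT v ->
  (forall w, 0 <= u w) -> (forall w, 0 <= v w) ->
  (\int[P]_w (u w + v w)%:E = \int[P]_w (u w)%:E + \int[P]_w (v w)%:E)%E.
Proof.
move=> mu mv u0 v0; under eq_integral do rewrite EFinD.
rewrite ge0_integralD //.
- by move=> w _; rewrite lee_fin.
- by apply/measurable_EFinP.
- by move=> w _; rewrite lee_fin.
- by apply/measurable_EFinP.
Qed.

Lemma integral_realZ (c : R) (u : T -> R) : 0 <= c -> measurable_fun setT u ->
  (forall w, 0 <= u w) -> (\int[P]_w (c * u w)%:E = c%:E * \int[P]_w (u w)%:E)%E.
Proof.
move=> c0 mu u0; under eq_integral do rewrite EFinM.
rewrite ge0_integralZl_EFin //.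
- by move=> w _; rewrite lee_fin.
- by apply/measurable_EFinP.
Qed.

Lemma le_integral_real (u v : T -> R) : measurable_fun setT u -> measurable_fun setT v ->
  (forall w, 0 <= u w) -> (forall w, u w <= v w) ->
  (\int[P]_w (u w)%:E <= \int[P]_w (v w)%:E)%E.
Proof.
move=> mu mv u0 uv; apply: ge0_le_integral => //.
- by move=> w _; rewrite lee_fin.
- by apply/measurable_EFinP.
- by apply/measurable_EFinP.
- by move=> w _; rewrite lee_fin.
Qed.

Variable X : int -> {RV P >-> R}.
Hypothesis hX : iid_signs X.
Variable q : R.
Hypothesis q0 : 0 < q.
Notation f := (fun x : R => `|x| `^ q).

Lemma measurable_powR_norm (u : T -> R) : measurable_fun setT u ->
  measurable_fun setT (fun w => `|u w| `^ q).
Proof.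
move=> mu; apply: (measurableT_comp (measurable_powR q)).
exact: measurableT_comp.
Qed.

(** The comparison inequality [powR_diff_bound] for the limit L and the
    partial sum of order M: the n-th moments are bounded uniformly, and the
    second moment of the difference is O(1 / M), both passing to the limit
    by Fatou's lemma. The threshold M0 depends on the bound on the
    coefficients only, hence the uniformity in s later on. *)
Lemma limit_expectation (eps : R) : 0 < eps -> exists M0 : nat, forall M, (M0 <= M)%N ->
  forall (a : int -> R) (N : set T) (L : T -> R),
  (forall m, `|a m| <= 3 / `|m|%N.+1%:R) -> measurable N -> P N = 0%E ->
  measurable_fun setT L -> (forall w, N w -> L w = 0) ->
  (forall w, ~ N w -> partial_sum X a n w @[n --> \oo] --> L w) ->
  exists r : R, [/\ (\int[P]_w (f (L w))%:E = r%:E)%E, 0 <= r & `|r - sign_avg M a f| <= eps].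
Proof.
move=> eps0.
pose n := (Num.bound q).*2.
have nodd : ~~ odd n by rewrite odd_double.
have qn : q < n%:R.
  apply: lt_le_trans (archi_boundP (ltW q0)) _; rewrite ler_nat /n -addnn leq_addr //.
pose K : R := 2 * n`!%:R * expR (2 * (4 * 3 ^+ 2)).
have K0 : 0 <= K by rewrite !mulr_ge0 // expR_ge0.
pose eta := eps / (2 * (1 + K + K)).
have den0 : 0 < 2 * (1 + K + K) by lra.
have eta0 : 0 < eta by rewrite divr_gt0.
have [C C0 HC] := powR_diff_bound q0 nodd qn eta0.
exists (Num.bound (C * 36 * 2 / eps)) => M M0M a N L aP mN N0 mL LN SL.
have en (z : R) : z ^+ n = `|z| ^+ n by rewrite -normrX ger0_norm // exprn_even_ge0.
(* Cutting off on N makes convergence hold everywhere without changing the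
   expectations. *)
pose S k w := partial_sum X a k w * \1_(~` N) w.
have mS k : measurable_fun setT (S k).
  apply: measurable_funM; first exact: measurable_partial_sum.
  by apply: measurable_indic; exact: measurableC.
have SE k w : ~ N w -> S k w = partial_sum X a k w.
  by move=> Nw; rewrite /S indicE mem_set ?mulr1.
have S0 k w : N w -> S k w = 0.
  by move=> Nw; rewrite /S indicE memNset ?mulr0 //=; apply/not_notP.
have cS w : S k w @[k --> \oo] --> L w.
  have [Nw|Nw] := pselect (N w).
    rewrite LN //; under eq_fun do rewrite S0 //; exact: cvg_cst.
  under eq_fun do rewrite SE //; exact: SL.
have SI g k : (forall x, 0 <= g x) -> (\int[P]_w (g (S k w))%:E = (sign_avg k a g)%:E)%E.
  move=> g0; rewrite -(partial_sum_expectation hX) //.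
  apply: (@ge0_integral_eq_off_null _ _ _ P N) => //.
  - by move=> w; rewrite lee_fin.
  - by move=> w; rewrite lee_fin.
  by move=> w Nw; rewrite SE.
have Smom k : (\int[P]_w (`|S k w| ^+ n)%:E <= K%:E)%E.
  rewrite (SI (fun x => `|x| ^+ n)); last by move=> x; rewrite exprn_ge0.
  by rewrite lee_fin; apply: sign_avg_moment => // m _; exact: aP.
have mSn k : measurable_fun setT (fun w => `|S k w| ^+ n).
  by apply: measurable_funX; exact: measurableT_comp.
have mLn : measurable_fun setT (fun w => `|L w| ^+ n).
  by apply: measurable_funX; exact: measurableT_comp.
have Lmom : (\int[P]_w (`|L w| ^+ n)%:E <= K%:E)%E.
  apply: (@ge0_integral_cvg_le _ _ _ P (fun k w => `|S k w| ^+ n) _ _ 0%N) => [//|k w|w|//].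
    by rewrite exprn_ge0.
  have c : `|S k w| @[k --> \oo] --> `|L w| by apply: cvg_norm; exact: cS.
  exact: (cvg_comp _ _ c (@exprn_continuous R n _)).
have mD k : measurable_fun setT (fun w => (S k w - S M w) ^+ 2).
  by apply: measurable_funX; exact: measurable_funB.
have mLD : measurable_fun setT (fun w => (L w - S M w) ^+ 2).
  by apply: measurable_funX; exact: measurable_funB.
have LD : (\int[P]_w ((L w - S M w) ^+ 2)%:E <= (36 / M.+1%:R)%:E)%E.
  apply: (@ge0_integral_cvg_le _ _ _ P (fun k w => (S k w - S M w) ^+ 2) _ _ M) => [//|k w|w|k Mk].
  - by rewrite sqr_ge0.
  - have c : S k w - S M w @[k --> \oo] --> L w - S M w.
      by apply: cvgB; [exact: cS | exact: cvg_cst].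
    exact: (cvg_comp _ _ c (@exprn_continuous R 2 _)).
  apply: le_trans (partial_sum_increment hX aP Mk).
  rewrite (@ge0_integral_eq_off_null _ _ _ P N _ (fun w => ((partial_sum X a k w - partial_sum X a M w) ^+ 2)%:E)) //.
  - by move=> w; rewrite lee_fin sqr_ge0.
  - by move=> w; rewrite lee_fin sqr_ge0.
  by move=> w Nw; rewrite !SE.
pose Z w := eta * ((1 + `|L w| ^+ n) + `|S M w| ^+ n) + C * (L w - S M w) ^+ 2.
have mc : measurable_fun setT (fun _ : T => 1 : R) by exact: measurable_cst.
have mZ1 : measurable_fun setT (fun w => (1 + `|L w| ^+ n) + `|S M w| ^+ n).
  by apply: measurable_funD => //; apply: measurable_funD.
have mZ : measurable_fun setT Z.
  by apply: measurable_funD; apply: measurable_funM => //; exact: measurable_cst.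
have z1 w : 0 <= 1 + `|L w| ^+ n by rewrite addr_ge0 // exprn_ge0.
have z2 w : 0 <= (1 + `|L w| ^+ n) + `|S M w| ^+ n by rewrite addr_ge0 // exprn_ge0.
have z3 w : 0 <= (L w - S M w) ^+ 2 by rewrite sqr_ge0.
have Z0 w : 0 <= Z w by rewrite addr_ge0 // mulr_ge0 // ltW.
have IZ : (\int[P]_w (Z w)%:E <= eps%:E)%E.
  have m1 : measurable_fun setT (fun w => 1 + `|L w| ^+ n) by exact: measurable_funD.
  rewrite integral_realD //; first last.
  - by move=> w; rewrite mulr_ge0.
  - by move=> w; rewrite mulr_ge0 // ltW.
  - by apply: measurable_funM => //; exact: measurable_cst.
  - by apply: measurable_funM => //; exact: measurable_cst.
  rewrite (integral_realZ (ltW eta0)) // (integral_realZ C0) //.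
  rewrite integral_realD // integral_realD //.
  rewrite integral_cst // [X in (1%:E * X)%E](_ : _ = 1%E); last exact: probability_setT.
  rewrite mule1.
  have h1 : (1 + \int[P]_w (`|L w| ^+ n)%:E + \int[P]_w (`|S M w| ^+ n)%:E <= (1 + K + K)%:E)%E.
    by rewrite !EFinD; apply: leeD => //; apply: leeD.
  have e1 : (0 <= eta%:E)%E by rewrite lee_fin ltW.
  have e2 : (0 <= C%:E)%E by rewrite lee_fin.
  apply: le_trans (leeD (lee_wpmul2l e1 h1) (lee_wpmul2l e2 LD)) _.
  rewrite -!EFinM -EFinD lee_fin.
  have -> : eta * (1 + K + K) = eps / 2 by rewrite /eta; field; lra.
  rewrite [leRHS]splitr lerD2l.
  rewrite mulrA ler_pdivrMr ?ltr0n // mulrAC ler_pdivlMr // -[eps * _]mulrC -ler_pdivrMr //.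
  apply/ltW/(lt_le_trans (archi_boundP _)); first by rewrite divr_ge0 ?mulr_ge0 // ltW.
  by rewrite ler_nat; exact: leqW.
have key w : `|f (L w) - f (S M w)| <= Z w.
  by have := HC (L w) (S M w); rewrite /Z (en (L w)) (en (S M w)).
have fge0 x : 0 <= f x by exact: powR_ge0.
have mfL := measurable_powR_norm mL.
have mfS := measurable_powR_norm (mS M).
have up : (\int[P]_w (f (L w))%:E <= (sign_avg M a f)%:E + eps%:E)%E.
  apply: (@le_trans _ _ (\int[P]_w (f (S M w) + Z w)%:E)%E).
    apply: le_integral_real => //; first exact: measurable_funD.
    by move=> w; have := key w; rewrite ler_norml => /andP[_]; rewrite lerBlDl.
  by rewrite integral_realD // (SI f) //; apply: leeD.
have dn : ((sign_avg M a f)%:E <= \int[P]_w (f (L w))%:E + eps%:E)%E.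
  rewrite -(SI f) //.
  apply: (@le_trans _ _ (\int[P]_w (f (L w) + Z w)%:E)%E).
    apply: le_integral_real => //; first exact: measurable_funD.
    by move=> w; have := key w; rewrite distrC ler_norml => /andP[_]; rewrite lerBlDl.
  by rewrite integral_realD //; apply: leeD.
have I0 : (0 <= \int[P]_w (f (L w))%:E)%E.
  by apply: integral_ge0 => w _; rewrite lee_fin.
move: up dn I0; case: (\int[P]_w (f (L w))%:E)%E => [r||] //.
rewrite -!EFinD !lee_fin => up dn r0; exists r; split => //.
by rewrite ler_norml; apply/andP; split; lra.
Qed.

End LimitExpectation.

(** * Moments of the process *)

Section ProcessMoment.
Context {d : measure_display} {T : measurableType d} {R : realType}
  {P : probability T R}.
Variable X : int -> {RV P >-> R}.
Hypothesis hX : iid_signs X.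
Notation normc := Normc.normc.

Definition phase (t : R) : R[i] := (- sin (pi * t) +i* cos (pi * t)) / 'i%C.

Lemma normc_phase t : normc (phase t) = 1.
Proof.
have i1 : normc 'i%C = 1 :> R by rewrite /= expr0n expr1n add0r sqrtr1.
have h : normc (phase t) * normc 'i%C = 1.
  rewrite -Normc.normcM /phase divfK; last by apply/negP => /eqP h; move: i1; rewrite h Normc.normc0 => /eqP; rewrite eq_sym oner_eq0.
  by rewrite /= sqrrN addrC cos2Dsin2 sqrtr1.
by rewrite i1 mulr1 in h.
Qed.

(** From e(t) - 1 = 2 sin(pi t) (- sin(pi t) + i cos(pi t)). *)
Lemma coef_phase (t : R) m : 0 < t -> t < 1 -> coef t m = phase t * (limit_coef t m)%:C.
Proof.
move=> t0 t1; have d0 := dist_int_gt0 m t0 t1.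
have mt : m%:~R - t != 0 by rewrite -normr_gt0.
rewrite /coef ifF; last by rewrite eq_sym -subr_eq0 (negPf mt).
rewrite e_half /phase /limit_coef; have pi0 : pi != 0 :> R by rewrite gt_eqF // pi_gt0.
set dt := m%:~R - t in mt *; set w := (_ +i* _).
have -> : sin (pi * t) / (pi * dt) = (2 * sin (pi * t)) / (2 * pi * dt).
  by rewrite -[2 * pi * dt]mulrA -mulf_div divff ?mul1r // pnatr_eq0.
rewrite [RHS]mulrC; have -> : (2 * sin (pi * t) / (2 * pi * dt))%:C = (2 * sin (pi * t))%:C / ((2 * pi)%:C * dt%:C) :> R[i].
  by rewrite -(rmorphM (real_complex R)); exact: (fmorph_div (real_complex R)).
rewrite !invfM.
have comR (a b g i z : R[i]) : a * b * (g * i * z) = a * (g * z) * (b * i) by ring.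
exact: comR.
Qed.

Lemma GX_partialE (t : R) w M : 0 < t -> t < 1 ->
  GX_partial X t w M = phase t * (partial_sum X (limit_coef t) M w)%:C.
Proof.
move=> t0 t1; rewrite /GX_partial /partial_sum /ssum (rmorph_sum (real_complex R)) mulr_sumr.
apply: eq_bigr => k _.
rewrite coef_phase // -mulrA; congr (_ * _); exact/esym/(rmorphM (real_complex R)).
Qed.

Lemma cvg_complex (u : R[i]) (s : nat -> R) (l : R) : s n @[n --> \oo] --> l ->
  (u * (s n)%:C : (R[i] : numFieldType)) @[n --> \oo] --> (u * l%:C : (R[i] : numFieldType)).
Proof.
move=> sl; apply: cvgMr.
apply/cvgrPdist_lt => e e0.
have [er ei] : 0 < complex.Re e /\ e = (complex.Re e)%:C.
  move: e0; case: e => a b; rewrite ltcE /= => /andP[/eqP b0 a0]; split => //.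
  by rewrite b0.
have /cvgrPdist_lt/(_ _ er) := sl; apply: filterS => n h.
by rewrite ei -rmorphB normc_def /= expr0n addr0 sqrtr_sqr ltcR.
Qed.

Lemma GX_lim (t : R) w (l : R) : 0 < t -> t < 1 ->
  partial_sum X (limit_coef t) n w @[n --> \oo] --> l -> normc (GX X t w) = `|l|.
Proof.
move=> t0 t1 sl; rewrite /GX.
have c := cvg_complex (u := phase t) sl.
have -> : [lim (GX_partial X t w M @[M --> \oo]) in (R[i] : numFieldType)] = phase t * l%:C.
  apply: cvg_lim; first exact: norm_hausdorff.
  by under eq_fun do rewrite GX_partialE //.
by rewrite Normc.normcM normc_phase mul1r /= expr0n addr0 sqrtr_sqr.
Qed.

Variable q : R.
Hypothesis q0 : 0 < q.
Notation f := (fun x : R => `|x| `^ q).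

(** [limit_expectation] for the coefficients a(t, m). Replacing the partial
    sums by 0 on the null set where they may diverge produces a measurable
    limit, equal to the process in modulus off that set. *)
Lemma GX_moment (eps : R) : 0 < eps -> exists M0 : nat, forall M, (M0 <= M)%N ->
  forall t, 0 < t -> t < 1 -> exists r : R,
  [/\ ('E_P[(fun w => normc (GX X t w) `^ q)%R] = r%:E)%E, 0 <= r &
      `|r - sign_avg M (limit_coef t) f| <= eps].
Proof.
move=> eps0; have [M0 H] := limit_expectation hX q0 eps0; exists M0 => M MM t t0 t1.
have aP m : `|limit_coef t m| <= 3 / `|m|%N.+1%:R by exact: limit_coef_le.
have [N [mN N0 HN]] := partial_sum_as_cvg hX aP.
pose S n w := partial_sum X (limit_coef t) n w * \1_(~` N) w.
pose L w := limn (S ^~ w).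
have SE k w : ~ N w -> S k w = partial_sum X (limit_coef t) k w.
  by move=> Nw; rewrite /S indicE mem_set ?mulr1.
have S0 k w : N w -> S k w = 0.
  by move=> Nw; rewrite /S indicE memNset ?mulr0 //=; apply/not_notP.
have cS w : S n w @[n --> \oo] --> L w.
  have [Nw|Nw] := pselect (N w).
    rewrite /L; have -> : S ^~ w = fun=> 0 by apply/funext => n; rewrite S0.
    exact: is_cvg_cst.
  have [_ c] := HN w Nw; rewrite /L.
  have -> : S ^~ w = fun n => partial_sum X (limit_coef t) n w by apply/funext => n; rewrite SE.
  exact: c.
have mL : measurable_fun setT L.
  apply: (@measurable_fun_cvg _ _ _ setT S) => //.
    move=> k; apply: measurable_funM; first exact: measurable_partial_sum.
    by apply: measurable_indic; exact: measurableC.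
have LN w : N w -> L w = 0.
  move=> Nw; apply: cvg_lim => //; under eq_fun do rewrite S0 //; exact: cvg_cst.
have SL w : ~ N w -> partial_sum X (limit_coef t) n w @[n --> \oo] --> L w.
  by move=> Nw; have := cS w; under eq_fun do rewrite SE //.
have [r [rE r0 rle]] := H M MM (limit_coef t) N L aP mN N0 mL LN SL.
exists r; split => //; rewrite -rE unlock.
apply: (@ge0_integral_eq_off_null _ _ _ P N) => //.
  by move=> w; rewrite /= ?lee_fin ?powR_ge0.
by move=> w Nw; rewrite (GX_lim t0 t1 (SL w Nw)).
Qed.

End ProcessMoment.

(** * Passage to the limit *)

Section UniformLimit.
Variable R : realType.
Notation mu := (@lebesgue_measure R).

Lemma continuous_integrable_oo (g : R -> R) : continuous g ->
  mu.-integrable `]0, 1[ (EFin \o g).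
Proof.
move=> cg; have := @continuous_integrable_itv R g 0 1 cg.
by apply: integrableS => //; apply: subset_itvW; rewrite bnd_simp.
Qed.

Variable psi : R -> R.

(** This is how t |-> E |G_X(t)|^q is seen to be measurable and integrable:
    it is approximated uniformly on ]0, 1[ by the continuous means of the
    Fekete polynomials. *)
Lemma uniform_limit_integrable :
  (forall eps : R, 0 < eps -> exists2 Phi : R -> R, continuous Phi &
    forall s : R, 0 < s -> s < 1 -> `|Phi s - psi s| <= eps) ->
  mu.-integrable `]0, 1[ (EFin \o psi).
Proof.
move=> H.
have /choice[F HF] n : exists Phi : R -> R, continuous Phi /\
    forall s : R, 0 < s -> s < 1 -> `|Phi s - psi s| <= n.+1%:R^-1.
  by have [|Phi c h] := H n.+1%:R^-1; [rewrite invr_gt0 | exists Phi].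
have mpsi : measurable_fun (`]0, 1[%classic : set R) psi.
  apply: (@measurable_fun_cvg _ _ _ _ F) => [m|s].
    apply: measurable_funTS; apply: continuous_measurable_fun; exact: (HF m).1.
  rewrite /= in_itv /= => /andP[s0 s1]; apply/cvgrPdist_lt => eta eta0.
  have := near_infty_natSinv_lt (PosNum eta0); apply: filterS => n /=.
  by apply: le_lt_trans; rewrite distrC; exact: (HF n).2.
have [c0 h0] := HF 0.
apply: (@le_integrable _ _ _ mu _ _ _ (EFin \o (fun s : R => `|F 0 s| + 1))) => //.
- exact/measurable_EFinP.
- move=> s; rewrite /= in_itv /= => /andP[s0 s1]; rewrite lee_fin.
  rewrite [leRHS]ger0_norm ?addr_ge0 //; have := h0 s s0 s1; rewrite invr1 => h.
  rewrite -[psi s](subKr (F 0 s)); apply: le_trans (ler_normB _ _) _.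
  by rewrite lerD2l.
- apply: continuous_integrable_oo => s; apply: cvgD; last exact: cvg_cst.
  by apply: (@continuous_comp _ _ _ (F 0) Num.norm); [exact: c0 | exact: norm_continuous].
Qed.

Lemma Rintegral_uniform_approx (Phi : R -> R) (eps : R) : continuous Phi ->
  mu.-integrable `]0, 1[ (EFin \o psi) ->
  (forall s : R, 0 < s -> s < 1 -> `|Phi s - psi s| <= eps) ->
  `|\int[mu]_(s in `[0, 1]) Phi s - \int[mu]_(s in `]0, 1[) psi s| <= eps.
Proof.
move=> cPhi ipsi H.
have iPhi : mu.-integrable `]0, 1[ (EFin \o Phi).
  exact: continuous_integrable_oo.
have -> : \int[mu]_(s in `[0, 1]) Phi s = \int[mu]_(s in `]0, 1[) Phi s.
  by rewrite /Rintegral integral_itv_bndoo //; exact: (measurable_int mu).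
rewrite -RintegralB //.
have iB : mu.-integrable `]0, 1[ (EFin \o (fun s => Phi s - psi s)).
  by have := integrableB _ iPhi ipsi; apply.
apply: le_trans (le_normr_Rintegral _ iB) _ => //.
have -> : eps = \int[mu]_(s in `]0, 1[) (cst eps s).
  have := @lebesgue_measure_itv R `]0, 1[; rewrite /= lte_fin ltr01 oppr0 adde0 => m1.
  rewrite Rintegral_cst //; have -> : fine (mu `]0, 1[%classic) = 1 by exact: (congr1 fine m1).
  by rewrite mulr1.
apply: le_Rintegral => //.
- by have := integrable_norm iB.
- by apply: continuous_integrable_oo; exact: cst_continuous.
- by move=> s; rewrite /= in_itv /= => /andP[s0 s1]; exact: H.
Qed.

End UniformLimit.

Theorem corollary1p3 (R : realType) (d : measure_display)
    (T : measurableType d) (P : probability T R)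
    (X : int -> {RV P >-> R}) (hX : iid_signs X) (q : R) (hq : 0 < q) :
  kq X q \is a fin_num /\
  (Mq q (fekete R p) / Num.sqrt (p%:R : R)
     @[p --> within [set p | prime p && odd p] \oo] --> fine (kq X q)).
Proof.
pose E t := ('E_P[(fun w => Normc.normc (GX X t w) `^ q)%R])%E.
pose psi t := fine (E t).
(* At a common truncation M, both the mean of the character sums and the
   moment of the process are within eps / 2 of the same average over signs. *)
have approx (eps : R) : 0 < eps -> exists p0 : nat, forall p, (p0 <= p)%N ->
    prime p -> odd p -> exists Phi : R -> R, [/\ continuous Phi, forall s, 0 <= Phi s,
      forall s : R, 0 < s -> s < 1 -> `|Phi s - psi s| <= eps &
      Mq q (fekete R p) / Num.sqrt p%:R =
        (\int[lebesgue_measure]_(s in `[0, 1]) Phi s) `^ q^-1].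
  move=> eps0; have e2 : 0 < eps / 2 by rewrite divr_gt0.
  have [M1 H1] := fekete_vs_signs hq e2.
  have [M2 H2] := GX_moment hX hq e2.
  pose M := maxn M1 M2.
  have [p0 H3] := H1 M (leq_maxl _ _).
  exists (maxn p0 11) => p; rewrite geq_max => /andP[pp0 p11] p_pr podd.
  have [Phi [cPhi Phi0 ePhi MPhi]] := fekete_mean p_pr podd p11 hq.
  exists Phi; split => // s s0 s1; rewrite ePhi //.
  have [r [rE r0 rle]] := H2 M (leq_maxr _ _) s s0 s1.
  rewrite /psi /E rE /= [leRHS]splitr.
  apply: le_trans (ler_distD (sign_avg M (limit_coef s) (fun x => `|x| `^ q)) _ _) _.
  by apply: lerD; [exact: H3 | rewrite distrC].
have Efin t : 0 < t -> t < 1 -> E t = (psi t)%:E.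
  move=> t0 t1; have [M0 H] := GX_moment hX hq ltr01.
  have [r [rE _ _]] := H M0 (leqnn _) t t0 t1.
  by rewrite /psi /E rE.
have psi0 t : 0 < t -> t < 1 -> 0 <= psi t.
  move=> t0 t1; have [M0 H] := GX_moment hX hq ltr01.
  have [r [rE r0 _]] := H M0 (leqnn _) t t0 t1.
  by rewrite /psi /E rE.
have ipsi : lebesgue_measure.-integrable `]0, 1[ (EFin \o psi).
  apply: uniform_limit_integrable => eps eps0.
  have [p0 H] := approx eps eps0.
  have [p pgt p_pr] := prime_above (maxn p0 2).
  move: pgt; rewrite gtn_max => /andP[pp0 p2].
  have podd : odd p by case: (even_prime p_pr) p2 => [->|].
  by have [Phi [cPhi _ hPhi _]] := H p (ltnW pp0) p_pr podd; exists Phi.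
pose I := \int[lebesgue_measure]_(s in `]0, 1[) psi s.
have I0 : 0 <= I.
  by apply: Rintegral_ge0 => t; rewrite /= in_itv /= => /andP[t0 t1]; exact: psi0.
have Ein : {in `]0, 1[%classic, EFin \o psi =1 E}.
  by move=> t; rewrite inE /= in_itv /= => /andP[t0 t1]; rewrite Efin.
have mE : measurable_fun (`]0, 1[%classic : set R) E.
  by apply: (eq_measurable_fun (EFin \o psi)) => //; exact: (measurable_int lebesgue_measure ipsi).
have kE : kq X q = (I `^ q^-1)%:E.
  rewrite /kq -poweR_EFin; congr (_ `^ _)%E.
  rewrite integral_itv_bndoo; last exact: mE.
  rewrite /I /Rintegral fineK; last exact: integrable_fin_num.
  by apply: eq_integral => t tin; rewrite -[LHS]Ein.
rewrite kE; split => //=.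
have cpow : continuous (fun t : R => `|t| `^ q^-1).
  apply: continuous_powR; [by rewrite invr_gt0 | by [] | exact: norm_continuous].
rewrite -[I]ger0_norm //.
apply/cvgrPdist_le => eps eps0.
have /cvgrPdist_le/(_ eps eps0) := cpow I.
move=> /nbhs_ballP[delta /= delta0 hd].
have [p0 H] := approx _ (divr_gt0 delta0 (ltr0n R 2)).
exists p0 => // p /= pp0 /andP[p_pr podd].
have [Phi [cPhi Phi0 hPhi ->]] := H p pp0 p_pr podd.
have hI := Rintegral_uniform_approx cPhi ipsi hPhi.
have J0 : 0 <= \int[lebesgue_measure]_(s in `[0, 1]) Phi s by apply: Rintegral_ge0.
rewrite -(ger0_norm J0); apply: hd; rewrite /ball /= distrC.
by apply: le_lt_trans hI _; rewrite ltr_pdivrMr // ltr_pMr // ltr1n.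
Qed.
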